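(* (a) Reflection functors preserve the class of quiver linear free divisors: if $(Q,d)$ defines a linear free divisor, $k\in Q_0$ is a source or a sink of $Q$, and $(Q^*,d^* )$ is obtained from $(Q,d)$ by the reflection at $k$, then $(Q^*,d^* )$ defines a linear free divisor. (b) Modulo reflection functors and adding arrows with associated head and tail dimensions equal to $1$ (that is, for the equivalence relation on quiver linear free divisors generated by these operations), each equivalence class contains a divisor represented by an oriented bipartite graph, i.e. a divisor defined by a pair $(Q,d)$ for which $Q$ is an oriented bipartite graph.
   Context: Linear free divisors: for a reduced hypersurface $D\subset V=\mathbb{A}^n_{\mathbb{C}}$, $\mathrm{Der}(-\log D)$ is the sheaf of vector fields $\delta$ with $\delta(f)\in(f)$ for a local reduced equation $f$ of $D$. $D$ is a linear free divisor if $\mathrm{Der}(-\log D)$ is freely generated over $\mathcal{O}_V$ by globally defined linear vector fields $\sum a_{ij}x_j\partial/\partial x_i$, $a_{ij}\in\mathbb{C}$. The associated group $G$ is the largest connected subgroup of $\mathrm{GL}(V)$ preserving $D$. Quivers: a quiver $Q=(Q_0,Q_1,s,t)$ has finite vertex set $Q_0$, finite arrow set $Q_1$ and source/target maps $s,t\colon Q_1\to Q_0$; all quivers are assumed connected. For $d\in\mathbb{N}^{Q_0}$, $\mathrm{Rep}(Q,d)=\bigoplus_{\alpha\in Q_1}\mathrm{Hom}(\mathbb{C}^{d_{s\alpha}},\mathbb{C}^{d_{t\alpha}})$, with $\mathrm{GL}(Q,d)=\prod_{i\in Q_0}\mathrm{GL}_{d_i}(\mathbb{C})$ acting by $(g_i)\cdot(x_\alpha)=(g_{t\alpha}x_\alpha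 g_{s\alpha}^{-1})$ through $\mathrm{PGL}(Q,d)=\mathrm{GL}(Q,d)/\mathbb{C}^*\mathrm{id}$. $d$ is sincere if all $d_i\ge1$. For $d$ sincere, $(Q,d)$ defines a linear free divisor $D$, and $D$ is called a quiver linear free divisor, if the discriminant $D$ (complement of the open orbit) in $\mathrm{Rep}(Q,d)$ is a linear free divisor with associated group $\mathrm{PGL}(Q,d)$. Reflections: let $k$ be a source (resp. sink) of $Q$. The reflected quiver $Q^*$ is obtained by reversing all arrows involving $k$, so that $k$ becomes a sink (resp. source). For a dimension vector $d$ with $d_k\le\sum_{\alpha}d_{i(\alpha)}$, the sum running over all arrows $\alpha$ involving $k$, with $i(\alpha)$ the other endpoint of $\alpha$ (a condition that holds for all $(Q,d)$ defining linear free divisors), $d^*$ is given by $d^*_i=d_i$ for $i\neq k$ and $d^*_k=\big(\sum_{\alpha}d_{i(\alpha)}\big)-d_k$. On representations, the reflection functor at a source $k$ replaces the space $V_k$ by the cokernel of the map $V_k\to\bigoplus_{\alpha}V_{i(\alpha)}$ (required to be injective) with the canonical maps into it, and at a sink $k$ replaces $V_k$ by the kernel of the map $\bigoplus_{\alpha}V_{i(\alpha)}\to V_k$ (required to be surjective) with the canonical maps out of it, leaving everything else unchanged. In case of equality $d_k=\sum_\alpha d_{i(\alpha)}$, i.e. $d^*_k=0$, the vertex $k$ and its arrows are deleted from $Q^*$ and $d^*$ is restricted to the remaining vertices. Adding an arrow with head and tail dimensions $1$: given $(Q,d)$ and a vertex $l$ with $d_l=1$, adjoin a new vertex $k$ with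 $d_k=1$ and one new arrow $k\to l$ or $l\to k$. Oriented bipartite graph: a quiver with a partition $Q_0=Q_0^0\sqcup Q_0^1$ such that every arrow has source in $Q_0^0$ and target in $Q_0^1$. *)

(* Defs.v *)
From HB Require Import structures.
From mathcomp Require Import all_boot all_order all_algebra.
From mathcomp Require Import mpoly.

Set Implicit Arguments.
Unset Strict Implicit.
Unset Printing Implicit Defensive.

Import GRing.Theory.
Local Open Scope ring_scope.

Section Zariski.
Variable K : fieldType.

Definition peval n (f : {mpoly K[n]}) (x : 'cV[K]_n) : K :=
  f.@[fun i => x i 0].

Definition zariski_closed n (Z : 'cV[K]_n -> Prop) : Prop :=
  exists I : {mpoly K[n]} -> Prop,
    forall x, Z x <-> (forall p, I p -> peval p x = 0).

Definition zariski_open n (U : 'cV[K]_n -> Prop) : Prop :=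
  zariski_closed (fun x => ~ U x).

Definition zariski_connected n (S : 'cV[K]_n -> Prop) : Prop :=
  (exists x, S x) /\
  ~ exists Z1 Z2 : 'cV[K]_n -> Prop,
      [/\ zariski_closed Z1 /\ zariski_closed Z2,
          forall x, S x -> Z1 x \/ Z2 x,
          forall x, S x -> ~ (Z1 x /\ Z2 x),
          exists x, S x /\ Z1 x
        & exists x, S x /\ Z2 x].

(* [G] is read as a subset of the affine space of n x n matrices; since GL_n
   is open there, this induces on subsets of GL_n their usual topology. *)
Definition connected_matrices n (G : 'M[K]_n -> Prop) : Prop :=
  zariski_connected (fun v : 'cV[K]_(n * n) => G (vec_mx v^T)).

Definition GL_subgroup n (G : 'M[K]_n -> Prop) : Prop :=
  [/\ forall A, G A -> A \in unitmx,
      G 1%:M,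
      forall A B, G A -> G B -> G (A *m B)
    & forall A, G A -> G (invmx A)].

Definition preserves n (G : 'M[K]_n -> Prop) (D : 'cV[K]_n -> Prop) : Prop :=
  forall A, G A -> forall x, D (A *m x) <-> D x.

Definition is_associated_group n (D : 'cV[K]_n -> Prop)
    (G : 'M[K]_n -> Prop) : Prop :=
  [/\ GL_subgroup G, connected_matrices G, preserves G D
    & forall H : 'M[K]_n -> Prop,
        GL_subgroup H -> connected_matrices H -> preserves H D ->
        forall A, H A -> G A].

End Zariski.

Section LinearFreeDivisor.
Variable K : fieldType.

Definition pdivides n (f g : {mpoly K[n]}) : Prop := exists q, g = q * f.

(* [f] generates a nonzero radical ideal and [D] is its zero set.  Units are
   allowed, so that the empty divisor has the reduced equation [1]. *)
Definition reduced_equation n (D : 'cV[K]_n -> Prop) (f : {mpoly K[n]}) : Prop :=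
  [/\ f != 0,
      forall (g : {mpoly K[n]}) m, pdivides f (g ^+ m) -> pdivides f g
    & forall x, D x <-> peval f x = 0].

(* The vector field with components [delta i 0] applied to [f]. *)
Definition vf_apply n (delta : 'cV[{mpoly K[n]}]_n) (f : {mpoly K[n]}) :
    {mpoly K[n]} :=
  \sum_i delta i 0 * f^`M(i).

(* Global sections of Der(-log D) for D = V(f); as D is a hypersurface of
   affine space, they determine this coherent sheaf. *)
Definition logarithmic n (f : {mpoly K[n]}) (delta : 'cV[{mpoly K[n]}]_n) :
    Prop :=
  pdivides f (vf_apply delta f).

Definition linear_vf n (A : 'M[K]_n) : 'cV[{mpoly K[n]}]_n :=
  \col_i \sum_j A i j *: 'X_j.

Definition linear_free_divisor n (D : 'cV[K]_n -> Prop) : Prop :=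
  exists2 f : {mpoly K[n]}, reduced_equation D f &
  exists m (A : 'I_m -> 'M[K]_n),
    (forall l, logarithmic f (linear_vf (A l))) /\
    (forall delta, logarithmic f delta ->
       exists! c : 'rV[{mpoly K[n]}]_m,
         delta = \sum_l c 0 l *: linear_vf (A l)).

End LinearFreeDivisor.

Record quiver := Quiver {
  vertex : finType;
  arrow : finType;
  src : arrow -> vertex;
  tgt : arrow -> vertex }.

Record dquiver := DQuiver {
  dq_quiver :> quiver;
  dvec : vertex dq_quiver -> nat }.

Section Quivers.
Local Open Scope nat_scope.

Definition adjacent (Q : quiver) : rel (vertex Q) :=
  fun i j => [exists a : arrow Q,
    ((src a == i) && (tgt a == j)) || ((src a == j) && (tgt a == i))].

Definition quiver_connected (Q : quiver) : Prop :=
  0 < #|vertex Q| /\ forall i j : vertex Q, connect (@adjacent Q) i j.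

Definition sincere (P : dquiver) : Prop := forall i : vertex P, 0 < dvec i.

Definition oriented_bipartite (Q : quiver) : Prop :=
  exists A : {set vertex Q},
    forall a : arrow Q, src a \in A /\ tgt a \in ~: A.

Definition is_source (Q : quiver) (k : vertex Q) : Prop :=
  forall a : arrow Q, tgt a != k.

Definition is_sink (Q : quiver) (k : vertex Q) : Prop :=
  forall a : arrow Q, src a != k.

Definition involves (Q : quiver) (k : vertex Q) (a : arrow Q) : bool :=
  (src a == k) || (tgt a == k).

Definition other_end (Q : quiver) (k : vertex Q) (a : arrow Q) : vertex Q :=
  if src a == k then tgt a else src a.

Definition neighbour_dim (P : dquiver) (k : vertex P) : nat :=
  \sum_(a : arrow P | involves k a) dvec (other_end k a).

Definition reverse_at (Q : quiver) (k : vertex Q) : quiver :=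
  @Quiver (vertex Q) (arrow Q)
    (fun a => if involves k a then tgt a else src a)
    (fun a => if involves k a then src a else tgt a).

Definition delete_vertex (P : dquiver) (k : vertex P) : dquiver :=
  @DQuiver
    (@Quiver {i : vertex P | i != k}
       {a : arrow P | (src a != k) && (tgt a != k)}
       (fun a => exist _ (src (val a)) (proj1 (andP (valP a))))
       (fun a => exist _ (tgt (val a)) (proj2 (andP (valP a)))))
    (fun i => dvec (val i)).

Definition reflected_dim (P : dquiver) (k i : vertex P) : nat :=
  if i == k then neighbour_dim k - dvec k else dvec i.

(* Meaningful when [k] is a source or a sink and [dvec k <= neighbour_dim k]. *)
Definition reflection (P : dquiver) (k : vertex P) : dquiver :=
  let P' := @DQuiver (reverse_at k) (reflected_dim k) in
  if neighbour_dim k == dvec k then @delete_vertex P' k else P'.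

(* The new vertex and the new arrow are both [None]; the new arrow points
   towards [l] if [b] holds and leaves [l] otherwise. *)
Definition add_arrow (P : dquiver) (l : vertex P) (b : bool) : dquiver :=
  @DQuiver
    (@Quiver (option (vertex P)) (option (arrow P))
       (fun a => if a is Some a' then Some (src a')
                 else if b then None else Some l)
       (fun a => if a is Some a' then Some (tgt a')
                 else if b then Some l else None))
    (fun i => if i is Some i' then dvec i' else 1).

Definition dquiver_iso (P P' : dquiver) : Prop :=
  exists (f0 : vertex P -> vertex P') (f1 : arrow P -> arrow P'),
    [/\ bijective f0, bijective f1,
        forall a, src (f1 a) = f0 (src a),
        forall a, tgt (f1 a) = f0 (tgt a)
      & forall i, dvec (f0 i) = dvec i].

End Quivers.

Section QuiverLinearFreeDivisor.
Variables (K : fieldType) (P : dquiver).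

Definition Rep : Type :=
  forall a : arrow P, 'M[K]_(dvec (tgt a), dvec (src a)).

Definition GLfamily : Type := forall i : vertex P, 'M[K]_(dvec i).

Definition in_GL (g : GLfamily) : Prop := forall i, g i \in unitmx.

Definition rep_act (g : GLfamily) (x : Rep) : Rep :=
  fun a => g (tgt a) *m x a *m invmx (g (src a)).

Definition rep_coord : finType :=
  {a : arrow P & ('I_(dvec (tgt a)) * 'I_(dvec (src a)))%type}.

Definition rep_dim : nat := #|rep_coord|.

(* The identification of Rep(Q,d) with affine space by matrix entries. *)
Definition rep_vec (x : Rep) : 'cV[K]_rep_dim :=
  \col_i (let u : rep_coord := enum_val i in
          x (tag u) (tagged u).1 (tagged u).2).

Definition rep_orbit (x : Rep) (v : 'cV[K]_rep_dim) : Prop :=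
  exists2 g, in_GL g & v = rep_vec (rep_act g x).

Definition is_discriminant (D : 'cV[K]_rep_dim -> Prop) : Prop :=
  exists2 x : Rep, zariski_open (rep_orbit x)
    & forall v, D v <-> ~ rep_orbit x v.

(* The image of GL(Q,d), hence of PGL(Q,d), in GL(Rep(Q,d)). *)
Definition PGL_image (A : 'M[K]_rep_dim) : Prop :=
  exists2 g, in_GL g & forall x, rep_vec (rep_act g x) = A *m rep_vec x.

(* Together with [PGL_image] being the associated group, this identifies the
   latter with PGL(Q,d) itself; it excludes for instance a single vertex of
   dimension 2, where the divisor and its group are trivial but PGL is not. *)
Definition PGL_faithful : Prop :=
  forall g, in_GL g -> (forall x, rep_vec (rep_act g x) = rep_vec x) ->
  exists c : K, forall i, g i = c%:M.

Definition quiver_lfd : Prop :=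
  [/\ quiver_connected P, sincere P
    & exists D : 'cV[K]_rep_dim -> Prop,
        [/\ is_discriminant D, linear_free_divisor D,
            is_associated_group D PGL_image & PGL_faithful]].

End QuiverLinearFreeDivisor.

Section Equivalence.
Variable K : fieldType.

Definition reflection_step (P P' : dquiver) : Prop :=
  exists k : vertex P,
    [/\ is_source k \/ is_sink k, (dvec k <= neighbour_dim k)%N
      & dquiver_iso (reflection k) P'].

Definition arrow_step (P P' : dquiver) : Prop :=
  exists (l : vertex P) (b : bool),
    dvec l = 1%N /\ dquiver_iso (add_arrow l b) P'.

(* The equivalence relation on quiver linear free divisors, with pairs (Q,d)
   taken up to isomorphism, generated by the two operations. *)
Inductive lfd_equiv : dquiver -> dquiver -> Prop :=
| lfd_equiv_iso P P' : quiver_lfd K P -> quiver_lfd K P' ->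
    dquiver_iso P P' -> lfd_equiv P P'
| lfd_equiv_reflection P P' : quiver_lfd K P -> quiver_lfd K P' ->
    reflection_step P P' -> lfd_equiv P P'
| lfd_equiv_arrow P P' : quiver_lfd K P -> quiver_lfd K P' ->
    arrow_step P P' -> lfd_equiv P P'
| lfd_equiv_sym P P' : lfd_equiv P P' -> lfd_equiv P' P
| lfd_equiv_trans P P' P'' :
    lfd_equiv P P' -> lfd_equiv P' P'' -> lfd_equiv P P''.

End Equivalence.

(* Main.v *)
Require Import Defs.
From mathcomp Require Import all_boot all_order perm all_algebra.
From mathcomp Require Import reals complex.
From mathcomp Require Import mpoly.
From mathcomp Require Import ring lra zify.
From mathcomp Require classical_sets boolp.

Set Implicit Arguments.
Unset Strict Implicit.
Unset Printing Implicit Defensive.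

Import Order.TTheory GRing.Theory Num.Theory.
Local Open Scope ring_scope.

(* Call a sincere [(Q,d)] good if [dim PGL(Q,d) = dim Rep(Q,d)] and the
   representations with nontrivial endomorphisms are the zeros of a reduced
   homogeneous equation of degree [dim Rep(Q,d)].  Good pairs are exactly the
   quiver linear free divisors: by Saito's criterion the determinant [Delta] of the
   infinitesimal action of [pgl(Q,d)] is a reduced equation of the discriminant.
   A connected group [H] preserving the divisor lies in the image of [PGL(Q,d)],
   because the equations [s v = v] and [f o s = f] satisfied by suitable translates
   [s] of its elements isolate [s = 1] among the linear maps.

   Goodness is symmetric under reflections.  Completing [V_k -> sum V_i] to an
   invertible matrix, whose inverse gives the reflected maps, identifies
   the infinitesimal actions on both sides up to invertible factors, and
   reducedness descends along the projections from the invertible matrices.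

   For (b), the homotheties preserve the divisor, hence lie in [PGL(Q,d)]; a family
   acting as multiplication by [2] gives scalars that double along every arrow, so
   the vertices have heights increasing by [1] along arrows.  Reflecting at a source
   of minimal height raises it by [2], until only two consecutive heights remain. *)

(** * Polynomial functions *)

(** Divisors are given as zero sets and reducedness as radicality, so vanishing has to be turned
    into divisibility; the Nullstellensatz used for this rests on the uncountability of the field.
    Polynomials are treated as functions on vector spaces, so that changes of coordinates are
    compositions. Prescribing the degree in goodness makes the equation unique up to a constant: the
    quotient of two candidates is homogeneous of degree 0. Reducedness of one equation thus passes
    to an explicit determinant. The two sides of a reflection are compared over the completed
    matrices, where their equations differ by factors invertible only off a determinant. Descending
    from there means removing powers of maximal minors, which is done with leading coefficients. The
    competing groups [H] are abstract subgroups, so no Lie algebra of [H] is at hand; the isolation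
    of [s = 1] is instead used to cut [H] into two disjoint closed pieces. *)

Section MpolyBasics.
Variable K : numFieldType.

Lemma mpoly_alg_ind n (P : {mpoly K[n]} -> Prop) :
  (forall c, P c%:MP) -> (forall i, P 'X_i) ->
  (forall p q, P p -> P q -> P (p + q)) ->
  (forall p q, P p -> P q -> P (p * q)) -> forall p, P p.
Proof.
move=> PC PX PD PM p; elim/mpolyind: p => [|c m p _ _ Pp]; first exact: (PC 0).
apply: PD => //; rewrite -mul_mpolyC; apply: (PM) => //.
rewrite mpolyXE_id; elim/big_ind: _ => [||i _]; [exact: (PC 1)|exact: PM|].
by elim: (m i) => [|e IH]; rewrite ?expr0 ?exprS; [exact: (PC 1)|exact: PM].
Qed.

Lemma poly_nat_roots (P : {poly K}) : (forall n : nat, P.[n%:R] = 0) -> P = 0.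
Proof.
move=> P0; apply: (@roots_geq_poly_eq0 _ _ [seq i%:R | i <- iota 0 (size P)]).
- by apply/allP => x /mapP[i _ ->]; rewrite /root P0.
- by rewrite map_inj_uniq ?iota_uniq //; exact: mulrIn (oner_neq0 K).
- by rewrite size_map size_iota.
Qed.

(** Differentiating by a variable of the leading monomial multiplies its coefficient by a positive
    integer, nonzero in characteristic 0, and the size drops; so one ends at a nonzero constant. It
    replaces density and degree arguments in what follows. *)
Lemma deriv_closed_const n (J : {mpoly K[n]} -> Prop) :
  (forall i p, J p -> J p^`M(i)) ->
  forall p, J p -> p != 0 -> exists2 c, c != 0 & J c%:MP.
Proof.
move=> dJ p; have [s] := ubnP (msize p); elim: s p => // s IH p le_ps Jp p0.
have lc0 : p@_(mlead p) != 0 by rewrite mcoeff_eq0 negbK mlead_supp.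
case: (eqVneq (mlead p) 0%MM) => [m0 | mn0].
  exists p@_(mlead p) => //.
  rewrite m0.
  by have /msize1_polyC <- : (msize p <= 1)%N by rewrite -mlead_deg // m0 mdeg0.
have [i mi] : exists i, (mlead p i != 0)%N.
  apply/existsP; rewrite -negb_forall; apply: contra mn0 => /forallP m0.
  by apply/eqP/mnmP => i; rewrite mnm0E; apply/eqP.
have Um : (U_(i) <= mlead p)%MM by rewrite lep1mP.
apply: (IH p^`M(i)) => //; last 2 first.
- exact: dJ.
- apply/eqP => /(congr1 (mcoeff (mlead p - U_(i))%MM)) /eqP.
  rewrite mcoeff0 mcoeff_mderiv submK // mulrn_eq0 /=.
  by rewrite (negbTE lc0).
- suff : (msize p^`M(i) < msize p)%N by move=> lt; apply: leq_trans lt _.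
  rewrite msizeE big_seq.
  apply: (@big_ind _ (fun k => k < msize p)%N).
  - by rewrite lt0n msize_poly_eq0.
  - by move=> a b ha hb; rewrite gtn_max ha hb.
  move=> m; rewrite mcoeff_msupp mcoeff_mderiv mulrn_eq0 /= => mp.
  have : (m + U_(i))%MM \in msupp p by rewrite mcoeff_msupp.
  by move/msize_mdeg_lt; rewrite mdegD mdeg1 addn1.
Qed.

(** A single polynomial in [t] carries both the values and the directional derivative, so vanishing
    on a line passes to the derivative without limits. *)
Lemma mpoly_line n (p : {mpoly K[n]}) (x v : 'cV[K]_n) :
  exists P : {poly K}, forall t,
    P.[t] = peval p (x + t *: v) /\
    P^`().[t] = \sum_i v i 0 * peval p^`M(i) (x + t *: v).
Proof.
elim/mpoly_alg_ind: p => [c|j|p q [P hP] [Q hQ]|p q [P hP] [Q hQ]].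
- exists c%:P => t; rewrite derivC horner0 hornerC /peval mevalC; split=> //.
  by rewrite big1 // => i _; rewrite mderivC meval0 mulr0.
- exists ((v j 0)%:P * 'X + (x j 0)%:P) => t.
  rewrite derivD derivM !derivC derivX mul0r add0r mulr1 addr0 hornerC.
  rewrite !hornerE /peval mevalXU !mxE; split; first by rewrite addrC mulrC.
  rewrite (bigD1 j) //= big1 ?addr0 => [|i nij].
    have -> : ('X_j : {mpoly K[n]})^`M(j) = 1.
      rewrite mderivX mnm1E eqxx scale1r -mpolyX0; congr mpolyX.
      by apply/mnmP => i; rewrite mnmBE subnn mnm0E.
    by rewrite meval1 mulr1.
  by rewrite mderivX mnm1E eq_sym (negbTE nij) scale0r meval0 mulr0.
- exists (P + Q) => t; rewrite derivD !hornerD.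
  have [-> ->] := hP t; have [-> ->] := hQ t; rewrite /peval mevalD; split=> //.
  by rewrite -big_split; apply: eq_bigr => i _ /=; rewrite mderivD mevalD mulrDr.
- exists (P * Q) => t; rewrite derivM !hornerD !hornerM.
  have [-> ->] := hP t; have [-> ->] := hQ t; rewrite /peval mevalM; split=> //.
  rewrite mulr_suml mulr_sumr -big_split; apply: eq_bigr => i _ /=.
  by rewrite mderivM mevalD !mevalM; ring.
Qed.

Lemma peval_eq0 n (p : {mpoly K[n]}) : (forall x, peval p x = 0) -> p = 0.
Proof.
move=> p0; apply/eqP/negP => /negP pn0.
pose J (q : {mpoly K[n]}) := forall x, peval q x = 0.
have [|c /negP cn0 Jc] := @deriv_closed_const n J _ p p0 pn0.
  move=> i q Jq x; have [P hP] := mpoly_line q x (delta_mx i 0).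
  have P0 : P = 0 by apply: poly_nat_roots => k; rewrite (hP _).1.
  have := (hP 0).2; rewrite P0 derivC horner0 scale0r addr0 (bigD1 i) //=.
  rewrite big1 ?addr0 ?mxE ?eqxx ?mul1r => [<- //|j nji].
  by rewrite mxE (negbTE nji) mul0r.
by apply: cn0; have := Jc 0; rewrite /peval mevalC => ->.
Qed.

Lemma peval_inj n (p q : {mpoly K[n]}) :
  (forall x, peval p x = peval q x) -> p = q.
Proof.
move=> pq; apply/eqP; rewrite -subr_eq0; apply/eqP/peval_eq0 => x.
by rewrite /peval mevalB; apply/eqP; rewrite subr_eq0; apply/eqP/pq.
Qed.

End MpolyBasics.

(** * Polynomial functions and the identity principle *)

Section PolynomialFunctions.
Variable K : numFieldType.
Implicit Types X Y Z : lmodType K.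

Definition linform X (l : X -> K) : Prop :=
  forall a u v, l (a *: u + v) = a * l u + l v.

(* Polynomial functions on a vector space, without a choice of coordinates. *)
Inductive pf X : (X -> K) -> Prop :=
| pf_const c : pf (fun=> c)
| pf_linform l : linform l -> pf l
| pf_add f g : pf f -> pf g -> pf (fun x => f x + g x)
| pf_mul f g : pf f -> pf g -> pf (fun x => f x * g x)
| pf_ext f g : f =1 g -> pf f -> pf g.

Lemma linform0 X (l : X -> K) : linform l -> l 0 = 0.
Proof.
move=> h; have /eqP := h 1 0 0.
by rewrite scaler0 addr0 mul1r -subr_eq subrr => /eqP <-.
Qed.

Lemma linformD X (l : X -> K) : linform l -> forall u v, l (u + v) = l u + l v.
Proof. by move=> h u v; rewrite -{1}(scale1r u) h mul1r. Qed.

Lemma linformZ X (l : X -> K) : linform l -> forall a u, l (a *: u) = a * l u.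
Proof. by move=> h a u; rewrite -{1}(addr0 (a *: u)) h linform0 // addr0. Qed.

Lemma linform_sum X (l : X -> K) : linform l ->
  forall I (r : seq I) (F : I -> X), l (\sum_(i <- r) F i) = \sum_(i <- r) l (F i).
Proof.
move=> h I r F; elim: r => [|i r IH]; first by rewrite !big_nil linform0.
by rewrite !big_cons linformD // IH.
Qed.

Lemma pf_opp X (f : X -> K) : pf f -> pf (fun x => - f x).
Proof.
move=> pff; apply: (@pf_ext _ (fun x => (-1) * f x)) => [x|].
  by rewrite mulN1r.
by apply: pf_mul => //; exact: pf_const.
Qed.

Lemma pf_sum X I (r : seq I) (F : I -> X -> K) :
  (forall i, pf (F i)) -> pf (fun x => \sum_(i <- r) F i x).
Proof.
move=> hF; elim: r => [|i r IH].
  by apply: (pf_ext _ (pf_const X 0)) => x; rewrite big_nil.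
by apply: (pf_ext _ (pf_add (hF i) IH)) => x; rewrite big_cons.
Qed.

Lemma pf_prod X I (r : seq I) (F : I -> X -> K) :
  (forall i, pf (F i)) -> pf (fun x => \prod_(i <- r) F i x).
Proof.
move=> hF; elim: r => [|i r IH].
  by apply: (pf_ext _ (pf_const X 1)) => x; rewrite big_nil.
by apply: (pf_ext _ (pf_mul (hF i) IH)) => x; rewrite big_cons.
Qed.

Lemma pf_exp X (f : X -> K) m : pf f -> pf (fun x => f x ^+ m).
Proof.
move=> hf; elim: m => [|m IH].
  by apply: (pf_ext _ (pf_const X 1)) => x; rewrite expr0.
by apply: (pf_ext _ (pf_mul hf IH)) => x; rewrite exprS.
Qed.

Lemma pf_det X n (A : X -> 'M[K]_n) :
  (forall i j, pf (fun x => A x i j)) -> pf (fun x => \det (A x)).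
Proof.
move=> hA; apply: pf_sum => s; apply: pf_mul; first exact: pf_const.
by apply: pf_prod => i; exact: hA.
Qed.

Definition polymap X Y (h : X -> Y) : Prop :=
  forall l, linform l -> pf (fun x => l (h x)).

Lemma pf_comp X Y (h : X -> Y) f : polymap h -> pf f -> pf (fun x => f (h x)).
Proof.
move=> hh; elim=> {f} [c|l /hh //|f g _ IHf _ IHg|f g _ IHf _ IHg|f g fg _ IHf].
- exact: pf_const.
- exact: pf_add.
- exact: pf_mul.
- by apply: pf_ext IHf => x; rewrite fg.
Qed.

Lemma linform_mx m n (l : 'M[K]_(m, n) -> K) : linform l ->
  forall A, l A = \sum_i \sum_j A i j * l (delta_mx i j).
Proof.
move=> hl A; rewrite {1}(matrix_sum_delta A) linform_sum //.
by apply: eq_bigr => i _; rewrite linform_sum //; apply: eq_bigr => j _;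
  rewrite linformZ.
Qed.

Lemma linform_entry m n i j : linform (fun A : 'M[K]_(m, n) => A i j).
Proof. by move=> a u v; rewrite !mxE. Qed.

Lemma pf_entry m n i j : pf (fun A : 'M[K]_(m, n) => A i j).
Proof. exact/pf_linform/linform_entry. Qed.

Lemma polymap_pair X Y Z (h : X -> Y) (k : X -> Z) :
  polymap h -> polymap k -> polymap (fun x => (h x, k x) : (Y * Z)%type).
Proof.
move=> hh hk l hl; apply: (@pf_ext _ (fun x => l (h x, 0) + l (0, k x))).
  by move=> x; rewrite -linformD //; congr l; congr pair; rewrite /= ?addr0 ?add0r.
apply: pf_add.
  apply: (hh (fun y => l (y, 0))) => a u v; rewrite -hl; congr l.
  by congr pair; rewrite /= scaler0 addr0.
apply: (hk (fun y => l (0, y))) => a u v; rewrite -hl; congr l.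
by congr pair; rewrite /= scaler0 addr0.
Qed.

Lemma polymap_lin X Y (h : X -> Y) :
  (forall a u v, h (a *: u + v) = a *: h u + h v) -> polymap h.
Proof. by move=> hh l hl; apply: pf_linform => a u v; rewrite hh hl. Qed.

Lemma polymap_affine X (x v : X) : polymap (fun t : K^o => x + t *: v).
Proof.
move=> l hl; apply: (@pf_ext _ (fun t : K^o => l x + t * l v)).
  by move=> t; rewrite linformD // linformZ.
apply: pf_add; first exact: pf_const.
by apply: pf_mul; [apply: pf_linform|exact: pf_const].
Qed.

Lemma pf_poly (f : K^o -> K) : pf f -> exists P : {poly K}, forall t, f t = P.[t].
Proof.
elim=> {f} [c|l hl|f g _ [P hP] _ [Q hQ]|f g _ [P hP] _ [Q hQ]|f g fg _ [P hP]].
- by exists c%:P => t; rewrite hornerC.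
- exists ('X * (l 1)%:P) => t; rewrite hornerM hornerX hornerC -linformZ //.
  by congr l; rewrite /GRing.scale /= mulr1.
- by exists (P + Q) => t; rewrite hornerD hP hQ.
- by exists (P * Q) => t; rewrite hornerM hP hQ.
- by exists P => t; rewrite -fg.
Qed.

(** On the line from [y] to [x] both factors become polynomials in one variable, where there are no
    zero divisors, and [f] stays nonzero because of [y]. *)
Lemma pf_integral X (f g : X -> K) : pf f -> pf g ->
  (forall x, f x * g x = 0) -> forall y, f y != 0 -> forall x, g x = 0.
Proof.
move=> hf hg fg0 y fy x.
have [P hP] := pf_poly (pf_comp (polymap_affine y (x - y)) hf).
have [Q hQ] := pf_poly (pf_comp (polymap_affine y (x - y)) hg).
have PQ0 : P * Q = 0.
  by apply: poly_nat_roots => k; rewrite hornerM -hP -hQ.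
have Pn0 : P != 0.
  by apply: contraNneq fy => P0; have := hP 0; rewrite scale0r addr0 P0 horner0 => ->.
have Q0 : Q = 0 by move/eqP: PQ0; rewrite mulf_eq0 (negbTE Pn0) => /eqP.
by have := hQ 1; rewrite scale1r addrC subrK Q0 horner0.
Qed.

(** Density of the nonvanishing locus of [d], in the form that permits division by [d]. *)
Lemma pf_cancel X (d f g : X -> K) : pf d -> pf f -> pf g ->
  (exists y, d y != 0) ->
  (forall x, d x != 0 -> f x = g x) -> forall x, f x = g x.
Proof.
move=> hd hf hg [y dy] fg x; apply/eqP; rewrite -subr_eq0; apply/eqP.
apply: (@pf_integral X d (fun x => f x - g x) hd) dy x => [|x].
  by apply: pf_add => //; exact: pf_opp.
by have [->|dx] := eqVneq (d x) 0; rewrite ?mul0r // fg // subrr mulr0.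
Qed.

Lemma pf_peval n (p : {mpoly K[n]}) : pf (peval p).
Proof.
elim/mpoly_alg_ind: p => [c|i|p q hp hq|p q hp hq].
- by apply: (pf_ext _ (pf_const _ c)) => x; rewrite /peval mevalC.
- by apply: (pf_ext _ (pf_entry i 0)) => x; rewrite /peval mevalXU.
- by apply: (pf_ext _ (pf_add hp hq)) => x; rewrite /peval mevalD.
- by apply: (pf_ext _ (pf_mul hp hq)) => x; rewrite /peval mevalM.
Qed.

Lemma pf_mpoly n (f : 'cV[K]_n -> K) : pf f ->
  exists p : {mpoly K[n]}, forall x, f x = peval p x.
Proof.
elim=> {f} [c|l hl|f g _ [P hP] _ [Q hQ]|f g _ [P hP] _ [Q hQ]|f g fg _ [P hP]].
- by exists c%:MP => t; rewrite /peval mevalC.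
- exists (\sum_i l (delta_mx i 0) *: 'X_i) => x.
  rewrite /peval raddf_sum linform_mx //=; apply: eq_bigr => i _.
  by rewrite big_ord1 mevalZ mevalXU mulrC.
- by exists (P + Q) => t; rewrite /peval mevalD hP hQ.
- by exists (P * Q) => t; rewrite /peval mevalM hP hQ.
- by exists P => t; rewrite -fg.
Qed.

Lemma pf_expand X (f : X -> K) (v : X) : pf f ->
  exists N (c : nat -> X -> K), (forall i, pf (c i)) /\
    forall x t, f (x + t *: v) = \sum_(i < N) c i x * t ^+ i.
Proof.
elim=> {f} [a|l hl|f g _ [N [c [hc ec]]] _ [M [d [hd ed]]]
           |f g _ [N [c [hc ec]]] _ [M [d [hd ed]]]|f g fg _ [N [c [hc ec]]]].
- exists 1%N, (fun _ _ => a); split=> [i|x t]; first exact: pf_const.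
  by rewrite big_ord1 mulr1.
- exists 2, (fun i x => if i == 0 then l x else l v); split=> [i|x t].
    by case: eqP => _; [exact: pf_linform|exact: pf_const].
  by rewrite !big_ord_recl big_ord0 /= linformD // linformZ // expr0 expr1; ring.
- exists (N + M)%N, (fun i x => (if (i < N)%N then c i x else 0) +
                            (if (i < M)%N then d i x else 0)); split=> [i|x t].
    by apply: pf_add; [case: (i < N)%N|case: (i < M)%N] => //; exact: pf_const.
  have tr L (e : nat -> X -> K) L' : (L <= L')%N ->
     \sum_(i < L') (if (i < L)%N then e i x else 0) * t ^+ i =
     \sum_(i < L) e i x * t ^+ i.
    move=> le; rewrite (big_ord_widen _ (fun i => e i x * t ^+ i) le) [RHS]big_mkcond.
    by apply: eq_bigr => i _; case: ifP; rewrite ?mul0r.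
  under eq_bigr do rewrite mulrDl.
  by rewrite big_split /= !tr ?leq_addr ?leq_addl // ec ed.
- exists (N + M)%N, (fun k x => \sum_(i < N) \sum_(j < M | (i + j == k)%N) c i x * d j x).
  split=> [k|x t].
    apply: pf_sum => i.
    apply: (@pf_ext _ (fun x => \sum_(j < M) if (i + j == k)%N then c i x * d j x else 0)).
      by move=> x; rewrite [RHS]big_mkcond.
    by apply: pf_sum => j; case: (i + j == k)%N; [exact: pf_mul|exact: pf_const].
  rewrite ec ed mulr_suml; under [RHS]eq_bigr do rewrite mulr_suml.
  rewrite [RHS]exchange_big /=; apply: eq_bigr => i _.
  rewrite mulr_sumr; under [RHS]eq_bigr do rewrite mulr_suml big_mkcond /=.
  rewrite [RHS]exchange_big; apply: eq_bigr => j _ /=.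
  have lt : (i + j < N + M)%N by have := ltn_ord i; have := ltn_ord j; lia.
  rewrite (bigD1 (Ordinal lt)) //= eqxx big1 ?addr0 => [|k nk].
    by rewrite exprD; ring.
  by case: eqP => // e; case/negP: nk; apply/eqP/val_inj.
- exists N, c; split=> // x t; by rewrite -fg.
Qed.

End PolynomialFunctions.

(** * Nullstellensatz over an uncountable field *)

Definition uncountable_type (T : Type) : Prop :=
  forall s : nat -> T, exists a, forall n, s n <> a.

Section Uncountable.
Variable R : realType.

Lemma realType_uncountable : uncountable_type R.
Proof.
move=> s.
(* Of the outer thirds, the one that misses [s n] is kept; with halves, [s n] could be the common
   endpoint. *)
pose step (n : nat) (I : R * R) : R * R :=
  let: (a, b) := I in
  if s n <= (2 * a + b) / 3 then ((a + 2 * b) / 3, b) else (a, (2 * a + b) / 3).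
pose I := fix I n := if n is m.+1 then step m (I m) else (0, 1).
have IS n : I n.+1 = step n (I n) by [].
have lt n : (I n).1 < (I n).2.
  elim: n => [|n]; first exact: ltr01.
  by rewrite IS /step; case: (I n) => a b /= ab; case: ifP => _ /=; lra.
have mono n : (I n).1 <= (I n.+1).1 /\ (I n.+1).2 <= (I n).2.
  have := lt n; rewrite IS /step; case: (I n) => a b /= ab.
  by case: ifP => _ /=; split; lra.
have mono1 n m : (n <= m)%N -> (I n).1 <= (I m).1 /\ (I m).2 <= (I n).2.
  move=> /subnK <-; elim: (m - n)%N => [//|k [IH1 IH2]]; rewrite addSn.
  by have [h1 h2] := mono (k + n)%N; split; [apply: le_trans h1|apply: le_trans IH2].
pose E : classical_sets.set R := fun x => exists n, x = (I n).1.
have ub n x : E x -> x <= (I n).2.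
  case=> m ->; have [h1 h2] := mono1 n _ (leq_maxl n m).
  have [h3 h4] := mono1 m _ (leq_maxr n m).
  by apply: le_trans h3 (le_trans (ltW (lt _)) h2).
have hs : classical_sets.has_ubound E by exists (I 0).2 => x; exact: ub.
have ne : classical_sets.nonempty E by exists (I 0).1, 0.
exists (sup E) => n e.
have h1 : (I n.+1).1 <= sup E by apply: ub_le_sup => //; exists n.+1.
have h2 : sup E <= (I n.+1).2 by apply: ge_sup => // x; exact: ub.
move: h1 h2 (lt n); rewrite -e IS /step; case: (I n) => a b /=.
by case: ifP => [hh|/negbT]; rewrite -?ltNge /=; lra.
Qed.

Lemma complex_uncountable : uncountable_type R[i].
Proof.
move=> s; have [a ha] := realType_uncountable (fun n => complex.Re (s n)).
by exists (a%:C)%C => n e; apply: (ha n); rewrite e.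
Qed.

End Uncountable.

Section Nullstellensatz.
Variable K : numClosedFieldType.
Hypothesis uncK : uncountable_type K.

(** Size at most [D] means degree below [D], so only the [D ^ n] monomials with all exponents below
    [D] can occur. *)
Lemma mpoly_dependent (F : fieldType) n D r (p : 'I_r -> {mpoly F[n]}) :
  (forall i, msize (p i) <= D)%N -> (D ^ n < r)%N ->
  exists c : 'I_r -> F, (exists i, c i != 0) /\ \sum_i c i *: p i = 0.
Proof.
move=> hp lt_r.
pose mon (f : {ffun 'I_n -> 'I_D}) : 'X_{1..n} := [multinom f i : nat | i < n].
pose A : 'M[F]_(r, #|{ffun 'I_n -> 'I_D}|) := \matrix_(i, j) (p i)@_(mon (enum_val j)).
have : kermx A != 0.
  rewrite -mxrank_eq0 mxrank_ker -lt0n subn_gt0.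
  by rewrite (leq_ltn_trans (rank_leq_col _)) // card_ffun !card_ord.
case/rowV0Pn => v /sub_kermxP vA v0; exists (fun i => v 0 i); split.
  have [i vi] : exists i, v 0 i != 0.
    apply/existsP; rewrite -negb_forall; apply: contra v0 => /forallP h.
    by apply/eqP/rowP => i; rewrite mxE; apply/eqP.
  by exists i.
apply/mpolyP => m; rewrite raddf_sum mcoeff0 /=.
have [hm|] := boolP [forall i, (m i < D)%N].
  pose f : {ffun 'I_n -> 'I_D} := [ffun i => Ordinal (forallP hm i)].
  have <- : mon f = m by apply/mnmP => i; rewrite mnmE ffunE.
  move/rowP: vA => /(_ (enum_rank f)); rewrite !mxE => E; rewrite -[RHS]E.
  by apply: eq_bigr => i _; rewrite mcoeffZ mxE enum_rankK.
rewrite negb_forall => /existsP[j]; rewrite -leqNgt => hj.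
apply: big1 => i _; rewrite mcoeffZ; apply/eqP; rewrite mulf_eq0 mcoeff_eq0.
apply/orP; right; apply: msize_mdeg_ge; apply: leq_trans (hp i) _.
apply: leq_trans hj _; rewrite mdegE (bigD1 j) //=; exact: leq_addr.
Qed.

(** Otherwise every fibre of [k] is finite and [T] is enumerated by pairs of an index and a
    position. The required size depends on the fibre, because the dimension bound it must beat
    does. *)
Lemma uncountable_pigeonhole (T : eqType) (J : countType) (a0 : T) (k : T -> J)
    (r : J -> nat) :
  uncountable_type T ->
  exists j (s : seq T), [/\ uniq s, size s = r j & forall a, a \in s -> k a = j].
Proof.
move=> uncT; apply: boolp.contrapT => no.
have cov j : exists s : seq T, forall a, k a = j -> a \in s.
  have [l|] := boolp.EM (forall m, (m <= r j)%N -> exists s : seq T,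
    [/\ uniq s, size s = m & forall a, a \in s -> k a = j]).
    by case: no; exists j; apply: l.
  (* At the first size that cannot be reached, a list one shorter cannot be enlarged, so it exhausts
     the fibre. *)
  move=> /boolp.existsNP[m]; elim: m => [|m IH] h.
    by case: h => _; exists [::].
  have [|h'] := boolp.EM ((m <= r j)%N -> exists s : seq T,
    [/\ uniq s, size s = m & forall a, a \in s -> k a = j]); last exact: IH.
  move=> h'; have mr : (m < r j)%N by apply: boolp.contrapT => nm; apply: h => /nm.
  have [s [us ss hs]] := h' (ltnW mr); exists s => a ka.
  apply: boolp.contrapT => /negP as_; apply: h => _; exists (a :: s); split=> //=.
  - by rewrite as_.
  - by rewrite ss.
  - by move=> b; rewrite inE => /orP[/eqP -> //|]; exact: hs.
have [s hs] := boolp.choice cov.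
pose e (n : nat) : T := if unpickle n is Some (j, i) then nth a0 (s j) i else a0.
have [a /(_ (pickle (k a, index a (s (k a))))) ha] := uncT e.
by apply: ha; rewrite /e pickleK nth_index // hs.
Qed.

(* An ideal [I] containing [f] and maximal for missing the powers of [g] is
   prime.  If no [x_i - a] were in [I], each [a] would give [p] and [m] with
   [p * (x_i - a) = g ^+ m] modulo [I]; with uncountably many [a], some bounded
   family of such [p] is linearly dependent, which puts [g ^+ m * q(x_i)] in
   [I] for a nonzero [q], and a linear factor of [q] is then in [I]. *)
Lemma nullstellensatz n (f g : {mpoly K[n]}) :
  (forall x, peval f x = 0 -> peval g x = 0) -> exists m, pdivides f (g ^+ m).
Proof.
move=> fg; apply: boolp.contrapT => no.
pose ideal (I : {mpoly K[n]} -> Prop) :=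
  [/\ I f, forall p q, I p -> I q -> I (p + q),
      forall p q, I q -> I (p * q) & forall m, ~ I (g ^+ m)].
have I0 : ideal (pdivides f).
  split=> [|p q [a ->] [b ->]|p q [b ->]|m dv].
  - by exists 1; rewrite mul1r.
  - by exists (a + b); rewrite mulrDl.
  - by exists (p * b); rewrite mulrA.
  - by apply: no; exists m.
have [|I [PI maxI]] := @classical_sets.Zorn_bigcup {mpoly K[n]}
    (fun I => ideal I \/ forall p, ~ I p).
  move=> C CP Ctot.
  have [[J CJ [p Jp]]|nC] := boolp.EM (exists2 J, C J & exists p, J p); last first.
    by right => p [J CJ Jp]; apply: nC; exists J => //; exists p.
  have idC L : C L -> (exists q, L q) -> ideal L.
    by move=> CL [q Lq]; have [//|h] := CP L CL; case: (h q).
  left; split.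
  - by exists J => //; have [] := idC J CJ (ex_intro _ p Jp).
  - move=> a b [L CL La] [M CM Mb].
    have [LM|ML] := Ctot L M CL CM.
      exists M => //; have [_ + _ _] := idC M CM (ex_intro _ b Mb).
      by apply=> //; apply: LM.
    exists L => //; have [_ + _ _] := idC L CL (ex_intro _ a La).
    by apply=> //; apply: ML.
  - move=> a b [L CL Lb]; exists L => //.
    by have [_ _ + _] := idC L CL (ex_intro _ b Lb); apply.
  - move=> m [L CL Lm]; have [_ _ _] := idC L CL (ex_intro _ _ Lm).
    by move/(_ m).
have [If ID IM Ig] : ideal I.
  have [//|h] := PI; case: (maxI (pdivides f)); last by left.
  split; first by move=> p /h.
  by move=> /(_ f) h'; apply: (h f); apply: h'; exists 1; rewrite mul1r.
have ext p : ~ I p -> exists m q, I (g ^+ m - q * p).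
  move=> nIp; apply: boolp.contrapT => h.
  pose J := fun r => exists q, I (r - q * p).
  case: (maxI J).
    split=> [r Ir|JI]; first by exists 0; rewrite mul0r subr0.
    by apply: nIp; apply: JI; exists 1; rewrite mul1r subrr -(mul0r f); apply: IM.
  left; split.
  - by exists 0; rewrite mul0r subr0.
  - move=> a b [q hq] [q' hq']; exists (q + q').
    by rewrite mulrDl opprD addrACA; apply: ID.
  - move=> a b [q hq]; exists (a * q); rewrite -mulrA -mulrBr; exact: IM.
  - by move=> m [q hq]; apply: h; exists m, q.
have I00 : I 0 by rewrite -(mul0r f); apply: IM.
have IN p : I p -> I (- p) by move=> Ip; rewrite -mulN1r; apply: IM.
have prime p q : I (p * q) -> I p \/ I q.
  move=> Ipq; have [|nIp] := boolp.EM (I p); first by left.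
  have [|nIq] := boolp.EM (I q); first by right.
  have [m [a ha]] := ext _ nIp; have [m' [b hb]] := ext _ nIq.
  case: (Ig (m + m')%N); rewrite exprD.
  have -> : g ^+ m * g ^+ m' = g ^+ m' * (g ^+ m - a * p) +
     ((a * p) * (g ^+ m' - b * q) + (a * b) * (p * q)) by ring.
  by apply: (ID); [exact: IM|apply: (ID); exact: IM].
have I1 : ~ I 1 by have := Ig 0%N; rewrite expr0.
have rt i : exists a, I ('X_i - a%:MP).
  apply: boolp.contrapT => none.
  have h a : exists mq : nat * {mpoly K[n]}, I (g ^+ mq.1 - mq.2 * ('X_i - a%:MP)).
    have [|m [q hq]] := ext ('X_i - a%:MP); last by exists (m, q).
    by move=> h; apply: none; exists a.
  have [F hF] := boolp.choice h.
  pose k a := ((F a).1, msize (F a).2).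
  have [[m d] [s [us ss hs]]] :=
    uncountable_pigeonhole (0 : K) k (fun md => (md.2 ^ n).+1) uncK.
  pose t j := nth 0 s j.
  have ts (j : 'I_(d ^ n).+1) : t j \in s by rewrite mem_nth // ss.
  have [|//|c [[i0 ci0] c0]] := @mpoly_dependent K n d _ (fun j : 'I_(d ^ n).+1 => (F (t j)).2).
    by move=> j; have [_ ->] := hs _ (ts j).
  (* Multiply the dependence relation by the product of all [x_i - t l]: modulo [I], the factor
     [x_i - t j] turns the [j]-th polynomial into [g ^+ m], which leaves [g ^+ m] times [q(x_i)]. As
     in Lagrange interpolation, the value of [q] at [t i0] isolates [c i0]. *)
  pose q : {poly K} := \sum_(j < (d ^ n).+1) c j *: \prod_(l < (d ^ n).+1 | l != j) ('X - (t l)%:P).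
  have qn0 : q != 0.
    apply/eqP => /(congr1 (horner^~ (t i0)))/eqP; rewrite horner0 horner_sum.
    rewrite (bigD1 i0) //= [X in _ + X]big1 ?addr0 => [|j nj]; last first.
      rewrite hornerZ horner_prod (bigD1 i0) 1?eq_sym //= !hornerE subrr.
      by rewrite /= mulr0 mul0r.
    rewrite hornerZ mulf_eq0 (negbTE ci0) horner_prod /= prodf_seq_eq0.
    case/hasP => l _ /andP[nl]; rewrite !hornerE subr_eq0 nth_uniq ?ss //.
    by move/eqP/val_inj => e; rewrite e eqxx in nl.
  pose phi (u : {poly K}) : {mpoly K[n]} := (map_poly (@mpolyC n K) u).['X_i].
  have phiX a : phi ('X - a%:P) = 'X_i - a%:MP.
    by rewrite /phi rmorphB /= map_polyX map_polyC /= !hornerE.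
  have phiM u v : phi (u * v) = phi u * phi v by rewrite /phi rmorphM hornerM.
  have Iq : I (g ^+ m * phi q).
    have -> : g ^+ m * phi q = \sum_(j < (d ^ n).+1)
        (c j *: phi (\prod_(l < (d ^ n).+1 | l != j) ('X - (t l)%:P))) *
          (g ^+ m - (F (t j)).2 * ('X_i - (t j)%:MP)).
      have -> : g ^+ m * phi q = g ^+ m * phi q - (\sum_j c j *: (F (t j)).2) *
          phi (\prod_(l < (d ^ n).+1) ('X - (t l)%:P)).
        by rewrite c0 mul0r subr0.
      rewrite [X in g ^+ m * X]/phi raddf_sum horner_sum mulr_sumr mulr_suml.
      rewrite -sumrB; apply: eq_bigr => j _.
      rewrite [in X in _ - X](bigD1 j) //= phiM phiX linearZ /= hornerZ -/(phi _).
      by rewrite -!mul_mpolyC; ring.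
    elim/big_ind: _ => // j _; apply: IM.
    have := hF (t j); have [-> _] := hs _ (ts j); exact.
  have [z qE] := closed_field_poly_normal q.
  case: (prime _ _ Iq); first exact: Ig.
  rewrite qE -mul_polyC phiM => /prime[|].
    rewrite /phi map_polyC hornerC /= => hc.
    apply: I1; have -> : 1 = (lead_coef q)^-1%:MP * (lead_coef q)%:MP :> {mpoly K[n]}.
      by rewrite -mpolyCM mulVf ?lead_coef_eq0 // mpolyC1.
    exact: IM.
  elim: (z) => [|y z' IH]; first by rewrite big_nil /phi rmorph1 hornerC => /I1.
  by rewrite big_cons phiM phiX => /prime[hy|//]; apply: none; exists y.
have [b hb] := boolp.choice rt.
pose v : 'cV[K]_n := \col_i b i.
have Iv p : I (p - (peval p v)%:MP).
  elim/mpoly_alg_ind: p => [c|i|p q hp hq|p q hp hq].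
  - by rewrite /peval mevalC subrr.
  - by rewrite /peval mevalXU mxE.
  - by rewrite /peval mevalD mpolyCD opprD addrACA; apply: ID.
  - rewrite /peval mevalM mpolyCM.
    have -> : p * q - (peval p v)%:MP * (peval q v)%:MP =
      q * (p - (peval p v)%:MP) + (peval p v)%:MP * (q - (peval q v)%:MP) by ring.
    by apply: (ID); apply: (IM).
have fv : peval f v = 0.
  apply/eqP/negP => /negP nf; apply: I1.
  have -> : 1 = (peval f v)^-1%:MP * (f - (f - (peval f v)%:MP)).
    by rewrite opprB addrC subrK -mpolyCM mulVf // mpolyC1.
  by apply: (IM); apply: (ID) => //; apply: (IN).
by apply: (Ig 1%N); have := Iv g; rewrite fg // mpolyC0 subr0 expr1.
Qed.

End Nullstellensatz.

(** * Radical polynomials and regular functions *)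

Definition mradical (K : fieldType) n (f : {mpoly K[n]}) : Prop :=
  forall g m, pdivides f (g ^+ m) -> pdivides f g.

Section MpolyRadical.
Variable K : numFieldType.

Lemma pdividesM n (f p q : {mpoly K[n]}) : pdivides f q -> pdivides f (p * q).
Proof. by move=> [b ->]; exists (p * b); rewrite mulrA. Qed.

(* The ideal of all [g] with [f] dividing [g * e] contains the partial
   derivatives of its elements, hence a nonzero constant. *)
Lemma radical_jacobian n (f e : {mpoly K[n]}) : f != 0 -> mradical f ->
  (forall i, pdivides f (e * f^`M(i))) -> pdivides f e.
Proof.
move=> f0 rf fe.
have [|||c c0 [q]] := @deriv_closed_const K n (fun g => pdivides f (g * e)) _ f.
- move=> i g [u hu]; apply: (rf _ 2).
  have [w hw] := fe i.
  have := congr1 (mderiv i) hu; rewrite !mderivM => hd.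
  exists (g^`M(i) * (w * u + e * u^`M(i) - u * e^`M(i))).
  have -> : (g^`M(i) * e) ^+ 2 = g^`M(i) * (e * (g^`M(i) * e + g * e^`M(i))
     - (g * e) * e^`M(i)) by ring.
  rewrite hd hu.
  have -> : e * (u^`M(i) * f + u * f^`M(i)) = e * u^`M(i) * f + u * (e * f^`M(i)).
    by ring.
  by rewrite hw; ring.
- by exists e; rewrite mulrC.
- exact: f0.
move=> hq; exists (c^-1%:MP * q).
by rewrite -mulrA -hq mulrA -mpolyCM mulVf // mul1r.
Qed.

(** A finite difference formula whose coefficients restrict to the partial derivatives on the
    diagonal. It gives derivatives along curves by evaluation, and turns [f(s v) = f(v)] into an
    equation linear in [s - 1] once the coefficients are frozen. *)
Lemma peval_telescope n (f : {mpoly K[n]}) :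
  exists q : 'I_n -> 'cV[K]_n -> 'cV[K]_n -> K,
    [/\ forall i, pf (fun uw : 'cV[K]_n * 'cV[K]_n => q i uw.1 uw.2),
        forall u w, peval f u - peval f w = \sum_i (u i 0 - w i 0) * q i u w
      & forall i w, q i w w = peval f^`M(i) w].
Proof.
have pf1 (p : {mpoly K[n]}) : pf (fun uw : 'cV[K]_n * 'cV[K]_n => peval p uw.1).
  by apply: (@pf_comp _ _ _ fst) (pf_peval p); apply: polymap_lin.
have pf2 (p : {mpoly K[n]}) : pf (fun uw : 'cV[K]_n * 'cV[K]_n => peval p uw.2).
  by apply: (@pf_comp _ _ _ snd) (pf_peval p); apply: polymap_lin.
elim/mpoly_alg_ind: f => [c|j|f g [q [qp qe qd]] [r [rp re rd]]|f g [q [qp qe qd]] [r [rp re rd]]].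
- exists (fun _ _ _ => 0); split=> [i|u w|i w]; first exact: pf_const.
    by rewrite /peval !mevalC subrr big1 // => i _; rewrite mulr0.
  by rewrite mderivC /peval meval0.
- exists (fun i _ _ => (i == j)%:R); split=> [i|u w|i w]; first exact: pf_const.
    rewrite /peval !mevalXU (bigD1 j) //= eqxx mulr1 big1 ?addr0 // => i nij.
    by rewrite (negbTE nij) mulr0.
  rewrite /peval mderivX mnm1E eq_sym; case: eqP => [->|_].
    rewrite scale1r (_ : (U_(i) - U_(i))%MM = 0%MM) ?mpolyX0 ?meval1 //.
    by apply/mnmP => k; rewrite mnmBE subnn mnm0E.
  by rewrite scale0r meval0.
- exists (fun i u w => q i u w + r i u w); split=> [i|u w|i w].
  + exact: pf_add.
  + rewrite /peval !mevalD opprD addrACA -!/(peval _ _) qe re -big_split.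
    by apply: eq_bigr => i _; rewrite mulrDr.
  + by rewrite qd rd mderivD /peval mevalD.
- exists (fun i u w => peval f u * r i u w + q i u w * peval g w); split=> [i|u w|i w].
  + by apply: pf_add; apply: pf_mul.
  + rewrite /peval !mevalM -!/(peval _ _).
    have -> : peval f u * peval g u - peval f w * peval g w =
      peval f u * (peval g u - peval g w) + (peval f u - peval f w) * peval g w by ring.
    rewrite qe re mulr_sumr mulr_suml -big_split; apply: eq_bigr => i _ /=; ring.
  + by rewrite qd rd mderivM /peval mevalD !mevalM; ring.
Qed.

End MpolyRadical.

(** * Divisibility of polynomial functions and regular functions on a principal open set *)

Section PolynomialFunctionDivisibility.
Variable K : numFieldType.
Implicit Types X Y Z : lmodType K.

Definition pfdvd X (f g : X -> K) : Prop :=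
  exists2 q, pf q & forall x, g x = q x * f x.

Definition pfradical X (f : X -> K) : Prop :=
  forall g m, pf g -> pfdvd f (fun x => g x ^+ m) -> pfdvd f g.

Lemma pfdvdD X (f g h : X -> K) :
  pfdvd f g -> pfdvd f h -> pfdvd f (fun x => g x + h x).
Proof.
move=> [q hq eq] [r hr er]; exists (fun x => q x + r x); first exact: pf_add.
by move=> x; rewrite eq er mulrDl.
Qed.

Lemma pfdvdMl X (f g h : X -> K) :
  pf h -> pfdvd f g -> pfdvd f (fun x => h x * g x).
Proof.
move=> hh [q hq eq]; exists (fun x => h x * q x); first exact: pf_mul.
by move=> x; rewrite eq mulrA.
Qed.

Lemma pfdvd_ext X (f g h : X -> K) : g =1 h -> pfdvd f g -> pfdvd f h.
Proof. by move=> gh [q hq eq]; exists q => // x; rewrite -gh. Qed.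

Lemma pfdvd_sum X (f : X -> K) I (r : seq I) (P : pred I) (F : I -> X -> K) :
  (forall i, P i -> pfdvd f (F i)) -> pfdvd f (fun x => \sum_(i <- r | P i) F i x).
Proof.
move=> h; elim: r => [|i r IH].
  by exists (fun=> 0); [exact: pf_const|move=> x; rewrite big_nil mul0r].
case Pi : (P i).
  by apply: pfdvd_ext (pfdvdD (h i Pi) IH) => x; rewrite big_cons Pi.
by apply: pfdvd_ext IH => x; rewrite big_cons Pi.
Qed.

Lemma mradicalP n (f : {mpoly K[n]}) : mradical f <-> pfradical (peval f).
Proof.
split=> h g m.
  move=> hg [q hq eq]; have [p ep] := pf_mpoly hg; have [r er] := pf_mpoly hq.
  have [|s es] := h p m.
    exists r; apply: peval_inj => x.
    by rewrite /peval rmorphXn mevalM /= -!/(peval _ _) -ep -er eq.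
  exists (peval s); first exact: pf_peval.
  by move=> x; rewrite ep es /peval mevalM.
move=> [q eq]; have [||r hr er] := h (peval g) m; first exact: pf_peval.
  exists (peval q); first exact: pf_peval.
  by move=> x; rewrite /peval -rmorphXn /= eq mevalM.
have [p ep] := pf_mpoly hr; exists p; apply: peval_inj => x.
by rewrite er /peval mevalM -!/(peval _ _) ep.
Qed.

Lemma pfradical_iso X Y (h : X -> Y) (k : Y -> X) (f : Y -> K) :
  polymap h -> polymap k -> cancel k h -> cancel h k ->
  pfradical f -> pfradical (fun x => f (h x)).
Proof.
move=> hh hk kh khk rf g m hg [q hq eq].
have [||r hr er] := rf (fun y => g (k y)) m; first exact: pf_comp.
  exists (fun y => q (k y)); first exact: pf_comp.
  by move=> y; rewrite eq kh.
exists (fun x => r (h x)); first exact: pf_comp.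
by move=> x; rewrite -er khk.
Qed.

Section Regular.
Variables (X : lmodType K) (d : X -> K).
Hypothesis pfd : pf d.

(* [f] is a regular function on the open set where [d] does not vanish. *)
Definition regular (f : X -> K) : Prop :=
  exists e h, pf h /\ forall x, d x != 0 -> h x = d x ^+ e * f x.

Lemma regular_pf f : pf f -> regular f.
Proof. by move=> hf; exists 0%N, f; split=> // x _; rewrite mul1r. Qed.

Lemma regular_ext f g : (forall x, d x != 0 -> f x = g x) -> regular f -> regular g.
Proof. by move=> fg [e [h [hh eh]]]; exists e, h; split=> // x dx; rewrite eh // fg. Qed.

Lemma regular_add f g : regular f -> regular g -> regular (fun x => f x + g x).
Proof.
move=> [e [h [hh eh]]] [a [k [hk ek]]].
exists (e + a)%N, (fun x => d x ^+ a * h x + d x ^+ e * k x); split.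
  by apply: pf_add; apply: pf_mul => //; exact: pf_exp.
by move=> x dx; rewrite eh // ek // exprD; ring.
Qed.

Lemma regular_mul f g : regular f -> regular g -> regular (fun x => f x * g x).
Proof.
move=> [e [h [hh eh]]] [a [k [hk ek]]].
exists (e + a)%N, (fun x => h x * k x); split; first exact: pf_mul.
by move=> x dx; rewrite eh // ek // exprD; ring.
Qed.

Lemma regular_sum I (r : seq I) (F : I -> X -> K) :
  (forall i, regular (F i)) -> regular (fun x => \sum_(i <- r) F i x).
Proof.
move=> hF; elim: r => [|i r IH].
  by apply: regular_ext (regular_pf (pf_const X 0)) => x _; rewrite big_nil.
by apply: regular_ext (regular_add (hF i) IH) => x _; rewrite big_cons.
Qed.

(** The cofactor [r] lets one denominator [d], a product of determinants, serve for the inverses of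
    all the matrices of a family. *)
Lemma regular_invmx n (A : X -> 'M[K]_n) (r : X -> K) : pf r ->
  (forall i j, pf (fun x => A x i j)) -> (forall x, d x = r x * \det (A x)) ->
  forall i j, regular (fun x => invmx (A x) i j).
Proof.
move=> hr hA dE i j; exists 1%N, (fun x => r x * \adj (A x) i j); split.
  apply: pf_mul => //; apply: (@pf_ext _ _ (fun x => cofactor (A x) j i)).
    by move=> x; rewrite mxE.
  apply: pf_mul; first exact: pf_const.
  apply: pf_det => a b; apply: (pf_ext _ (hA (lift j a) (lift i b))).
  by move=> x; rewrite !mxE.
move=> x; rewrite dE mulf_eq0 negb_or => /andP[_ dx].
by rewrite expr1 /invmx unitmxE unitfE dx !mxE; field.
Qed.

Definition rmap Y (h : X -> Y) : Prop :=
  forall l, linform l -> regular (fun x => l (h x)).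

Lemma regular_comp Y (h : X -> Y) f : rmap h -> pf f -> regular (fun x => f (h x)).
Proof.
move=> hh; elim=> {f} [c|l /hh //|f g _ IHf _ IHg|f g _ IHf _ IHg|f g fg _ IHf].
- exact/regular_pf/pf_const.
- exact: regular_add.
- exact: regular_mul.
- by apply: regular_ext IHf => x _; rewrite fg.
Qed.

Lemma rmap_mx m n (h : X -> 'M[K]_(m, n)) :
  (forall i j, regular (fun x => h x i j)) -> rmap h.
Proof.
move=> hh l hl.
apply: (@regular_ext (fun x => \sum_i \sum_j h x i j * l (delta_mx i j))).
  by move=> x _; rewrite -linform_mx.
apply: regular_sum => i; apply: regular_sum => j.
by apply: regular_mul => //; exact/regular_pf/pf_const.
Qed.

Lemma rmap_pair Y Z (h : X -> Y) (k : X -> Z) :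
  rmap h -> rmap k -> rmap (fun x => (h x, k x) : (Y * Z)%type).
Proof.
move=> hh hk l hl; apply: (@regular_ext (fun x => l (h x, 0) + l (0, k x))).
  by move=> x _; rewrite -linformD //; congr l; congr pair; rewrite /= ?addr0 ?add0r.
apply: regular_add.
  apply: (hh (fun y => l (y, 0))) => a u v; rewrite -hl; congr l.
  by congr pair; rewrite /= scaler0 addr0.
apply: (hk (fun y => l (0, y))) => a u v; rewrite -hl; congr l.
by congr pair; rewrite /= scaler0 addr0.
Qed.

Lemma rmap_polymap Y (h : X -> Y) : polymap h -> rmap h.
Proof. by move=> hh l /hh /regular_pf. Qed.

Lemma regular_eq0 f s : regular f -> pf s -> (exists y, s y != 0) ->
  (forall x, d x != 0 -> s x != 0 -> f x = 0) -> forall x, d x != 0 -> f x = 0.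
Proof.
move=> [e [h [hh eh]]] hs [y sy] f0 x dx.
(* The numerator [h] is unconstrained where [d] vanishes; the extra factor [d] makes the product
   vanish there too. *)
have hz : forall x, d x * h x = 0.
  move=> z; apply: (@pf_integral _ _ s (fun x => d x * h x) hs _ _ y sy z).
    exact: pf_mul.
  move=> t; have [->|dt] := eqVneq (d t) 0; first by rewrite mul0r mulr0.
  have [->|st] := eqVneq (s t) 0; first by rewrite mul0r.
  by rewrite eh // f0 // !mulr0.
move/eqP: (hz x); rewrite mulf_eq0 (negbTE dx) /= eh // mulf_eq0 expf_eq0.
by rewrite (negbTE dx) andbF => /eqP.
Qed.

End Regular.

End PolynomialFunctionDivisibility.

(** * Divisibility recovered from multipliers without a common factor *)

Section CodimensionTwo.
Variable K : numFieldType.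
Implicit Types X Y : lmodType K.

Lemma pf_neg (X : lmodType K) (f : X -> K) : ~ (exists y, f y != 0) -> forall y, f y = 0.
Proof. by move=> h y; apply/eqP/negP => /negP fy; apply: h; exists y. Qed.

Lemma pf_mul_neq0 X (f g : X -> K) : pf f -> pf g ->
  (exists y, f y != 0) -> (exists y, g y != 0) -> exists y, f y * g y != 0.
Proof.
move=> hf hg [y fy] [z gz]; apply: boolp.contrapT => /pf_neg fg0.
by move/eqP: gz; apply; exact: (pf_integral hf hg fg0 fy).
Qed.

Lemma poly_ext_nat (P Q : {poly K}) : (forall t, P.[t] = Q.[t]) -> P = Q.
Proof.
move=> e; apply/eqP; rewrite -subr_eq0; apply/eqP/poly_nat_roots => k.
by rewrite hornerD hornerN e subrr.
Qed.

Lemma horner_sum_coef N (c : nat -> K) t :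
  (\poly_(i < N) c i).[t] = \sum_(i < N) c i * t ^+ i.
Proof. by rewrite horner_poly. Qed.

Lemma pf_expand_lead X (f : X -> K) v : pf f -> (exists y, f y != 0) ->
  exists e (c : nat -> X -> K), [/\ forall i, pf (c i), exists y, c e y != 0 &
    forall x t, f (x + t *: v) = \sum_(i < e.+1) c i x * t ^+ i].
Proof.
move=> hf [y fy]; have [N [c [hc ec]]] := pf_expand v hf.
elim: N ec => [|N IH] ec.
  by move: fy; rewrite -(addr0 y) -(scale0r v) ec big_ord0 eqxx.
have [nz|/pf_neg z] := boolp.EM (exists y, c N y != 0); first by exists N, c.
by apply: IH => x t; rewrite ec big_ord_recr /= z mul0r addr0.
Qed.

(** Shifting [t] does not change a leading coefficient, and invariance of [f] along [w] passes to
    every coefficient. Passing to leading coefficients direction after direction thus accumulates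
    invariance. *)
Lemma lead_invariant X (f : X -> K) v e (c : nat -> X -> K) :
  (forall x t, f (x + t *: v) = \sum_(i < e.+1) c i x * t ^+ i) ->
  (forall x s, c e (x + s *: v) = c e x) /\
  (forall w, (forall x, f (x + w) = f x) -> forall x, c e (x + w) = c e x).
Proof.
move=> ec; split=> [x s|w fw x].
  have := @poly_ext_nat (\poly_(i < e.+1) c i (x + s *: v))
    (\sum_(i < e.+1) c i x *: ('X + s%:P) ^+ i).
  move=> h; have {}h := h _; have : forall t, (\poly_(i < e.+1) c i (x + s *: v)).[t] =
    (\sum_(i < e.+1) c i x *: ('X + s%:P) ^+ i).[t].
    move=> t; rewrite horner_sum_coef -ec -addrA -scalerDl ec horner_sum.
    by apply: eq_bigr => i _; rewrite !hornerE addrC.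
  move/h/(congr1 (fun P : {poly K} => P`_e)); rewrite coef_poly ltnSn => ->.
  rewrite coef_sum big_ord_recr /= big1 ?add0r => [|i _].
    have := monic_exp e (monicXaddC s); rewrite monicE lead_coefE.
    by rewrite -[s]opprK polyCN size_exp_XsubC /= coefZ => /eqP ->; rewrite mulr1.
  rewrite coefZ nth_default ?mulr0 // -[s]opprK polyCN size_exp_XsubC.
  exact: ltn_ord.
have := @poly_ext_nat (\poly_(i < e.+1) c i (x + w)) (\poly_(i < e.+1) c i x).
move=> h; have {}h := h _; suff /h : forall t, (\poly_(i < e.+1) c i (x + w)).[t] =
   (\poly_(i < e.+1) c i x).[t].
  by move/(congr1 (fun P : {poly K} => P`_e)); rewrite !coef_poly ltnSn.
by move=> t; rewrite !horner_sum_coef -!ec addrAC fw.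
Qed.

(* Compare coefficients along [v], from the top: if [b] is [v]-invariant and
   divides [a * u], it divides the product of [u] and a power of the leading
   coefficient of [a]. *)
Lemma pfdvd_lead X (a u b : X -> K) v e (c : nat -> X -> K) :
  pf u -> pf b -> (forall i, pf (c i)) ->
  (forall x t, a (x + t *: v) = \sum_(i < e.+1) c i x * t ^+ i) ->
  (forall x t, b (x + t *: v) = b x) ->
  pfdvd b (fun x => a x * u x) ->
  exists k, pfdvd b (fun x => c e x ^+ k * u x).
Proof.
move=> hu hb hc ec bv [w hw ew].
have [M [d [hd ed]]] := pf_expand v hu.
have [L [z [hz ez]]] := pf_expand v hw.
pose d' j x := if (j < M)%N then d j x else 0.
pose z' j x := if (j < L)%N then z j x else 0.
have hd' j : pf (d' j) by rewrite /d'; case: (j < M)%N => //; exact: pf_const.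
have hz' j : pf (z' j) by rewrite /z'; case: (j < L)%N => //; exact: pf_const.
have coefE x m : \sum_(i < m.+1) (if (i < e.+1)%N then c i x else 0) * d' (m - i)%N x
   = b x * z' m x.
  have /poly_ext_nat : forall t, ((\poly_(i < e.+1) c i x) * (\poly_(i < M) d i x)).[t] =
    (b x *: \poly_(i < L) z i x).[t].
    move=> t; rewrite hornerM hornerZ !horner_sum_coef -ec -ed -ez.
    by rewrite ew bv mulrC.
  move/(congr1 (fun P : {poly K} => P`_m)); rewrite coefM coefZ coef_poly => <-.
  by apply: eq_bigr => i _; rewrite !coef_poly.
(* The coefficient of degree [e + j] in [a * u = b * w] expresses [c e * d' j] through the [d'] of
   index above [j] modulo [b], so each step down costs one more factor [c e]. *)
have dv k : forall j, (M - k <= j)%N -> pfdvd b (fun x => c e x ^+ k * d' j x).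
  elim: k => [|k IH] j hj.
    exists (fun=> 0) => [|x]; first exact: pf_const.
    by rewrite /d' ltnNge -(subn0 M) hj mulr0 mul0r.
  have [le|lt] := leqP (M - k) j.
    by apply: pfdvd_ext (pfdvdMl (hc e) (IH j le)) => x; rewrite exprS mulrA.
  have jE : (e + j).+1 = (e + j.+1)%N by rewrite addnS.
  apply: (@pfdvd_ext _ _ _ (fun x => c e x ^+ k * z' (e + j)%N x * b x +
     \sum_(i < e) (- c i x) * (c e x ^+ k * d' (e + j - i)%N x))).
    move=> x; have := coefE x (e + j)%N.
    rewrite jE big_split_ord /= [X in _ + X]big_ord_recl /= addn0 ltnSn.
    have -> : (e + j - e)%N = j by lia.
    rewrite [X in _ + (_ + X)]big1 ?addr0 => [|i _]; last first.
      by rewrite ltnS /bump /=; case: leqP => hh; rewrite ?mul0r //; lia.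
    move=> E; have -> : c e x ^+ k.+1 * d' j x = c e x ^+ k * (c e x * d' j x).
      by rewrite exprSr mulrA.
    have -> : c e x * d' j x = b x * z' (e + j)%N x -
       \sum_(i < e) (if (i < e.+1)%N then c i x else 0) * d' (e + j - i)%N x.
      by rewrite -E addrC addrK.
    rewrite mulrBr mulr_sumr -sumrN; congr (_ + _); first by ring.
    apply: eq_bigr => i _; rewrite ifT; first by ring.
    by rewrite ltnS ltnW.
  apply: pfdvdD.
    exists (fun x => c e x ^+ k * z' (e + j)%N x) => //.
    by apply: pf_mul => //; exact: pf_exp.
  apply: pfdvd_sum => i _; apply: pfdvdMl; first exact: pf_opp.
  by apply: IH; have := ltn_ord i; lia.
exists M; have := dv M 0%N; rewrite subnn => /(_ isT); apply: pfdvd_ext => x.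
congr (_ * _); rewrite -[in RHS](addr0 x) -(scale0r v) ed /d'.
case: (M) => [|m]; first by rewrite big_ord0.
by rewrite big_ord_recl /= expr0 mulr1 big1 ?addr0 // => i _; rewrite expr0n mulr0.
Qed.

(* Leading coefficients in successive directions turn the multipliers [b] into a
   nonzero constant.  This replaces unique factorization: a common divisor of
   all the [b] would be constant in every direction. *)
Lemma pfdvd_directions X (vs : seq X) (F g : X -> K) :
  pf F -> pf g -> (exists y, F y != 0) ->
  (forall a : X -> K, (forall v, v \in vs -> forall x t, a (x + t *: v) = a x) ->
     forall x, a x = a 0) ->
  (forall v, v \in vs -> exists b, [/\ pf b, exists y, b y != 0,
     forall x t, b (x + t *: v) = b x & pfdvd F (fun x => b x * g x)]) ->
  pfdvd F g.
Proof.
move=> hF hg F0 span hvs.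
suff [a [ha [y ay] ainv [q hq eq]]] : exists a, [/\ pf a, exists y, a y != 0,
    forall v, v \in vs -> forall x t, a (x + t *: v) = a x &
    pfdvd F (fun x => a x * g x)].
  have a0 := span a ainv.
  exists (fun x => (a 0)^-1 * q x).
    by apply: pf_mul => //; exact: pf_const.
  by move=> x; rewrite -mulrA -eq a0 mulKf // -(a0 y).
have : {subset vs <= vs} by [].
elim: {-2}vs => [|v s IH] ss.
  exists F; split=> //; exists g => // x; exact: mulrC.
have [|a [ha a0 ainv [u' hu' eu']]] := IH; first by move=> w ws; apply: ss; rewrite inE ws orbT.
have [b [hb b0 bv [u hu eu]]] := hvs v (ss v (mem_head _ _)).
(* From [a * g = u' * F] and [b * g = u * F], cancelling [F] in [a * b * g] gives
   [a * u = u' * b]. *)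
have dv : pfdvd b (fun x => a x * u x).
  exists u' => // x.
  apply: (@pf_cancel _ _ F (fun x => a x * u x) (fun x => u' x * b x)) => //.
  - exact: pf_mul.
  - exact: pf_mul.
  move=> {}x Fx; apply: (mulIf Fx).
  by rewrite -mulrA -eu mulrCA eu' mulrA (mulrC (b x)).
have [e [c [hc c0 ec]]] := pf_expand_lead v ha a0.
have [k [q hq eq]] := pfdvd_lead hu hb hc ec bv dv.
have [lv lw] := lead_invariant ec.
exists (fun x => c e x ^+ k); split.
- exact: pf_exp.
- by have [y cy] := c0; exists y; rewrite expf_neq0.
- move=> w; rewrite inE => /orP[/eqP ->|ws] x t; first by rewrite lv.
  by rewrite lw // => z; exact: ainv.
exists q => // x.
apply: (@pf_cancel _ _ b (fun x => c e x ^+ k * g x) (fun x => q x * F x)) => //.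
- by apply: pf_mul => //; exact: pf_exp.
- exact: pf_mul.
move=> {}x bx; apply: (mulfI bx).
by rewrite mulrCA eu mulrA eq; ring.
Qed.

End CodimensionTwo.

(** * Castling transforms *)

Section CastlingRadical.
Variable K : numFieldType.
Implicit Types X Y : lmodType K.

Lemma pf_tensor X Y (G : (X * Y)%type -> K) : pf G ->
  exists (I : finType) (a : I -> X -> K) (b : I -> Y -> K),
    [/\ forall i, pf (a i), forall i, pf (b i) &
        forall x y, G (x, y) = \sum_i a i x * b i y].
Proof.
elim=> {G} [c|l hl|f g _ [I [a [b [ha hb e]]]] _ [J [c [d [hc hd e']]]]
  |f g _ [I [a [b [ha hb e]]]] _ [J [c [d [hc hd e']]]]|f g fg _ [I [a [b [ha hb e]]]]].
- exists 'I_1, (fun _ _ => c), (fun _ _ => 1); split=> [_|_|x y]; try exact: pf_const.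
  by rewrite big_ord1 mulr1.
- exists bool, (fun s x => if s then l (x, 0) else 1), (fun s y => if s then 1 else l (0, y)).
  split=> [[]|[]|x y]; try exact: pf_const.
  + apply: pf_linform => u v w; rewrite -hl; congr l.
    by congr pair; rewrite /= scaler0 addr0.
  + apply: pf_linform => u v w; rewrite -hl; congr l.
    by congr pair; rewrite /= scaler0 addr0.
  rewrite big_bool /= mulr1 mul1r -linformD //; congr l.
  by congr pair; rewrite /= ?addr0 ?add0r.
- exists (I + J)%type, (fun s => match s with inl i => a i | inr j => c j end),
    (fun s => match s with inl i => b i | inr j => d j end).
  by split=> [[]|[]|x y] //; rewrite e e' big_sumType.
- exists (I * J)%type, (fun s x => a s.1 x * c s.2 x), (fun s x => b s.1 x * d s.2 x).
  split=> [s|s|x y]; try exact: pf_mul.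
  rewrite e e' mulr_suml -(pair_bigA _ (fun i j => a i x * c j x * (b i y * d j y))) /=.
  apply: eq_bigr => i _; rewrite mulr_sumr; apply: eq_bigr => j _; ring.
- by exists I, a, b; split=> // x y; rewrite -fg.
Qed.

Lemma pf_fst X Y (f : X -> K) : pf f -> pf (fun z : (X * Y)%type => f z.1).
Proof. by apply: (@pf_comp _ _ _ fst); apply: polymap_lin. Qed.

Lemma pf_snd X Y (f : Y -> K) : pf f -> pf (fun z : (X * Y)%type => f z.2).
Proof. by apply: (@pf_comp _ _ _ snd); apply: polymap_lin. Qed.

Lemma polymap_fix X Y (y : Y) : polymap (fun x : X => (x, y) : (X * Y)%type).
Proof.
apply: polymap_pair => l hl; first exact: pf_linform.
exact: pf_const.
Qed.

(** The quotients for the various [y] must be shown to depend polynomially on [y]. Write [G] as a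
    sum of products; if the last factor is nonzero at [y0], subtracting a multiple of [G(-, y0)],
    which [F] divides, shortens the sum by one term. *)
Lemma pfdvd_param X Y (F : X -> K) (G : (X * Y)%type -> K) : pf G ->
  (forall y, pfdvd F (fun x => G (x, y))) -> pfdvd (fun z : (X * Y)%type => F z.1) G.
Proof.
move=> /pf_tensor[I [a [b [ha hb e]]]] dv.
suff h k : forall (a : 'I_k -> X -> K) (b : 'I_k -> Y -> K), (forall i, pf (a i)) ->
    (forall i, pf (b i)) -> (forall y, pfdvd F (fun x => \sum_i a i x * b i y)) ->
    pfdvd (fun z : (X * Y)%type => F z.1) (fun z => \sum_i a i z.1 * b i z.2).
  have eI x y : G (x, y) = \sum_(i < #|I|) a (enum_val i) x * b (enum_val i) y.
    by rewrite e (reindex _ (onW_bij _ (@enum_val_bij I))).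
  apply: (@pfdvd_ext _ _ _ (fun z => \sum_(i < #|I|) a (enum_val i) z.1 * b (enum_val i) z.2)).
    by case=> x y; rewrite -eI.
  apply: (h _ (fun i => a (enum_val i)) (fun i => b (enum_val i))) => // y.
  exact: (pfdvd_ext (fun x => eI x y) (dv y)).
elim: k {dv e ha hb a b} => [|k IH] a b ha hb dv.
  by exists (fun=> 0); [exact: pf_const|move=> z; rewrite big_ord0 mul0r].
have [[y0 by0]|/pf_neg b0] := boolp.EM (exists y, b ord_max y != 0); last first.
  have [//|//|y|q hq eq] := IH (fun i => a (widen_ord (leqnSn k) i)) (fun i => b (widen_ord (leqnSn k) i)).
    by apply: pfdvd_ext (dv y) => x; rewrite big_ord_recr /= b0 mulr0 addr0.
  by exists q => // z; rewrite big_ord_recr /= b0 mulr0 addr0.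
pose b' i y := b (widen_ord (leqnSn k) i) y
   - b (widen_ord (leqnSn k) i) y0 / b ord_max y0 * b ord_max y.
have sE x y : \sum_i a i x * b i y = \sum_(i < k) a (widen_ord (leqnSn k) i) x * b' i y
    + b ord_max y / b ord_max y0 * \sum_i a i x * b i y0.
  rewrite !big_ord_recr /= mulrDr addrA; congr (_ + _); last by field.
  by rewrite mulr_sumr -big_split; apply: eq_bigr => i _ /=; rewrite /b'; field.
have hb' i : pf (b' i).
  by apply: pf_add => //; apply: pf_opp; apply: pf_mul => //; exact: pf_const.
apply: (@pfdvd_ext _ _ _ (fun z : (X * Y)%type => \sum_(i < k) a (widen_ord (leqnSn k) i) z.1 * b' i z.2
    + b ord_max z.2 / b ord_max y0 * \sum_i a i z.1 * b i y0)) => [z|]; first exact/esym/sE.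
apply: pfdvdD.
  apply: (IH (fun i => a (widen_ord (leqnSn k) i)) b') => // y.
  apply: (@pfdvd_ext _ _ _ (fun x => \sum_i a i x * b i y +
     (- (b ord_max y / b ord_max y0)) * \sum_i a i x * b i y0)) => [x|].
    by rewrite (sE x y) mulNr addrK.
  by apply: pfdvdD => //; apply: pfdvdMl => //; exact: pf_const.
apply: pfdvdMl.
  apply: pf_mul; last exact: pf_const.
  exact: (@pf_snd X Y).
have [q hq eq] := dv y0; exists (fun z => q z.1) => [|z]; first exact: pf_fst.
exact: eq.
Qed.

Lemma pfradical_param X Y (F : X -> K) :
  pfradical F -> pfradical (fun z : (X * Y)%type => F z.1).
Proof.
move=> rF g m hg [q hq eq]; apply: pfdvd_param => // y; apply: (rF _ m).
  exact: pf_comp (polymap_fix y) hg.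
exists (fun x => q (x, y)) => [|x]; last exact: (eq (x, y)).
exact: pf_comp (polymap_fix y) hq.
Qed.

(** [M] collects the maps into a sink and [M'], a basis of its kernel, the maps out of the reflected
    source; [N] and [N'] are completions to mutually inverse matrices. *)
Definition inverse_blocks p q w (M : 'M[K]_(p, w)) (N : 'M[K]_(q, w))
    (N' : 'M[K]_(w, p)) (M' : 'M[K]_(w, q)) : Prop :=
  col_mx M N *m row_mx N' M' = 1%:M /\ row_mx N' M' *m col_mx M N = 1%:M.

Lemma inverse_blocks_left p q (T : 'M[K]_(p + q)) : T \in unitmx ->
  inverse_blocks (usubmx T) (dsubmx T) (lsubmx (invmx T)) (rsubmx (invmx T)).
Proof. by move=> uT; rewrite /inverse_blocks vsubmxK hsubmxK mulmxV // mulVmx. Qed.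

Lemma inverse_blocks_right p q (T : 'M[K]_(p + q)) : T \in unitmx ->
  inverse_blocks (usubmx (invmx T)) (dsubmx (invmx T)) (lsubmx T) (rsubmx T).
Proof. by move=> uT; rewrite /inverse_blocks vsubmxK hsubmxK mulmxV // mulVmx. Qed.

Lemma pf_matrix_directions m n o (a : ('M[K]_(m, n) * 'cV[K]_o)%type -> K) :
  (forall i j x t, a (x + t *: (delta_mx i j, 0)) = a x) ->
  (forall i x t, a (x + t *: (0, delta_mx i 0)) = a x) -> forall x, a x = a 0.
Proof.
move=> h1 h2; pose Q y := forall x, a (x + y) = a x.
have Q0 : Q 0 by move=> x; rewrite addr0.
have QD y z : Q y -> Q z -> Q (y + z) by move=> Qy Qz x; rewrite addrA Qz Qy.
have Ql A : Q (A, 0).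
  have -> : (A, 0) = \sum_i \sum_j A i j *: (delta_mx i j, 0) :> ('M[K]_(m, n) * 'cV[K]_o)%type.
    rewrite {1}(matrix_sum_delta A).
    have hD : {morph (fun B : 'M[K]_(m, n) => (B, 0) : ('M[K]_(m, n) * 'cV[K]_o)%type) : x y / x + y}.
      by move=> x y; congr pair; rewrite /= addr0.
    rewrite (big_morph _ hD (erefl : _ = 0)).
    apply: eq_bigr => i _; rewrite (big_morph _ hD (erefl : _ = 0)); apply: eq_bigr => j _.
    by congr pair; rewrite /= scaler0.
  by apply: big_ind => // i _; apply: big_ind => // j _ x; rewrite h1.
have Qr r : Q (0, r).
  have -> : (0, r) = \sum_i r i 0 *: (0, delta_mx i 0) :> ('M[K]_(m, n) * 'cV[K]_o)%type.
    rewrite {1}(matrix_sum_delta r).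
    have hD : {morph (fun B : 'cV[K]_o => (0, B) : ('M[K]_(m, n) * 'cV[K]_o)%type) : x y / x + y}.
      by move=> x y; congr pair; rewrite /= addr0.
    rewrite (big_morph _ hD (erefl : _ = 0)).
    apply: eq_bigr => i _; rewrite big_ord1; congr pair; by rewrite /= scaler0.
  by apply: big_ind => // i _ x; rewrite h2.
case=> A r; have <- := QD _ _ (Ql A) (Qr r) 0; rewrite add0r; congr a.
by congr pair; rewrite /= ?addr0 ?add0r.
Qed.

(* [F'] times a power of a maximal minor of [row_mx N' M'] with [N'] constant
   inherits divisibility from the radical [F]; as [p > 0], for every entry of
   [M'] some such minor does not involve it. *)
Lemma castling_radical p q w n0 (F : ('M[K]_(p, w) * 'cV[K]_n0)%type -> K)
    (F' : ('M[K]_(w, q) * 'cV[K]_n0)%type -> K) u1 u2 :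
  w = (p + q)%N -> (0 < p)%N -> pf F -> pf F' -> (exists y, F' y != 0) -> pf u1 -> pf u2 ->
  (forall M N N' M' r, inverse_blocks M N N' M' -> F (M, r) = u1 (M, N) * F' (M', r)) ->
  (forall M N N' M' r, inverse_blocks M N N' M' -> F' (M', r) = u2 (N', M') * F (M, r)) ->
  pfradical F -> pfradical F'.
Proof.
move=> E; subst w => p0 hF hF' F'0 hu1 hu2 H1 H2 rF g m hg [qq hqq eqq].
pose dl (z : (('M[K]_(p, p + q) * 'cV[K]_n0) * 'M[K]_(q, p + q))%type) := \det (col_mx z.1.1 z.2).
have hcol i j : pf (fun z : (('M[K]_(p, p + q) * 'cV[K]_n0) * 'M[K]_(q, p + q))%type =>
    col_mx z.1.1 z.2 i j).
  apply: pf_linform => a u v; rewrite !mxE; by case: splitP => k _; rewrite !mxE.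
have hdl : pf dl by apply: pf_det.
have rinv i j : regular dl (fun z => invmx (col_mx z.1.1 z.2) i j).
  apply: (@regular_invmx _ _ dl _ _ (fun=> 1)) => // [|x]; first exact: pf_const.
  by rewrite mul1r.
have rM' : rmap dl (fun z => (rsubmx (invmx (col_mx z.1.1 z.2)), z.1.2) : ('M[K]_(p+q, q) * 'cV[K]_n0)%type).
  apply: (rmap_pair hdl).
    apply: (rmap_mx hdl) => i j; apply: regular_ext (rinv i (rshift p j)) => x _.
    by rewrite [RHS]mxE.
  by apply: rmap_polymap; apply: polymap_lin.
have rNM' : rmap dl (fun z => (lsubmx (invmx (col_mx z.1.1 z.2)), rsubmx (invmx (col_mx z.1.1 z.2)))
     : ('M[K]_(p+q, p) * 'M[K]_(p+q, q))%type).
  apply: (rmap_pair hdl); apply: (rmap_mx hdl) => i j.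
    by apply: regular_ext (rinv i (lshift q j)) => x _; rewrite [RHS]mxE.
  by apply: regular_ext (rinv i (rshift p j)) => x _; rewrite [RHS]mxE.
have [e [gh [hgh egh]]] := regular_comp hdl rM' hg.
have [e2 [wh [hwh ewh]]] := regular_mul (regular_comp hdl rM' hqq) (regular_comp hdl rNM' hu2).
have uni z : dl z != 0 -> col_mx z.1.1 z.2 \in unitmx by rewrite unitmxE unitfE.
(* The pullback of [g] lives on the pairs [(M,N)]. The exponent pays [m] for the hypothesis and [e2]
   for the denominators of quotient and unit; the final 1 makes both sides vanish where [dl]
   does. *)
have [||h hh eh] := @pfradical_param _ 'M[K]_(q, p + q) F rF (fun z => dl z * gh z) (m + e2 + 1)%N.
- exact: pf_mul.
- exists (fun z => dl z ^+ (m + 1) * gh z ^+ (e2 + 1) * dl z ^+ (e * m) * wh z).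
    by do ![apply: pf_mul => //]; exact: pf_exp.
  move=> z; have [d0|dz] := eqVneq (dl z) 0.
    by rewrite d0 mul0r !addn1 !expr0n /= !mul0r.
  have ib := inverse_blocks_left (uni z dz); rewrite col_mxKu col_mxKd in ib.
  have /= H2' := H2 _ _ _ _ z.1.2 ib; have /= q2 := eqq (rsubmx (invmx (col_mx z.1.1 z.2)), z.1.2).
  rewrite ewh // exprMn !exprD !expr1.
  have -> : gh z ^+ m = dl z ^+ (e * m) * (qq (rsubmx (invmx (col_mx z.1.1 z.2)), z.1.2) *
     (u2 (lsubmx (invmx (col_mx z.1.1 z.2)), rsubmx (invmx (col_mx z.1.1 z.2))) * F z.1)).
    by rewrite egh // exprMn -exprM q2 H2'; case: (z.1).
  ring.
pose d' (z : (('M[K]_(p + q, q) * 'cV[K]_n0) * 'M[K]_(p + q, p))%type) := \det (row_mx z.2 z.1.1).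
have hrow i j : pf (fun z : (('M[K]_(p + q, q) * 'cV[K]_n0) * 'M[K]_(p + q, p))%type =>
    row_mx z.2 z.1.1 i j).
  apply: pf_linform => a u v; rewrite !mxE; by case: splitP => k _; rewrite !mxE.
have hd' : pf d' by apply: pf_det.
have rinv' i j : regular d' (fun z => invmx (row_mx z.2 z.1.1) i j).
  apply: (@regular_invmx _ _ d' _ _ (fun=> 1)) => // [|x]; first exact: pf_const.
  by rewrite mul1r.
have rM : rmap d' (fun z => usubmx (invmx (row_mx z.2 z.1.1))).
  by apply: (rmap_mx hd') => i j; apply: regular_ext (rinv' (lshift q i) j) => x _; rewrite [RHS]mxE.
have rN : rmap d' (fun z => dsubmx (invmx (row_mx z.2 z.1.1))).
  by apply: (rmap_mx hd') => i j; apply: regular_ext (rinv' (rshift p i) j) => x _; rewrite [RHS]mxE.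
have rx : rmap d' (fun z => ((usubmx (invmx (row_mx z.2 z.1.1)), z.1.2), dsubmx (invmx (row_mx z.2 z.1.1)))
    : (('M[K]_(p, p + q) * 'cV[K]_n0) * 'M[K]_(q, p + q))%type).
  apply: (rmap_pair hd') => //; apply: (rmap_pair hd') => //.
  by apply: rmap_polymap; apply: polymap_lin.
have [e3 [kh [hkh ekh]]] := regular_mul (regular_comp hd' rx hh)
   (regular_comp hd' (rmap_pair hd' rM rN) hu1).
(* The relation read back in the variables [(M',N')], where [d'] is the inverse of [dl]. *)
have dv z : d' z ^+ e3.+1 * g z.1 = d' z ^+ e.+2 * kh z * F' z.1.
  have [d0|dz] := eqVneq (d' z) 0; first by rewrite d0 !expr0n /= !mul0r.
  have uz : row_mx z.2 z.1.1 \in unitmx by rewrite unitmxE unitfE.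
  have ib := inverse_blocks_right uz; rewrite row_mxKl row_mxKr in ib.
  pose x : (('M[K]_(p, p + q) * 'cV[K]_n0) * 'M[K]_(q, p + q))%type :=
    ((usubmx (invmx (row_mx z.2 z.1.1)), z.1.2), dsubmx (invmx (row_mx z.2 z.1.1))).
  have dx : dl x = (d' z)^-1 by rewrite /dl /= vsubmxK det_inv.
  have dx0 : dl x != 0 by rewrite dx invr_eq0.
  have := eh x; rewrite egh // /x /= vsubmxK invmxK row_mxKr -/x dx.
  have /= -> := H1 _ _ _ _ z.1.2 ib; rewrite ekh // -/x => E.
  have -> : g z.1 = d' z ^+ e.+1 * ((d' z)^-1 * ((d' z)^-1 ^+ e * g (z.1.1, z.1.2))).
    rewrite exprVn exprS; case: (z.1) => a b /=; field.
    by rewrite dz expf_neq0.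
  rewrite E (exprS _ e3) (exprS _ e.+1); case: (z.1) => a b /=; ring.
have hb N0 : pf (fun x : ('M[K]_(p + q, q) * 'cV[K]_n0)%type => d' (x, N0) ^+ e3.+1).
  by apply: pf_exp; exact: pf_comp (polymap_fix N0) hd'.
have dvb N0 : pfdvd F' (fun x => d' (x, N0) ^+ e3.+1 * g x).
  exists (fun x => d' (x, N0) ^+ e.+2 * kh (x, N0)) => [|x]; last exact: (dv (x, N0)).
  apply: pf_mul; first by apply: pf_exp; exact: pf_comp (polymap_fix N0) hd'.
  exact: pf_comp (polymap_fix N0) hkh.
(* The first column of the left block of [Pi i] is the [i]-th basis vector. Changing row [i] of [M']
   is then a column operation, which leaves the determinant unchanged; the right block of [Pi i]
   shows that this determinant is not identically zero. *)
pose Pi (i : 'I_(p + q)) : 'M[K]_(p + q) := tperm_mx (lshift q (Ordinal p0)) i.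
have bn0 i : exists y, d' (y, lsubmx (Pi i)) ^+ e3.+1 != 0.
  exists (rsubmx (Pi i), 0); rewrite expf_neq0 // /d' /= hsubmxK det_perm.
  by rewrite signr_eq0.
pose vs : seq ('M[K]_(p + q, q) * 'cV[K]_n0)%type :=
  [seq (delta_mx ij.1 ij.2, 0) | ij : 'I_(p + q) * 'I_q] ++ [seq (0, delta_mx i 0) | i : 'I_n0].
apply: (@pfdvd_directions _ _ vs) => //.
  move=> a ha; apply: pf_matrix_directions => [i j|i]; apply: ha; rewrite mem_cat.
    by apply/orP; left; apply/imageP; exists (i, j).
  by apply/orP; right; apply/imageP; exists i.
move=> v; rewrite mem_cat => /orP[/imageP[[i j] _ ->]|/imageP[i _ ->]]; last first.
  exists (fun x => d' (x, lsubmx (Pi (lshift q (Ordinal p0)))) ^+ e3.+1).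
  by split=> // x t; rewrite /d' /= scaler0 addr0.
exists (fun x => d' (x, lsubmx (Pi i)) ^+ e3.+1); split=> // x t.
rewrite /d' /=; congr (_ ^+ _).
pose B : 'M[K]_(p + q) := block_mx 1%:M (t *: delta_mx (Ordinal p0) j) 0 1%:M.
have -> : row_mx (lsubmx (Pi i)) (x.1 + t *: delta_mx i j) = row_mx (lsubmx (Pi i)) x.1 *m B.
  rewrite /B mul_row_block !mulmx1 mulmx0 addr0 addrC; congr (row_mx _ (_ + _)).
  rewrite -scalemxAr; congr (_ *: _); apply/matrixP => a b; rewrite !mxE.
  rewrite (bigD1 (Ordinal p0)) //= big1 ?addr0 => [|c nc].
    rewrite !mxE eqxx /= -natrM mulnb; congr ((_ && _)%:R).
    by rewrite -(inj_eq (@perm_inj _ (tperm (lshift q (Ordinal p0)) i))) tpermR.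
  by rewrite [X in _ * X]mxE (negbTE nc) mulr0.
by rewrite det_mulmx /B det_ublock !det1 !mulr1.
Qed.

End CastlingRadical.

(** * Determinants of the infinitesimal actions on the two sides of a reflection *)

Section CastlingDeterminant.
Variable K : numFieldType.

Lemma mul_lin1_mx m n (f : 'rV[K]_m -> 'rV[K]_n) :
  (forall a u v, f (a *: u + v) = a *: f u + f v) ->
  forall v, v *m lin1_mx f = f v.
Proof.
move=> hf v; apply/rowP => j.
have hl : linform (fun u => f u 0 j) by move=> a u1 u2; rewrite hf !mxE.
rewrite !mxE [RHS](linform_mx hl) big_ord1; apply: eq_bigr => i _.
by rewrite [in LHS]mxE.
Qed.

Lemma rV_matrix_ext m n (A B : 'M[K]_(m, n)) :
  (forall v : 'rV_m, v *m A = v *m B) -> A = B.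
Proof. by move=> h; apply/row_matrixP => i; rewrite !rowE h. Qed.

Lemma det_neq0P n (A : 'M[K]_n) :
  \det A != 0 <-> forall v : 'rV_n, v *m A = 0 -> v = 0.
Proof.
split=> [nz v vA|h].
  apply/eqP/negP => /negP v0; move/negP: nz; apply.
  by apply/det0P; exists v.
by apply/negP => /det0P[v v0 /h v00]; rewrite v00 eqxx in v0.
Qed.

Variables (p q w n0 : nat).
Variables (b : 'rV[K]_(p * q + n0) -> 'M[K]_w).
Variables (rho : 'rV[K]_(p * q + n0) -> 'cV[K]_n0 -> 'cV[K]_n0).
Hypothesis b_lin : forall a u v, b (a *: u + v) = a *: b u + b v.
Hypothesis rho_lin1 : forall r a u v, rho (a *: u + v) r = a *: rho u r + rho v r.
Hypothesis rho_lin2 : forall c a r s, rho c (a *: r + s) = a *: rho c r + rho c s.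
Variables (M0 : 'M[K]_(p, w)) (N0 : 'M[K]_(q, w)).
Variables (N0' : 'M[K]_(w, p)) (M0' : 'M[K]_(w, q)).
Hypothesis ib0 : inverse_blocks M0 N0 N0' M0'.

(** The infinitesimal action at [(M, r)]: the left part of [v] acts at the reflected vertex, the
    right part elsewhere. With [p * q + n0] parameters elsewhere, a number symmetric in [p] and [q],
    source and target have equal dimension on both sides as soon as [w = p + q]. *)
Definition tangent_row (M : 'M[K]_(p, w)) (r : 'cV[K]_n0)
    (v : 'rV[K]_(p * p + (p * q + n0))) : 'rV[K]_(p * w + n0) :=
  row_mx (mxvec (vec_mx (lsubmx v) *m M + M *m b (rsubmx v))) (rho (rsubmx v) r)^T.

Definition tangent_col (M' : 'M[K]_(w, q)) (r : 'cV[K]_n0)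
    (v : 'rV[K]_(q * q + (p * q + n0))) : 'rV[K]_(w * q + n0) :=
  row_mx (mxvec (M' *m vec_mx (lsubmx v) + b (rsubmx v) *m M')) (rho (rsubmx v) r)^T.

(* In the frame given by an inverse pair [(M,N)], [(N',M')] both tangent maps
   become block triangular with the common diagonal block [core_map]. *)
Definition core_map (M : 'M[K]_(p, w)) (M' : 'M[K]_(w, q)) (r : 'cV[K]_n0)
    (c : 'rV[K]_(p * q + n0)) : 'rV[K]_(p * q + n0) :=
  row_mx (mxvec (M *m b c *m M')) (rho c r)^T.

Definition row_frame (N' : 'M[K]_(w, p)) (M' : 'M[K]_(w, q))
    (y : 'rV[K]_(p * w + n0)) : 'rV[K]_(p * p + (p * q + n0)) :=
  row_mx (mxvec (vec_mx (lsubmx y) *m N'))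
    (row_mx (mxvec (vec_mx (lsubmx y) *m M')) (rsubmx y)).

Definition row_coframe (M : 'M[K]_(p, w)) (N : 'M[K]_(q, w))
    (z : 'rV[K]_(p * p + (p * q + n0))) : 'rV[K]_(p * w + n0) :=
  row_mx (mxvec (vec_mx (lsubmx z) *m M + vec_mx (lsubmx (rsubmx z)) *m N))
    (rsubmx (rsubmx z)).

Definition col_frame (M : 'M[K]_(p, w)) (N : 'M[K]_(q, w))
    (y : 'rV[K]_(w * q + n0)) : 'rV[K]_(q * q + (p * q + n0)) :=
  row_mx (mxvec (N *m vec_mx (lsubmx y)))
    (row_mx (mxvec (M *m vec_mx (lsubmx y))) (rsubmx y)).

Definition col_coframe (N' : 'M[K]_(w, p)) (M' : 'M[K]_(w, q))
    (z : 'rV[K]_(q * q + (p * q + n0))) : 'rV[K]_(w * q + n0) :=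
  row_mx (mxvec (M' *m vec_mx (lsubmx z) + N' *m vec_mx (lsubmx (rsubmx z))))
    (rsubmx (rsubmx z)).

Lemma tangent_row_lin M r : forall a u v,
  tangent_row M r (a *: u + v) = a *: tangent_row M r u + tangent_row M r v.
Proof.
move=> a u v; rewrite /tangent_row !linearP /= b_lin rho_lin1 scale_row_mx add_row_mx.
congr row_mx; rewrite -[RHS]linearP //=; congr mxvec.
by rewrite ?mulmxDl ?mulmxDr -?scalemxAl -?scalemxAr scalerDr addrACA.
Qed.

Lemma tangent_col_lin M r : forall a u v,
  tangent_col M r (a *: u + v) = a *: tangent_col M r u + tangent_col M r v.
Proof.
move=> a u v; rewrite /tangent_col !linearP /= b_lin rho_lin1 scale_row_mx add_row_mx.
congr row_mx; rewrite -[RHS]linearP //=; congr mxvec.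
by rewrite ?mulmxDl ?mulmxDr -?scalemxAl -?scalemxAr scalerDr addrACA.
Qed.

Lemma core_map_lin M M' r : forall a u v,
  core_map M M' r (a *: u + v) = a *: core_map M M' r u + core_map M M' r v.
Proof.
move=> a u v; rewrite /core_map b_lin rho_lin1 scale_row_mx add_row_mx.
congr row_mx; rewrite -[RHS]linearP //=; congr mxvec.
by rewrite ?mulmxDr mulmxDl -?scalemxAr -scalemxAl.
Qed.

Lemma row_frame_lin N' M' : forall a u v,
  row_frame N' M' (a *: u + v) = a *: row_frame N' M' u + row_frame N' M' v.
Proof.
move=> a u v; rewrite /row_frame !linearP /= !scale_row_mx !add_row_mx.
by congr row_mx; [|congr row_mx]; rewrite -[RHS]linearP //=; congr mxvec;
  rewrite mulmxDl -scalemxAl.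
Qed.

Lemma row_coframe_lin M N : forall a u v,
  row_coframe M N (a *: u + v) = a *: row_coframe M N u + row_coframe M N v.
Proof.
move=> a u v; rewrite /row_coframe !linearP /= !scale_row_mx !add_row_mx.
congr row_mx; rewrite -[RHS]linearP //=; congr mxvec.
by rewrite !mulmxDl -!scalemxAl scalerDr addrACA.
Qed.

Lemma col_frame_lin M N : forall a u v,
  col_frame M N (a *: u + v) = a *: col_frame M N u + col_frame M N v.
Proof.
by move=> a u v; rewrite /col_frame !linearP /= !scale_row_mx !add_row_mx.
Qed.

Lemma col_coframe_lin N' M' : forall a u v,
  col_coframe N' M' (a *: u + v) = a *: col_coframe N' M' u + col_coframe N' M' v.
Proof.
move=> a u v; rewrite /col_coframe !linearP /= !scale_row_mx !add_row_mx.
congr row_mx; rewrite -[RHS]linearP //=; congr mxvec.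
by rewrite ?mulmxDr -?scalemxAr scalerDr addrACA.
Qed.

Lemma inverse_blocksE (M : 'M[K]_(p, w)) (N : 'M[K]_(q, w)) N' M' :
  inverse_blocks M N N' M' ->
  [/\ M *m N' = 1%:M, M *m M' = 0, N *m N' = 0, N *m M' = 1%:M &
      N' *m M + M' *m N = 1%:M].
Proof.
move=> [h1 h2]; move: h1; rewrite mul_col_row scalar_mx_block.
by move/eq_block_mx => [-> -> -> ->]; rewrite mul_row_col in h2.
Qed.

(** Source and target agree in dimension but not as types; a fixed frame makes the matrix square
    and, being constant, keeps the determinant polynomial and homogeneous. *)
Definition row_disc (z : ('M[K]_(p, w) * 'cV[K]_n0)%type) : K :=
  \det (lin1_mx (tangent_row z.1 z.2) *m lin1_mx (row_frame N0' M0')).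

Definition col_disc (z : ('M[K]_(w, q) * 'cV[K]_n0)%type) : K :=
  \det (lin1_mx (tangent_col z.1 z.2) *m lin1_mx (col_frame M0 N0)).

Definition core_disc M M' r : K := \det (lin1_mx (core_map M M' r)).

Lemma row_frameK M N N' M' : inverse_blocks M N N' M' ->
  lin1_mx (row_frame N' M') *m lin1_mx (row_coframe M N) = 1%:M.
Proof.
move=> /inverse_blocksE[_ _ _ _ e]; apply: rV_matrix_ext => v.
rewrite mulmxA (mul_lin1_mx (@row_frame_lin _ _)) (mul_lin1_mx (@row_coframe_lin _ _)).
rewrite /row_coframe /row_frame !row_mxKl !row_mxKr !row_mxKl !mxvecK.
by rewrite -!mulmxA -mulmxDr e !mulmx1 vec_mxK hsubmxK.
Qed.

Lemma col_frameK M N N' M' : inverse_blocks M N N' M' ->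
  lin1_mx (col_frame M N) *m lin1_mx (col_coframe N' M') = 1%:M.
Proof.
move=> /inverse_blocksE[_ _ _ _ e]; apply: rV_matrix_ext => v.
rewrite mulmxA (mul_lin1_mx (@col_frame_lin _ _)) (mul_lin1_mx (@col_coframe_lin _ _)).
rewrite /col_coframe /col_frame !row_mxKl !row_mxKr !row_mxKl !mxvecK.
by rewrite !mulmxA -mulmxDl addrC e mul1mx mulmx1 vec_mxK hsubmxK.
Qed.

Lemma row_disc_core M N N' M' r : inverse_blocks M N N' M' ->
  \det (lin1_mx (tangent_row M r) *m lin1_mx (row_frame N' M')) = core_disc M M' r.
Proof.
move=> /inverse_blocksE[e1 e2 e3 e4 _].
pose G := lin1_mx (fun c => mxvec (M *m b c *m N')).
have hG c : c *m G = mxvec (M *m b c *m N').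
  apply: mul_lin1_mx => a u v; rewrite b_lin -linearP /=; congr mxvec.
  by rewrite ?mulmxDr mulmxDl -?scalemxAr -scalemxAl.
have -> : lin1_mx (tangent_row M r) *m lin1_mx (row_frame N' M') =
    block_mx 1%:M 0 G (lin1_mx (core_map M M' r)).
  apply: rV_matrix_ext => v; rewrite mulmxA (mul_lin1_mx (tangent_row_lin _ _)).
  rewrite (mul_lin1_mx (@row_frame_lin _ _)) -[in RHS](hsubmxK v) mul_row_block.
  rewrite mulmx1 mulmx0 add0r hG (mul_lin1_mx (@core_map_lin _ _ _)).
  rewrite /row_frame /tangent_row /core_map row_mxKl row_mxKr mxvecK.
  by rewrite !mulmxDl -!mulmxA e1 e2 mulmx1 mulmx0 add0r linearD /= vec_mxK.
by rewrite det_lblock det1 mul1r.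
Qed.

Lemma col_disc_core M N N' M' r : inverse_blocks M N N' M' ->
  \det (lin1_mx (tangent_col M' r) *m lin1_mx (col_frame M N)) = core_disc M M' r.
Proof.
move=> /inverse_blocksE[e1 e2 e3 e4 _].
pose G := lin1_mx (fun c => mxvec (N *m b c *m M')).
have hG c : c *m G = mxvec (N *m b c *m M').
  apply: mul_lin1_mx => a u v; rewrite b_lin -linearP /=; congr mxvec.
  by rewrite ?mulmxDr mulmxDl -?scalemxAr -scalemxAl.
have -> : lin1_mx (tangent_col M' r) *m lin1_mx (col_frame M N) =
    block_mx 1%:M 0 G (lin1_mx (core_map M M' r)).
  apply: rV_matrix_ext => v; rewrite mulmxA (mul_lin1_mx (tangent_col_lin _ _)).
  rewrite (mul_lin1_mx (@col_frame_lin _ _)) -[in RHS](hsubmxK v) mul_row_block.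
  rewrite mulmx1 mulmx0 add0r hG (mul_lin1_mx (@core_map_lin _ _ _)).
  rewrite /col_frame /tangent_col /core_map row_mxKl row_mxKr mxvecK.
  by rewrite !mulmxDr !mulmxA e2 e4 mul1mx mul0mx add0r linearD /= vec_mxK.
by rewrite det_lblock det1 mul1r.
Qed.

Lemma det_reframe m n (S : 'M[K]_(m, n)) (L L0 : 'M[K]_(n, m)) (L0' : 'M[K]_(m, n)) :
  L0 *m L0' = 1%:M -> \det (S *m L) = \det (S *m L0) * \det (L0' *m L).
Proof. by move=> e; rewrite -det_mulmx -mulmxA (mulmxA L0) e mul1mx. Qed.

(** Both determinants equal [core_disc] in the frame of the pair. Returning to the fixed frames
    costs determinants of frame changes, which here are polynomial in [M] and [N] alone. *)
Lemma row_disc_col_disc M N N' M' r : inverse_blocks M N N' M' ->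
  row_disc (M, r) = \det (lin1_mx (row_coframe M N) *m lin1_mx (row_frame N0' M0')) *
    \det (lin1_mx (col_coframe N0' M0') *m lin1_mx (col_frame M N)) * col_disc (M', r).
Proof.
move=> ib; rewrite /row_disc (det_reframe _ _ (row_frameK ib)) /= (row_disc_core r ib).
rewrite -(col_disc_core r ib) (det_reframe _ _ (col_frameK ib0)) /col_disc /=; ring.
Qed.

Lemma col_disc_row_disc M N N' M' r : inverse_blocks M N N' M' ->
  col_disc (M', r) = \det (lin1_mx (col_coframe N' M') *m lin1_mx (col_frame M0 N0)) *
    \det (lin1_mx (row_coframe M0 N0) *m lin1_mx (row_frame N' M')) * row_disc (M, r).
Proof.
move=> ib; rewrite /col_disc (det_reframe _ _ (col_frameK ib)) /= (col_disc_core r ib).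
rewrite -(row_disc_core r ib) (det_reframe _ _ (row_frameK ib0)) /row_disc /=; ring.
Qed.

Lemma row_disc_neq0 M r : row_disc (M, r) != 0 <->
  forall v, tangent_row M r v = 0 -> v = 0.
Proof.
rewrite det_neq0P; split=> h v hv; apply: h.
  by rewrite mulmxA (mul_lin1_mx (tangent_row_lin _ _)) /= hv mul0mx.
move: hv; rewrite mulmxA (mul_lin1_mx (tangent_row_lin _ _)) /= => hv.
by rewrite -[tangent_row M r v]mulmx1 -(row_frameK ib0) mulmxA hv mul0mx.
Qed.

Lemma col_disc_neq0 M' r : col_disc (M', r) != 0 <->
  forall v, tangent_col M' r v = 0 -> v = 0.
Proof.
rewrite det_neq0P; split=> h v hv; apply: h.
  by rewrite mulmxA (mul_lin1_mx (tangent_col_lin _ _)) /= hv mul0mx.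
move: hv; rewrite mulmxA (mul_lin1_mx (tangent_col_lin _ _)) /= => hv.
by rewrite -[tangent_col M' r v]mulmx1 -(col_frameK ib0) mulmxA hv mul0mx.
Qed.

Lemma tangent_row_bilin v a z z' :
  tangent_row (a *: z + z').1 (a *: z + z').2 v =
  a *: tangent_row z.1 z.2 v + tangent_row z'.1 z'.2 v.
Proof.
rewrite /tangent_row scale_row_mx add_row_mx /= rho_lin2; congr row_mx.
  rewrite -[RHS]linearP /=; congr mxvec.
  by rewrite ?mulmxDl ?mulmxDr -?scalemxAl -?scalemxAr scalerDr addrACA.
by rewrite linearP.
Qed.

Lemma tangent_col_bilin v a z z' :
  tangent_col (a *: z + z').1 (a *: z + z').2 v =
  a *: tangent_col z.1 z.2 v + tangent_col z'.1 z'.2 v.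
Proof.
rewrite /tangent_col scale_row_mx add_row_mx /= rho_lin2; congr row_mx.
  rewrite -[RHS]linearP /=; congr mxvec.
  by rewrite ?mulmxDl ?mulmxDr -?scalemxAl -?scalemxAr scalerDr addrACA.
by rewrite linearP.
Qed.

Lemma pf_mulmx (X : lmodType K) m n o (A : X -> 'M[K]_(m, n)) (B : X -> 'M[K]_(n, o)) :
  (forall i j, pf (fun x => A x i j)) -> (forall i j, pf (fun x => B x i j)) ->
  forall i j, pf (fun x => (A x *m B x) i j).
Proof.
move=> hA hB i j; apply: (@pf_ext _ _ (fun x => \sum_k A x i k * B x k j)).
  by move=> x; rewrite mxE.
by apply: pf_sum => k; exact: pf_mul.
Qed.

Lemma pf_lin1_mx (X : lmodType K) m n (f : X -> 'rV[K]_m -> 'rV[K]_n) :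
  (forall v a x y, f (a *: x + y) v = a *: f x v + f y v) ->
  forall i j, pf (fun x => lin1_mx (f x) i j).
Proof. by move=> hf i j; apply: pf_linform => a x y; rewrite !mxE hf !mxE. Qed.

Lemma pf_row_disc : pf row_disc.
Proof.
apply: pf_det; apply: pf_mulmx => i j; last exact: pf_const.
apply: (@pf_lin1_mx _ _ _ (fun z => tangent_row z.1 z.2)) => v a x y; exact: tangent_row_bilin.
Qed.

Lemma pf_col_disc : pf col_disc.
Proof.
apply: pf_det; apply: pf_mulmx => i j; last exact: pf_const.
apply: (@pf_lin1_mx _ _ _ (fun z => tangent_col z.1 z.2)) => v a x y; exact: tangent_col_bilin.
Qed.

Lemma row_disc_homog t z : row_disc (t *: z) = t ^+ (p * p + (p * q + n0)) * row_disc z.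
Proof.
have r0 c : rho c 0 = 0.
  by have := rho_lin2 c (-1) 0 0; rewrite scaler0 addr0 scaleN1r addNr.
have e v : tangent_row (t *: z).1 (t *: z).2 v = t *: tangent_row z.1 z.2 v.
  have := tangent_row_bilin v t z 0; rewrite addr0 => ->.
  by rewrite {2}/tangent_row /= r0 mulmx0 mul0mx addr0 linear0 trmx0 row_mx0 addr0.
rewrite /row_disc -detZ scalemxAl; congr (\det (_ *m _)).
by apply/matrixP => i j; rewrite [LHS]mxE e !mxE.
Qed.

Lemma col_disc_homog t z : col_disc (t *: z) = t ^+ (q * q + (p * q + n0)) * col_disc z.
Proof.
have r0 c : rho c 0 = 0.
  by have := rho_lin2 c (-1) 0 0; rewrite scaler0 addr0 scaleN1r addNr.
have e v : tangent_col (t *: z).1 (t *: z).2 v = t *: tangent_col z.1 z.2 v.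
  have := tangent_col_bilin v t z 0; rewrite addr0 => ->.
  by rewrite {2}/tangent_col /= r0 mulmx0 mul0mx addr0 linear0 trmx0 row_mx0 addr0.
rewrite /col_disc -detZ scalemxAl; congr (\det (_ *m _)).
by apply/matrixP => i j; rewrite [LHS]mxE e !mxE.
Qed.

Definition row_to_col_unit (z : ('M[K]_(p, w) * 'M[K]_(q, w))%type) : K :=
  \det (lin1_mx (row_coframe z.1 z.2) *m lin1_mx (row_frame N0' M0')) *
  \det (lin1_mx (col_coframe N0' M0') *m lin1_mx (col_frame z.1 z.2)).

Definition col_to_row_unit (z : ('M[K]_(w, p) * 'M[K]_(w, q))%type) : K :=
  \det (lin1_mx (col_coframe z.1 z.2) *m lin1_mx (col_frame M0 N0)) *
  \det (lin1_mx (row_coframe M0 N0) *m lin1_mx (row_frame z.1 z.2)).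

(** Frames leave the last [n0] coordinates alone, so they depend on the blocks affinely and not
    linearly. *)
Lemma pf_affine_lin1_mx (X : lmodType K) m n (f : X -> 'rV[K]_m -> 'rV[K]_n) :
  (forall v a x y, f (a *: x + y) v - f 0 v = a *: (f x v - f 0 v) + (f y v - f 0 v)) ->
  forall i j, pf (fun x => lin1_mx (f x) i j).
Proof.
move=> hf i j; apply: (@pf_ext _ _ (fun x => lin1_mx (fun v => f x v - f 0 v) i j + f 0 (delta_mx 0 i) 0 j)).
  by move=> x; rewrite !mxE subrK.
apply: pf_add; last exact: pf_const.
exact: (@pf_lin1_mx _ _ _ (fun x v => f x v - f 0 v)).
Qed.

Lemma row_mx_affine m n o (x y z : 'M[K]_(m, n)) (s : 'M[K]_(m, o)) a x' y' :
  z = a *: x + y -> x' = 0 -> y' = s ->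
  row_mx z s - row_mx x' y' = a *: (row_mx x s - row_mx x' y') + (row_mx y s - row_mx x' y').
Proof.
by move=> -> -> ->; rewrite !opp_row_mx !add_row_mx !scale_row_mx !add_row_mx
  !subrr !subr0 scaler0 addr0.
Qed.

Lemma pf_row_to_col_unit : pf row_to_col_unit.
Proof.
apply: pf_mul; apply: pf_det; apply: pf_mulmx => i j; try exact: pf_const.
  apply: (@pf_affine_lin1_mx _ _ _ (fun z => row_coframe z.1 z.2)) => v a x y.
  apply: row_mx_affine => //=; last by rewrite !mulmx0 addr0 linear0.
  rewrite -[RHS]linearP /=; congr mxvec.
  by rewrite ?mulmxDr -?scalemxAr scalerDr addrACA.
apply: (@pf_affine_lin1_mx _ _ _ (fun z => col_frame z.1 z.2)) => v a x y.
rewrite /col_frame !opp_row_mx !add_row_mx !scale_row_mx !add_row_mx.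
rewrite /= !mul0mx !linear0 !addr0 !subrr scaler0 addr0.
by rewrite !mulmxDl -!scalemxAl !linearP.
Qed.

Lemma pf_col_to_row_unit : pf col_to_row_unit.
Proof.
apply: pf_mul; apply: pf_det; apply: pf_mulmx => i j; try exact: pf_const.
  apply: (@pf_affine_lin1_mx _ _ _ (fun z => col_coframe z.1 z.2)) => v a x y.
  apply: row_mx_affine => //=; last by rewrite !mul0mx addr0 linear0.
  rewrite -[RHS]linearP /=; congr mxvec.
  by rewrite !mulmxDl -!scalemxAl scalerDr addrACA.
apply: (@pf_affine_lin1_mx _ _ _ (fun z => row_frame z.1 z.2)) => v a x y.
rewrite /row_frame !opp_row_mx !add_row_mx !scale_row_mx !add_row_mx.
rewrite /= !mulmx0 !linear0 !addr0 !subrr scaler0 addr0.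
by rewrite !mulmxDr -!scalemxAr !linearP.
Qed.

Hypothesis wE : w = (p + q)%N.

Lemma row_to_col_radical : (0 < p)%N -> (exists y, col_disc y != 0) ->
  pfradical row_disc -> pfradical col_disc.
Proof.
move=> p0 nz.
apply: (castling_radical wE p0 pf_row_disc pf_col_disc nz pf_row_to_col_unit
  pf_col_to_row_unit) => M N N' M' r ib.
- exact: (row_disc_col_disc r ib).
- exact: (col_disc_row_disc r ib).
Qed.

Lemma inverse_blocks_tr (M : 'M[K]_(q, w)) (N : 'M[K]_(p, w)) N' M' :
  inverse_blocks M N N' M' -> inverse_blocks M'^T N'^T N^T M^T.
Proof.
rewrite /inverse_blocks !mul_col_row !mul_row_col => -[h1 h2]; split.
  move: h1; rewrite !scalar_mx_block => /eq_block_mx[e1 e2 e3 e4].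
  by rewrite -!trmx_mul e1 e2 e3 e4 !trmx1 !trmx0.
by rewrite -!trmx_mul -linearD /= addrC h2 trmx1.
Qed.

(** Transposition exchanges [p] with [q] and the two kinds of matrices, which reduces this direction
    to [castling_radical]. *)
Lemma col_to_row_radical : (0 < q)%N -> (exists y, row_disc y != 0) ->
  pfradical col_disc -> pfradical row_disc.
Proof.
move=> q0 [[y1 y2] nz] rad.
have htr m n : polymap (fun z : ('M[K]_(m, n) * 'cV[K]_n0)%type => (z.1^T, z.2) : ('M[K]_(n, m) * 'cV[K]_n0)%type).
  by apply: polymap_lin => a [u1 u2] [v1 v2]; congr pair; rewrite /= linearP.
have htr2 m n m' n' : polymap (fun z : ('M[K]_(m, n) * 'M[K]_(m', n'))%type => (z.2^T, z.1^T) : ('M[K]_(n', m') * 'M[K]_(n, m))%type).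
  by apply: polymap_lin => a [u1 u2] [v1 v2]; congr pair; rewrite /= linearP.
have wE' : w = (q + p)%N by rewrite addnC.
have c := @castling_radical K q p w n0 (fun z => col_disc (z.1^T, z.2)) (fun z => row_disc (z.1^T, z.2))
  (fun z => col_to_row_unit (z.2^T, z.1^T)) (fun z => row_to_col_unit (z.2^T, z.1^T)) wE' q0.
have := @pfradical_iso K _ _ (fun z : ('M[K]_(p, w) * 'cV[K]_n0)%type => (z.1^T, z.2)) (fun z => (z.1^T, z.2))
   (fun z : ('M[K]_(w, p) * 'cV[K]_n0)%type => row_disc (z.1^T, z.2)).
move=> h; have {}h := h (htr _ _) (htr _ _).
have rw : pfradical (fun z : ('M[K]_(p, w) * 'cV[K]_n0)%type => row_disc (z.1^T^T, z.2)).
  apply: h => [[z1 z2]|[z1 z2]|]; rewrite /= ?trmxK //.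
  apply: c.
  - exact: pf_comp (htr _ _) pf_col_disc.
  - exact: pf_comp (htr _ _) pf_row_disc.
  - by exists (y1^T, y2); rewrite /= trmxK.
  - exact: pf_comp (htr2 _ _ _ _) pf_col_to_row_unit.
  - exact: pf_comp (htr2 _ _ _ _) pf_row_to_col_unit.
  - move=> M N N' M' r /inverse_blocks_tr ib; exact: (col_disc_row_disc r ib).
  - move=> M N N' M' r /inverse_blocks_tr ib; exact: (row_disc_col_disc r ib).
  apply: (@pfradical_iso K _ _ (fun z : ('M[K]_(q, w) * 'cV[K]_n0)%type => (z.1^T, z.2) : ('M[K]_(w, q) * 'cV[K]_n0)%type)
    (fun z => (z.1^T, z.2)) col_disc) => // [[z1 z2]|[z1 z2]]; by rewrite /= trmxK.
suff -> : row_disc = (fun z : ('M[K]_(p, w) * 'cV[K]_n0)%type => row_disc (z.1^T^T, z.2)) by [].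
by apply: boolp.funext => -[z1 z2]; rewrite /= trmxK.
Qed.

End CastlingDeterminant.

(** * Representations in coordinates and their reflections *)

Section Enumerations.
Variable K : numFieldType.

(** Coordinates are labelled by triples with natural entries, whose type does not depend on
    orientation or dimension vector; a reflection changes only which triples are valid. *)
Definition enumerates (T : eqType) n (e : 'I_n -> T) (P : T -> bool) : Prop :=
  injective e /\ forall x, P x <-> exists i, e i = x.

Definition extend (T : eqType) n (e : 'I_n -> T) (f : 'I_n -> K) (x : T) : K :=
  \sum_i f i * (e i == x)%:R.

Lemma extend_on (T : eqType) n (e : 'I_n -> T) f i :
  injective e -> extend e f (e i) = f i.
Proof.
move=> ie; rewrite /extend (bigD1 i) //= eqxx mulr1 big1 ?addr0 // => j nj.
by rewrite (inj_eq ie) (negbTE nj) mulr0.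
Qed.

Lemma extend_off (T : eqType) n (e : 'I_n -> T) f x :
  (forall i, e i != x) -> extend e f x = 0.
Proof. by move=> h; rewrite /extend big1 // => i _; rewrite (negbTE (h i)) mulr0. Qed.

Lemma extend_lin (T : eqType) n (e : 'I_n -> T) f g a x :
  extend e (fun i => a * f i + g i) x = a * extend e f x + extend e g x.
Proof.
rewrite /extend mulr_sumr -big_split; apply: eq_bigr => i _ /=.
by rewrite mulrDl mulrA.
Qed.

Lemma eq_extend (T : eqType) n (e : 'I_n -> T) f g x : f =1 g -> extend e f x = extend e g x.
Proof. by move=> fg; apply: eq_bigr => i _; rewrite fg. Qed.

Lemma enumerates_sigma (A : finType) (f g : A -> nat) :
  exists e : 'I_(\sum_a f a * g a) -> A * nat * nat,
    enumerates e (fun x => (x.1.2 < f x.1.1)%N && (x.2 < g x.1.1)%N).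
Proof.
pose T := {a : A & ('I_(f a) * 'I_(g a))%type}.
have cT : #|{: T}| = \sum_a f a * g a.
  rewrite card_tagged sumnE big_map big_enum; apply: eq_bigr => a _ /=.
  by rewrite card_prod !card_ord.
rewrite -cT; pose h (u : T) := (tag u, nat_of_ord (tagged u).1, nat_of_ord (tagged u).2).
exists (fun i => h (enum_val i)); split=> [i j|[[a u] v]] /=.
  move=> hij; apply: enum_val_inj; move: hij.
  case: (enum_val i) (enum_val j) => [a [u v]] [a' [u' v']] [e]; subst a' => /= eu ev.
  by congr Tagged; congr pair; apply: val_inj.
split=> [/andP[hu hv]|[l] ].
  exists (enum_rank (Tagged (fun a => ('I_(f a) * 'I_(g a))%type) (Ordinal hu, Ordinal hv))).
  by rewrite enum_rankK.
rewrite /h; case: (enum_val l) => [b [x y]] /= [e eu ev]; subst.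
by rewrite !ltn_ord.
Qed.

Lemma enumerates_size (T : eqType) n m (e : 'I_n -> T) (e' : 'I_m -> T) P :
  enumerates e P -> enumerates e' P -> n = m.
Proof.
have half a b (f : 'I_a -> T) (f' : 'I_b -> T) : enumerates f P -> enumerates f' P -> (a <= b)%N.
  move=> [fI cf] [fI' cf'].
  have ex i : exists j, f' j = f i by apply/cf'/cf; exists i.
  have [g hg] := boolp.choice ex.
  have ig : injective g by move=> i j gij; apply: fI; rewrite -!hg gij.
  by have := leq_card g ig; rewrite !card_ord.
by move=> h h'; apply/eqP; rewrite eqn_leq (half _ _ _ _ h h') (half _ _ _ _ h' h).
Qed.

Lemma enumerates_remove (T : eqType) n (e : 'I_n.+1 -> T) P x0 :
  enumerates e P -> P x0 ->
  exists e' : 'I_n -> T, enumerates e' (fun x => P x && (x != x0)).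
Proof.
move=> [ie ce] /ce[i0 e0]; exists (fun j => e (lift i0 j)); split=> [i j /ie /lift_inj //|x].
split=> [/andP[/ce[i ei] nx]|[j <-]].
  have : i0 != i by apply: contra nx => /eqP ii; rewrite -ei -ii e0.
  by move/unlift_some => [j ej _]; exists j; rewrite -ej.
apply/andP; split; first by apply/ce; exists (lift i0 j).
by rewrite -e0 (inj_eq ie) eq_sym neq_lift.
Qed.

End Enumerations.

Section NatReps.
Variables (K : numFieldType) (V A : finType).
Implicit Types (s t : A -> V) (d : V -> nat) (x : A -> nat -> nat -> K).
Implicit Types (B : V -> nat -> nat -> K).

(* Representations and their endomorphisms with entries indexed by natural
   numbers; only the entries within the dimension bounds matter. *)
Definition intertwines s t d x B : Prop := forall a u v,
  (u < d (t a))%N -> (v < d (s a))%N ->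
  \sum_(j < d (t a)) B (t a) u j * x a j v = \sum_(j < d (s a)) x a u j * B (s a) j v.

Definition brick s t d x : Prop := forall B, intertwines s t d x B ->
  exists c, forall i u v, (u < d i)%N -> (v < d i)%N -> B i u v = c * (u == v)%:R.

Lemma brick_ext s t d x y :
  (forall a u v, (u < d (t a))%N -> (v < d (s a))%N -> x a u v = y a u v) ->
  brick s t d x -> brick s t d y.
Proof.
move=> xy bx B hB; apply: bx => a u v hu hv.
transitivity (\sum_(j < d (t a)) B (t a) u j * y a j v).
  by apply: eq_bigr => j _; rewrite xy.
by rewrite hB //; apply: eq_bigr => j _; rewrite xy.
Qed.

Lemma intertwines_sub s t d x B c : intertwines s t d x B ->
  intertwines s t d x (fun i u v => B i u v - c * (u == v)%:R).
Proof.
move=> hB a u v hu hv.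
have dl n w (f : nat -> K) : (w < n)%N -> \sum_(j < n) c * (w == j :> nat)%:R * f j = c * f w.
  move=> hw; rewrite (bigD1 (Ordinal hw)) //= eqxx mulr1 big1 ?addr0 // => j nj.
  case: eqP => [e|]; last by rewrite mulr0 mul0r.
  by case/negP: nj; apply/eqP/val_inj.
under eq_bigr do rewrite mulrBl.
under [RHS]eq_bigr do rewrite mulrBr.
rewrite !sumrB hB //; congr (_ - _); rewrite (dl _ u (fun j => x a j v) hu).
rewrite -(dl _ v (fun j => x a u j) hv); apply: eq_bigr => j _.
by rewrite eq_sym mulrC.
Qed.

End NatReps.

(** * Representations split into the arrows at a vertex and the rest *)

Section VertexLink.
Variables (K : numFieldType) (V A : finType) (k i0 : V) (inv : pred A).
Variables (o s0 t0 : A -> V) (d0 : V -> nat).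
Hypothesis i0k : i0 != k.
Hypothesis d_i0 : (0 < d0 i0)%N.
Hypothesis o_k : forall a, inv a -> o a != k.
Hypothesis st_k : forall a, ~~ inv a -> s0 a != k /\ t0 a != k.

Variables (w n0 c0 : nat).
Variables (eW : 'I_w -> A * nat * nat) (eT : 'I_n0 -> A * nat * nat)
  (eC : 'I_c0 -> V * nat * nat).
Hypothesis eWP : enumerates eW (fun z => [&& inv z.1.1, (z.1.2 < d0 (o z.1.1))%N & z.2 == 0%N]).
Hypothesis eTP : enumerates eT
  (fun z => [&& ~~ inv z.1.1, (z.1.2 < d0 (t0 z.1.1))%N & (z.2 < d0 (s0 z.1.1))%N]).
Hypothesis eCP : enumerates eC
  (fun z => [&& z.1.1 != k, (z.1.2 < d0 z.1.1)%N, (z.2 < d0 z.1.1)%N & z != (i0, 0%N, 0%N)]).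

(** The entry [(i0, 0, 0)] missing from [eC] is read as 0; this picks a complement of the scalars,
    so [c] stands for the Lie algebra away from [k]. *)
Definition lie_of (c : 'rV[K]_c0) (i : V) (u v : nat) : K := extend eC (c 0) (i, u, v).

Definition rest_of (r : 'cV[K]_n0) (a : A) (u v : nat) : K :=
  extend eT (fun l => r l 0) (a, u, v).

(** The action on the direct sum of the neighbouring spaces, block diagonal along the arrows at [k].
    The same matrix serves both orientations, multiplying on the right at a sink and on the left at
    a source. *)
Definition big_act (c : 'rV[K]_c0) : 'M[K]_w := \matrix_(j, j')
  if (eW j).1.1 == (eW j').1.1
  then lie_of c (o (eW j).1.1) (eW j).1.2 (eW j').1.2 else 0.

Definition rest_act (c : 'rV[K]_c0) (r : 'cV[K]_n0) : 'cV[K]_n0 := \col_l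
  let: (a, u, v) := eT l in
  \sum_(j < d0 (t0 a)) lie_of c (t0 a) u j * rest_of r a j v -
  \sum_(j < d0 (s0 a)) rest_of r a u j * lie_of c (s0 a) j v.

Lemma lie_of_lin a c c' i u v :
  lie_of (a *: c + c') i u v = a * lie_of c i u v + lie_of c' i u v.
Proof. by rewrite /lie_of -extend_lin; apply: eq_extend => l; rewrite !mxE. Qed.

Lemma rest_of_lin a r r' i u v :
  rest_of (a *: r + r') i u v = a * rest_of r i u v + rest_of r' i u v.
Proof. by rewrite /rest_of -extend_lin; apply: eq_extend => l; rewrite !mxE. Qed.

Lemma big_act_lin a c c' : big_act (a *: c + c') = a *: big_act c + big_act c'.
Proof.
apply/matrixP => j j'; rewrite !mxE; case: eqP => _; first exact: lie_of_lin.
by rewrite mulr0 addr0.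
Qed.

Lemma rest_act_lin1 r a c c' :
  rest_act (a *: c + c') r = a *: rest_act c r + rest_act c' r.
Proof.
apply/colP => l; rewrite !mxE; case: (eT l) => [[b u] v].
under eq_bigr do rewrite lie_of_lin mulrDl -mulrA.
under [X in _ - X]eq_bigr do rewrite lie_of_lin mulrDr mulrCA.
by rewrite !big_split /= -!mulr_sumr; ring.
Qed.

Lemma rest_act_lin2 c a r r' :
  rest_act c (a *: r + r') = a *: rest_act c r + rest_act c r'.
Proof.
apply/colP => l; rewrite !mxE; case: (eT l) => [[b u] v].
under eq_bigr do rewrite rest_of_lin mulrDr mulrCA.
under [X in _ - X]eq_bigr do rewrite rest_of_lin mulrDl -mulrA.
by rewrite !big_split /= -!mulr_sumr; ring.
Qed.

Lemma sum_big_index a (g : nat -> K) : inv a ->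
  \sum_(j < w) (if (eW j).1.1 == a then g (eW j).1.2 else 0) = \sum_(l < d0 (o a)) g l.
Proof.
move=> ia; have [ie ce] := eWP.
transitivity (\sum_(l < d0 (o a)) \sum_(j < w) g l * (eW j == (a, l : nat, 0%N))%:R).
  rewrite exchange_big; apply: eq_bigr => j _ /=.
  have /= /ce/= := ex_intro (fun i => eW i = eW j) j erefl.
  case: (eW j) => [[b u] z] /= /and3P[ib hu /eqP ->].
  case: eqP => [e|ne]; last first.
    rewrite big1 // => l _; case: eqP => [[e _]|]; rewrite ?mulr0 //.
  subst b; rewrite (bigD1 (Ordinal hu)) //= eqxx mulr1 big1 ?addr0 // => l nl.
  case: eqP => [[e]|]; rewrite ?mulr0 //.
  by case/negP: nl; apply/eqP/val_inj.
apply: eq_bigr => l _; have /ce[j ej] : [&& inv (a, l : nat, 0%N).1.1,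
  ((a, l : nat, 0%N).1.2 < d0 (o (a, l : nat, 0%N).1.1))%N & (a, l : nat, 0%N).2 == 0%N].
  by rewrite /= ia ltn_ord.
rewrite (bigD1 j) //= ej eqxx mulr1 big1 ?addr0 // => j' nj.
by rewrite -ej (inj_eq ie) (negbTE nj) mulr0.
Qed.

Lemma eW_valid j : [/\ inv (eW j).1.1, ((eW j).1.2 < d0 (o (eW j).1.1))%N & (eW j).2 = 0%N].
Proof.
have [_ ce] := eWP; have /ce := ex_intro (fun i => eW i = eW j) j erefl.
by case/and3P => h1 h2 /eqP h3.
Qed.

Lemma eT_valid l : [/\ ~~ inv (eT l).1.1, ((eT l).1.2 < d0 (t0 (eT l).1.1))%N &
  ((eT l).2 < d0 (s0 (eT l).1.1))%N].
Proof.
have [_ ce] := eTP; have /ce := ex_intro (fun i => eT i = eT l) l erefl.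
by case/and3P.
Qed.

Lemma eW_ex a v : inv a -> (v < d0 (o a))%N -> exists j, eW j = (a, v, 0%N).
Proof. by move=> ia hv; have [_ ce] := eWP; apply/ce; rewrite /= ia hv. Qed.

Lemma eT_ex a u v : ~~ inv a -> (u < d0 (t0 a))%N -> (v < d0 (s0 a))%N ->
  exists l, eT l = (a, u, v).
Proof. by move=> ia hu hv; have [_ ce] := eTP; apply/ce; rewrite /= ia hu. Qed.

Lemma lie_of_base c : lie_of c i0 0%N 0%N = 0.
Proof.
apply: extend_off => l; apply/negP => /eqP e; have [_ ce] := eCP.
have /ce := ex_intro (fun i => eC i = (i0, 0%N, 0%N)) l e.
by rewrite eqxx !andbF.
Qed.

Lemma lie_of_restrict (B : V -> nat -> nat -> K) i u v : B i0 0%N 0%N = 0 ->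
  i != k -> (u < d0 i)%N -> (v < d0 i)%N ->
  lie_of (\row_l B (eC l).1.1 (eC l).1.2 (eC l).2) i u v = B i u v.
Proof.
move=> B0 ik hu hv; have [ie ce] := eCP.
have [e|ne] := eqVneq (i, u, v) (i0, 0%N, 0%N); first by case: e => -> -> ->; rewrite lie_of_base.
have /ce[l el] : [&& (i, u, v).1.1 != k, ((i, u, v).1.2 < d0 (i, u, v).1.1)%N,
  ((i, u, v).2 < d0 (i, u, v).1.1)%N & (i, u, v) != (i0, 0%N, 0%N)].
  by rewrite /= ik hu hv ne.
by rewrite /lie_of -el extend_on // mxE el.
Qed.

Lemma lie_of_eq0 c : (forall i u v, i != k -> (u < d0 i)%N -> (v < d0 i)%N ->
  lie_of c i u v = 0) -> c = 0.
Proof.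
move=> h; apply/rowP => l; rewrite mxE; have [ie ce] := eCP.
have /ce/and4P[h1 h2 h3 _] := ex_intro (fun i => eC i = eC l) l erefl.
by rewrite -(extend_on (c 0) l ie); case: (eC l) h1 h2 h3 => [[i u] v] /=; exact: h.
Qed.

Variables (p : nat) (s t : A -> V) (d : V -> nat).
Hypothesis dk : d k = p.
Hypothesis d_off : forall i, i != k -> d i = d0 i.
Hypothesis st_off : forall a, ~~ inv a -> s a = s0 a /\ t a = t0 a.

Lemma rest_intertwines c r (B : V -> nat -> nat -> K) x a u v : ~~ inv a ->
  (forall i u v, i != k -> (u < d0 i)%N -> (v < d0 i)%N -> lie_of c i u v = B i u v) ->
  (forall b u v, ~~ inv b -> (u < d0 (t0 b))%N -> (v < d0 (s0 b))%N ->
     x b u v = rest_of r b u v) ->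
  (u < d (t a))%N -> (v < d (s a))%N ->
  exists l, eT l = (a, u, v) /\ rest_act c r l 0 =
    \sum_(j < d (t a)) B (t a) u j * x a j v - \sum_(j < d (s a)) x a u j * B (s a) j v.
Proof.
move=> ia hB hx; have [-> ->] := st_off ia; have [sk tk] := st_k ia.
rewrite !d_off // => hu hv; have [l el] := eT_ex ia hu hv; exists l; split=> //.
rewrite mxE el; congr (_ - _); apply: eq_bigr => j _.
  by rewrite hB // hx.
by rewrite hB // hx.
Qed.

Lemma rest_act_eq0 c r (B : V -> nat -> nat -> K) x :
  (forall i u v, i != k -> (u < d0 i)%N -> (v < d0 i)%N -> lie_of c i u v = B i u v) ->
  (forall b u v, ~~ inv b -> (u < d0 (t0 b))%N -> (v < d0 (s0 b))%N ->
     x b u v = rest_of r b u v) ->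
  intertwines s t d x B -> rest_act c r = 0.
Proof.
move=> hB hx iB; apply/colP => l; have [h1 h2 h3] := eT_valid l.
have [es et] := st_off h1; have [sk tk] := st_k h1.
have hu : ((eT l).1.2 < d (t (eT l).1.1))%N by rewrite et d_off.
have hv : ((eT l).2 < d (s (eT l).1.1))%N by rewrite es d_off.
have [l' [el]] := rest_intertwines h1 hB hx hu hv.
have -> : l' = l by case: eTP => ie _; apply: ie; rewrite el; case: (eT l) => [[]].
by move=> ->; rewrite iB // subrr mxE.
Qed.

Lemma rest_act_intertwines c r (B : V -> nat -> nat -> K) x a u v : ~~ inv a ->
  (forall i u v, i != k -> (u < d0 i)%N -> (v < d0 i)%N -> lie_of c i u v = B i u v) ->
  (forall b u v, ~~ inv b -> (u < d0 (t0 b))%N -> (v < d0 (s0 b))%N ->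
     x b u v = rest_of r b u v) ->
  (u < d (t a))%N -> (v < d (s a))%N -> rest_act c r = 0 ->
  \sum_(j < d (t a)) B (t a) u j * x a j v = \sum_(j < d (s a)) x a u j * B (s a) j v.
Proof.
move=> ia hB hx hu hv z; have [l [_ e]] := rest_intertwines ia hB hx hu hv.
by apply/eqP; rewrite -subr_eq0 -e z mxE.
Qed.

Definition sink_rep (z : ('M[K]_(p, w) * 'cV[K]_n0)%type) (a : A) (u v : nat) : K :=
  if inv a then extend eW (fun j => extend (@nat_of_ord p) (z.1^~ j) u) (a, v, 0%N)
  else rest_of z.2 a u v.

Definition source_rep (z : ('M[K]_(w, p) * 'cV[K]_n0)%type) (a : A) (u v : nat) : K :=
  if inv a then extend eW (fun i => extend (@nat_of_ord p) (z.1 i) v) (a, u, 0%N)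
  else rest_of z.2 a u v.

Lemma sink_repE z (i : 'I_p) j : sink_rep z (eW j).1.1 i (eW j).1.2 = z.1 i j.
Proof.
have [h1 h2 h3] := eW_valid j; rewrite /sink_rep h1.
have -> : ((eW j).1.1, (eW j).1.2, 0%N) = eW j by case: (eW j) h3 => [[a b] e] /= ->.
by rewrite extend_on ?(extend_on _ _ (@ord_inj p)) //; case: eWP.
Qed.

Lemma source_repE z j (i : 'I_p) : source_rep z (eW j).1.1 (eW j).1.2 i = z.1 j i.
Proof.
have [h1 h2 h3] := eW_valid j; rewrite /source_rep h1.
have -> : ((eW j).1.1, (eW j).1.2, 0%N) = eW j by case: (eW j) h3 => [[a b] e] /= ->.
by rewrite extend_on ?(extend_on _ _ (@ord_inj p)) //; case: eWP.
Qed.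

Lemma rest_rep_sink z b u v : ~~ inv b -> sink_rep z b u v = rest_of z.2 b u v.
Proof. by rewrite /sink_rep => /negbTE ->. Qed.

Lemma rest_rep_source z b u v : ~~ inv b -> source_rep z b u v = rest_of z.2 b u v.
Proof. by rewrite /source_rep => /negbTE ->. Qed.

Lemma mul_big_act (z : 'M[K]_(p, w)) c (B : V -> nat -> nat -> K) r (i : 'I_p) j :
  (forall i u v, i != k -> (u < d0 i)%N -> (v < d0 i)%N -> lie_of c i u v = B i u v) ->
  (z *m big_act c) i j = \sum_(l < d0 (o (eW j).1.1))
    sink_rep (z, r) (eW j).1.1 i l * B (o (eW j).1.1) l (eW j).1.2.
Proof.
move=> hB; have [h1 h2 _] := eW_valid j.
rewrite -(sum_big_index (fun l => sink_rep (z, r) (eW j).1.1 i l * B (o (eW j).1.1) l (eW j).1.2) h1).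
rewrite mxE; apply: eq_bigr => l _; rewrite mxE.
have [g1 g2 _] := eW_valid l; case: eqP => e; last by rewrite mulr0.
by rewrite -(sink_repE (z, r)) hB -?e // ?e ?o_k // -e.
Qed.

Lemma big_act_mul (z : 'M[K]_(w, p)) c (B : V -> nat -> nat -> K) r (i : 'I_p) j :
  (forall i u v, i != k -> (u < d0 i)%N -> (v < d0 i)%N -> lie_of c i u v = B i u v) ->
  (big_act c *m z) j i = \sum_(l < d0 (o (eW j).1.1))
    B (o (eW j).1.1) (eW j).1.2 l * source_rep (z, r) (eW j).1.1 l i.
Proof.
move=> hB; have [h1 h2 _] := eW_valid j.
rewrite -(sum_big_index (fun l => B (o (eW j).1.1) (eW j).1.2 l * source_rep (z, r) (eW j).1.1 l i) h1).
rewrite mxE; apply: eq_bigr => l _; rewrite mxE eq_sym.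
have [g1 g2 _] := eW_valid l; case: eqP => e; last by rewrite mul0r.
by rewrite -(source_repE (z, r)) hB -?e // ?e ?o_k // -e.
Qed.

Definition mx_entries m n (X : 'M[K]_(m, n)) (u v : nat) : K :=
  extend (@nat_of_ord m) (fun i => extend (@nat_of_ord n) (X i) v) u.

Lemma mx_entriesE m n (X : 'M[K]_(m, n)) (i : 'I_m) (j : 'I_n) : mx_entries X i j = X i j.
Proof. by rewrite /mx_entries (extend_on _ _ (@ord_inj m)) (extend_on _ _ (@ord_inj n)). Qed.

Lemma lie_of0 i u v : lie_of 0 i u v = 0.
Proof. by rewrite /lie_of /extend big1 // => l _; rewrite mxE mul0r. Qed.

(** The kernel of the tangent map is the endomorphism algebra modulo scalars. *)
Lemma sink_kernel z : (forall a, inv a -> s a = o a /\ t a = k) ->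
  (forall (X : 'M_p) c, X *m z.1 + z.1 *m big_act c = 0 -> rest_act c z.2 = 0 ->
     X = 0 /\ c = 0) <-> brick s t d (sink_rep z).
Proof.
case: z => M r /= hst; split=> [ker B iB|br X c hX hr].
  (* Subtracting a scalar brings the endomorphism into the complement described by [lie_of]. *)
  pose B1 i u v := B i u v - B i0 0%N 0%N * (u == v)%:R.
  have iB1 : intertwines s t d (sink_rep (M, r)) B1 by exact: intertwines_sub.
  pose c : 'rV_c0 := \row_l B1 (eC l).1.1 (eC l).1.2 (eC l).2.
  have hB i u v : i != k -> (u < d0 i)%N -> (v < d0 i)%N -> lie_of c i u v = B1 i u v.
    by apply: lie_of_restrict; rewrite /B1 eqxx mulr1 subrr.
  (* The sign turns the sum in the tangent map into the equality that defines an intertwiner. *)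
  have [||X0 c00] := ker (\matrix_(i, j) - B1 k i j) c.
  - apply/matrixP => i j; rewrite mxE (mul_big_act _ r _ _ hB) mxE [RHS]mxE.
    have [h1 h2 _] := eW_valid j; have [es et] := hst _ h1.
    have := iB1 (eW j).1.1 i (eW j).1.2; rewrite es et dk d_off ?o_k // => <- //.
    rewrite -big_split big1 // => l _ /=.
    by rewrite mxE -(sink_repE (M, r)) mulNr addNr.
  - by apply: rest_act_eq0 hB _ iB1 => b u v nb _ _; exact: (rest_rep_sink (M, r)).
  exists (B i0 0%N 0%N) => i u v hu hv; apply/eqP; rewrite -subr_eq0 -/(B1 i u v).
  have [e|ik] := eqVneq i k.
    subst i; rewrite dk in hu hv; move/matrixP: X0 => /(_ (Ordinal hu) (Ordinal hv)).
    by rewrite !mxE /= => /eqP; rewrite oppr_eq0.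
  by rewrite d_off // in hu hv; rewrite -hB // c00 lie_of0.
pose B i u v := if i == k then - mx_entries X u v else lie_of c i u v.
have hB i u v : i != k -> (u < d0 i)%N -> (v < d0 i)%N -> lie_of c i u v = B i u v.
  by move=> ik _ _; rewrite /B (negbTE ik).
have [a u v|cc hcc] := br B.
  have [ia|ia] := boolP (inv a); last first.
    move=> hu hv; apply: (rest_act_intertwines ia hB _ hu hv hr) => b u' v' nb _ _.
    exact: (rest_rep_sink (M, r)).
  have [es et] := hst a ia; rewrite es et dk d_off ?o_k // => hu hv.
  have [j ej] := eW_ex ia hv.
  have := congr1 (fun Y : 'M_(p, w) => Y (Ordinal hu) j) hX; rewrite mxE [RHS]mxE.
  rewrite (mul_big_act _ r _ _ hB) ej /= => /eqP; rewrite addrC addr_eq0 => /eqP ->.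
  rewrite mxE -sumrN; apply: eq_bigr => l _; rewrite /B eqxx.
  rewrite -[u]/(nat_of_ord (Ordinal hu)) mx_entriesE mulNr -(sink_repE (M, r)) ej //.
have cc0 : cc = 0.
  have := hcc i0 0%N 0%N; rewrite d_off // => /(_ d_i0 d_i0)/esym.
  by rewrite /B (negbTE i0k) lie_of_base eqxx mulr1.
split.
  apply/matrixP => i j; rewrite mxE -mx_entriesE; apply/eqP; rewrite -oppr_eq0.
  by have := hcc k i j; rewrite dk cc0 mul0r /B eqxx => ->.
apply: lie_of_eq0 => i u v ik hu hv; rewrite hB // hcc ?d_off // cc0 mul0r //.
Qed.

Lemma source_kernel z : (forall a, inv a -> s a = k /\ t a = o a) ->
  (forall (X : 'M_p) c, z.1 *m X + big_act c *m z.1 = 0 -> rest_act c z.2 = 0 ->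
     X = 0 /\ c = 0) <-> brick s t d (source_rep z).
Proof.
case: z => M r /= hst; split=> [ker B iB|br X c hX hr].
  pose B1 i u v := B i u v - B i0 0%N 0%N * (u == v)%:R.
  have iB1 : intertwines s t d (source_rep (M, r)) B1 by exact: intertwines_sub.
  pose c : 'rV_c0 := \row_l B1 (eC l).1.1 (eC l).1.2 (eC l).2.
  have hB i u v : i != k -> (u < d0 i)%N -> (v < d0 i)%N -> lie_of c i u v = B1 i u v.
    by apply: lie_of_restrict; rewrite /B1 eqxx mulr1 subrr.
  have [||X0 c00] := ker (\matrix_(i, j) - B1 k i j) c.
  - apply/matrixP => j i; rewrite mxE (big_act_mul _ r _ _ hB) mxE [RHS]mxE.
    have [h1 h2 _] := eW_valid j; have [es et] := hst _ h1.
    have := iB1 (eW j).1.1 (eW j).1.2 i; rewrite es et dk d_off ?o_k // => -> //.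
    rewrite -big_split big1 // => l _ /=.
    by rewrite mxE -(source_repE (M, r)) mulrN addNr.
  - by apply: rest_act_eq0 hB _ iB1 => b u v nb _ _; exact: (rest_rep_source (M, r)).
  exists (B i0 0%N 0%N) => i u v hu hv; apply/eqP; rewrite -subr_eq0 -/(B1 i u v).
  have [e|ik] := eqVneq i k.
    subst i; rewrite dk in hu hv; move/matrixP: X0 => /(_ (Ordinal hu) (Ordinal hv)).
    by rewrite !mxE /= => /eqP; rewrite oppr_eq0.
  by rewrite d_off // in hu hv; rewrite -hB // c00 lie_of0.
pose B i u v := if i == k then - mx_entries X u v else lie_of c i u v.
have hB i u v : i != k -> (u < d0 i)%N -> (v < d0 i)%N -> lie_of c i u v = B i u v.
  by move=> ik _ _; rewrite /B (negbTE ik).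
have [a u v|cc hcc] := br B.
  have [ia|ia] := boolP (inv a); last first.
    move=> hu hv; apply: (rest_act_intertwines ia hB _ hu hv hr) => b u' v' nb _ _.
    exact: (rest_rep_source (M, r)).
  have [es et] := hst a ia; rewrite es et dk d_off ?o_k // => hu hv.
  have [j ej] := eW_ex ia hu.
  have := congr1 (fun Y : 'M_(w, p) => Y j (Ordinal hv)) hX; rewrite mxE [RHS]mxE.
  rewrite (big_act_mul _ r _ _ hB) ej /= => /eqP; rewrite addrC addr_eq0 => /eqP ->.
  rewrite mxE -sumrN; apply: eq_bigr => l _; rewrite /B eqxx.
  rewrite -[v]/(nat_of_ord (Ordinal hv)) mx_entriesE mulrN -(source_repE (M, r)) ej //.
have cc0 : cc = 0.
  have := hcc i0 0%N 0%N; rewrite d_off // => /(_ d_i0 d_i0)/esym.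
  by rewrite /B (negbTE i0k) lie_of_base eqxx mulr1.
split.
  apply/matrixP => i j; rewrite mxE -mx_entriesE; apply/eqP; rewrite -oppr_eq0.
  by have := hcc k i j; rewrite dk cc0 mul0r /B eqxx => ->.
apply: lie_of_eq0 => i u v ik hu hv; rewrite hB // hcc ?d_off // cc0 mul0r //.
Qed.

Variables (n : nat) (eR : 'I_n -> A * nat * nat).
Hypothesis eRP : enumerates eR
  (fun z => (z.1.2 < d (t z.1.1))%N && (z.2 < d (s z.1.1))%N).

Lemma eR_ex a u v : (u < d (t a))%N -> (v < d (s a))%N -> exists l, eR l = (a, u, v).
Proof. by move=> hu hv; have [_ ce] := eRP; apply/ce; rewrite /= hu. Qed.

Lemma eR_valid l : ((eR l).1.2 < d (t (eR l).1.1))%N /\ ((eR l).2 < d (s (eR l).1.1))%N.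
Proof.
have [_ ce] := eRP; have /ce := ex_intro (fun i => eR i = eR l) l erefl.
by case/andP.
Qed.

Definition nat_rep (y : 'cV[K]_n) (a : A) (u v : nat) : K := extend eR (y^~ 0) (a, u, v).

Definition vec_rep (x : A -> nat -> nat -> K) : 'cV[K]_n :=
  \col_l x (eR l).1.1 (eR l).1.2 (eR l).2.

Lemma vec_repK x a u v : (u < d (t a))%N -> (v < d (s a))%N ->
  nat_rep (vec_rep x) a u v = x a u v.
Proof.
move=> hu hv; have [l el] := eR_ex hu hv; have [ie _] := eRP.
by rewrite /nat_rep -el extend_on // mxE el.
Qed.

Lemma nat_repE y l : nat_rep y (eR l).1.1 (eR l).1.2 (eR l).2 = y l 0.
Proof.
have [ie _] := eRP; rewrite /nat_rep.
have -> : ((eR l).1.1, (eR l).1.2, (eR l).2) = eR l by case: (eR l) => [[]].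
by rewrite extend_on.
Qed.

Lemma nat_rep_lin c y y' a u v :
  nat_rep (c *: y + y') a u v = c * nat_rep y a u v + nat_rep y' a u v.
Proof. by rewrite /nat_rep -extend_lin; apply: eq_extend => l; rewrite !mxE. Qed.

Definition unrest (y : 'cV[K]_n) : 'cV[K]_n0 :=
  \col_l nat_rep y (eT l).1.1 (eT l).1.2 (eT l).2.

Definition sink_coords (y : 'cV[K]_n) : ('M[K]_(p, w) * 'cV[K]_n0)%type :=
  (\matrix_(i, j) nat_rep y (eW j).1.1 i (eW j).1.2, unrest y).

Definition source_coords (y : 'cV[K]_n) : ('M[K]_(w, p) * 'cV[K]_n0)%type :=
  (\matrix_(j, i) nat_rep y (eW j).1.1 (eW j).1.2 i, unrest y).

Lemma rest_ofE r l : rest_of r (eT l).1.1 (eT l).1.2 (eT l).2 = r l 0.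
Proof.
have [ie _] := eTP; rewrite /rest_of.
have -> : ((eT l).1.1, (eT l).1.2, (eT l).2) = eT l by case: (eT l) => [[]].
by rewrite extend_on.
Qed.

Lemma eT_bounds l : ((eT l).1.2 < d (t (eT l).1.1))%N /\ ((eT l).2 < d (s (eT l).1.1))%N.
Proof.
have [h1 h2 h3] := eT_valid l; have [-> ->] := st_off h1; have [sk tk] := st_k h1.
by rewrite !d_off.
Qed.

Lemma rest_of_unrest y l : ~~ inv (eR l).1.1 ->
  rest_of (unrest y) (eR l).1.1 (eR l).1.2 (eR l).2 = y l 0.
Proof.
move=> ia; have [h1 h2] := eR_valid l; have [es et] := st_off ia; have [sk tk] := st_k ia.
rewrite et d_off // in h1; rewrite es d_off // in h2.
have [m em] := eT_ex ia h1 h2.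
have -> : (eR l).1.1 = (eT m).1.1 by rewrite em.
have -> : (eR l).1.2 = (eT m).1.2 by rewrite em.
have -> : (eR l).2 = (eT m).2 by rewrite em.
by rewrite rest_ofE mxE em /= nat_repE.
Qed.

Lemma sink_coordsK : (forall a, inv a -> s a = o a /\ t a = k) ->
  cancel sink_coords (fun z => vec_rep (sink_rep z)) /\
  cancel (fun z => vec_rep (sink_rep z)) sink_coords.
Proof.
move=> hst; split=> [y|[M r]].
  apply/colP => l; rewrite mxE; have [ia|ia] := boolP (inv (eR l).1.1); last first.
    by rewrite rest_rep_sink // rest_of_unrest.
  have [es et] := hst _ ia; have [h1 h2] := eR_valid l.
  rewrite et dk in h1; rewrite es d_off ?o_k // in h2.
  have [j ej] := eW_ex ia h2.
  have := sink_repE (sink_coords y) (Ordinal h1) j; rewrite ej /= => ->.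
  by rewrite mxE ej /= nat_repE.
congr pair; last first.
  apply/colP => l; rewrite mxE; have [h1 h2] := eT_bounds l.
  by rewrite vec_repK // rest_rep_sink ?rest_ofE //; case: (eT_valid l).
apply/matrixP => i j; rewrite mxE; have [h1 h2 _] := eW_valid j.
have [es et] := hst _ h1; rewrite vec_repK ?sink_repE // ?et ?dk // es d_off ?o_k //.
Qed.

Lemma source_coordsK : (forall a, inv a -> s a = k /\ t a = o a) ->
  cancel source_coords (fun z => vec_rep (source_rep z)) /\
  cancel (fun z => vec_rep (source_rep z)) source_coords.
Proof.
move=> hst; split=> [y|[M r]].
  apply/colP => l; rewrite mxE; have [ia|ia] := boolP (inv (eR l).1.1); last first.
    by rewrite rest_rep_source // rest_of_unrest.
  have [es et] := hst _ ia; have [h1 h2] := eR_valid l.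
  rewrite es dk in h2; rewrite et d_off ?o_k // in h1.
  have [j ej] := eW_ex ia h1.
  have := source_repE (source_coords y) j (Ordinal h2); rewrite ej /= => ->.
  by rewrite mxE ej /= nat_repE.
congr pair; last first.
  apply/colP => l; rewrite mxE; have [h1 h2] := eT_bounds l.
  by rewrite vec_repK // rest_rep_source ?rest_ofE //; case: (eT_valid l).
apply/matrixP => j i; rewrite mxE; have [h1 h2 _] := eW_valid j.
have [es et] := hst _ h1; rewrite vec_repK ?source_repE // ?es ?dk // et d_off ?o_k //.
Qed.

Lemma sink_rep_lin a z z' b u v :
  sink_rep (a *: z + z') b u v = a * sink_rep z b u v + sink_rep z' b u v.
Proof.
rewrite /sink_rep; case: ifP => _; last exact: rest_of_lin.
rewrite -extend_lin; apply: eq_extend => j; rewrite -extend_lin; apply: eq_extend => i.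
by rewrite !mxE.
Qed.

Lemma source_rep_lin a z z' b u v :
  source_rep (a *: z + z') b u v = a * source_rep z b u v + source_rep z' b u v.
Proof.
rewrite /source_rep; case: ifP => _; last exact: rest_of_lin.
rewrite -extend_lin; apply: eq_extend => j; rewrite -extend_lin; apply: eq_extend => i.
by rewrite !mxE.
Qed.

Lemma polymap_sink_coords : polymap sink_coords.
Proof.
apply: polymap_lin => a u v; congr pair; apply/matrixP => i j;
  by rewrite !mxE nat_rep_lin.
Qed.

Lemma polymap_source_coords : polymap source_coords.
Proof.
apply: polymap_lin => a u v; congr pair; apply/matrixP => i j;
  by rewrite !mxE nat_rep_lin.
Qed.

Lemma polymap_sink_vec : polymap (fun z => vec_rep (sink_rep z)).
Proof. by apply: polymap_lin => a u v; apply/colP => l; rewrite !mxE sink_rep_lin. Qed.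

Lemma polymap_source_vec : polymap (fun z => vec_rep (source_rep z)).
Proof. by apply: polymap_lin => a u v; apply/colP => l; rewrite !mxE source_rep_lin. Qed.

End VertexLink.

(** * Uniqueness of the homogeneous reduced equation *)

Section Discriminants.
Variable K : numClosedFieldType.
Hypothesis uncK : uncountable_type K.

Definition disc_fun (X : lmodType K) m (P : X -> Prop) : Prop :=
  exists F : X -> K, [/\ pf F, pfradical F, forall t x, F (t *: x) = t ^+ m * F x &
    forall x, F x != 0 <-> P x].

Lemma disc_fun_iso (X Y : lmodType K) m (P : X -> Prop) (Q : Y -> Prop)
    (h : X -> Y) (g : Y -> X) :
  polymap h -> polymap g -> (forall t x, h (t *: x) = t *: h x) ->
  cancel g h -> cancel h g -> (forall x, P x <-> Q (h x)) ->
  disc_fun m Q -> disc_fun m P.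
Proof.
move=> hh hg hZ gh hgK PQ [F [pF rF hF FQ]].
exists (fun x => F (h x)); split.
- exact: pf_comp.
- exact: (pfradical_iso hh hg gh hgK rF).
- by move=> t x; rewrite hZ hF.
- by move=> x; rewrite PQ -FQ.
Qed.

Lemma pfradical_ext (X : lmodType K) (f g : X -> K) : f =1 g -> pfradical f -> pfradical g.
Proof.
move=> fg rf h m ph [q pq eq]; have [|r pr er] := rf h m ph.
  by exists q => // x; rewrite eq fg.
by exists r => // x; rewrite er fg.
Qed.

Lemma pf_nullstellensatz n (f g : 'cV[K]_n -> K) : pf f -> pf g ->
  (forall x, f x = 0 -> g x = 0) -> exists m, pfdvd f (fun x => g x ^+ m).
Proof.
move=> /pf_mpoly[p ep] /pf_mpoly[q eq] h.
have [|m [r er]] := @nullstellensatz K uncK n p q; first by move=> x; rewrite -ep -eq => /h.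
exists m, (peval r); first exact: pf_peval.
by move=> x; rewrite eq ep /peval -rmorphXn /= er mevalM.
Qed.

(** The quotient is constant on punctured rays through points where [F] does not vanish, hence takes
    its value at 0 there, and then everywhere by density. *)
Lemma pf_homog_const (X : lmodType K) m (F G q : X -> K) x0 :
  pf F -> pf q -> (forall t x, F (t *: x) = t ^+ m * F x) ->
  (forall t x, G (t *: x) = t ^+ m * G x) -> (forall x, G x = q x * F x) ->
  F x0 != 0 -> forall x, q x = q 0.
Proof.
move=> pF pq hF hG e F0.
apply: (@pf_cancel _ _ F) => //; first exact: pf_const.
  by exists x0.
move=> x Fx; have pqx : pf (fun t : K^o => q (t *: x)).
  apply: (@pf_comp _ _ _ (fun t : K^o => t *: x)) => //.
  by apply: polymap_lin => a u v; rewrite scalerDl scalerA.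
have := @pf_cancel _ _ (fun t : K^o => t) (fun t => q (t *: x)) (fun=> q x) _ pqx.
move=> h; have := h _ _ _ _ 0; rewrite scale0r => -> //.
- exact: pf_linform.
- exact: pf_const.
- by exists 1; rewrite oner_neq0.
move=> t t0; have := hG t x; rewrite !e hF mulrCA => /mulfI; rewrite expf_eq0 (negbTE t0).
by rewrite andbF => /(_ isT) /mulIf; apply.
Qed.

(** By the Nullstellensatz and radicality [F] divides [G], and equal degrees make the quotient a
    nonzero constant. So an explicit equation inherits reducedness from an abstract one. *)
Lemma disc_fun_unique n m (P : 'cV[K]_n -> Prop) (G : 'cV[K]_n -> K) :
  disc_fun m P -> pf G -> (forall t x, G (t *: x) = t ^+ m * G x) ->
  (forall x, G x != 0 <-> P x) -> (exists x, P x) -> pfradical G.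
Proof.
move=> [F [pF rF hF FP]] pG hG GP [x0 Px0].
have [|e /(rF _ _ pG)[q pq eq]] := @pf_nullstellensatz n F G pF pG.
  move=> x Fx; apply/eqP/negP => /negP /GP /FP; by rewrite Fx eqxx.
have F0 : F x0 != 0 by apply/FP.
have qc := pf_homog_const pF pq hF hG eq F0.
have q0 : q 0 != 0 by move/GP: Px0; rewrite eq (qc x0) mulf_eq0 negb_or => /andP[].
move=> g a pg [r pr er]; have [|u pu eu] := rF g a pg.
  exists (fun x => r x * q x); first exact: pf_mul.
  by move=> x; rewrite er eq mulrA.
exists (fun x => u x * (q 0)^-1) => [|x]; first by apply: pf_mul => //; exact: pf_const.
by rewrite eu eq (qc x); field.
Qed.

End Discriminants.

(** * Transfer of the discriminant between a sink and the reflected source *)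

Section CastlingLink.
Variable K : numClosedFieldType.
Hypothesis uncK : uncountable_type K.
Variables (V A : finType) (k i0 : V) (inv : pred A).
Variables (o s0 t0 : A -> V) (d0 : V -> nat).
Hypothesis i0k : i0 != k.
Hypothesis d_i0 : (0 < d0 i0)%N.
Hypothesis o_k : forall a, inv a -> o a != k.
Hypothesis st_k : forall a, ~~ inv a -> s0 a != k /\ t0 a != k.
Variables (p q n0 : nat).
Let w := (p + q)%N.
Let c0 := (p * q + n0)%N.
Variables (eW : 'I_w -> A * nat * nat) (eT : 'I_n0 -> A * nat * nat)
  (eC : 'I_c0 -> V * nat * nat).
Hypothesis eWP : enumerates eW (fun z => [&& inv z.1.1, (z.1.2 < d0 (o z.1.1))%N & z.2 == 0%N]).
Hypothesis eTP : enumerates eT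
  (fun z => [&& ~~ inv z.1.1, (z.1.2 < d0 (t0 z.1.1))%N & (z.2 < d0 (s0 z.1.1))%N]).
Hypothesis eCP : enumerates eC
  (fun z => [&& z.1.1 != k, (z.1.2 < d0 z.1.1)%N, (z.2 < d0 z.1.1)%N & z != (i0, 0%N, 0%N)]).
Variables (s t s' t' : A -> V) (d d' : V -> nat).
Hypothesis dk : d k = p.
Hypothesis dk' : d' k = q.
Hypothesis d_off : forall i, i != k -> d i = d0 i.
Hypothesis d_off' : forall i, i != k -> d' i = d0 i.
Hypothesis st_off : forall a, ~~ inv a -> s a = s0 a /\ t a = t0 a.
Hypothesis st_off' : forall a, ~~ inv a -> s' a = s0 a /\ t' a = t0 a.
Hypothesis sink : forall a, inv a -> s a = o a /\ t a = k.
Hypothesis source : forall a, inv a -> s' a = k /\ t' a = o a.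
Variables (n n' : nat) (eR : 'I_n -> A * nat * nat) (eR' : 'I_n' -> A * nat * nat).
Hypothesis eRP : enumerates eR
  (fun z => (z.1.2 < d (t z.1.1))%N && (z.2 < d (s z.1.1))%N).
Hypothesis eRP' : enumerates eR'
  (fun z => (z.1.2 < d' (t' z.1.1))%N && (z.2 < d' (s' z.1.1))%N).
Hypothesis nE : n = (p * p + (p * q + n0))%N.
Hypothesis nE' : n' = (q * q + (p * q + n0))%N.

Let b := big_act (K := K) o eW eC.
Let rho := rest_act (K := K) s0 t0 d0 eT eC.
Let M0 := usubmx (1%:M : 'M[K]_(p + q)).
Let N0 := dsubmx (1%:M : 'M[K]_(p + q)).
Let N0' := lsubmx (1%:M : 'M[K]_(p + q)).
Let M0' := rsubmx (1%:M : 'M[K]_(p + q)).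

Let ib0 : inverse_blocks M0 N0 N0' M0'.
Proof. by have := inverse_blocks_left (unitmx1 K (p + q)); rewrite invmx1. Qed.

Let F := row_disc b rho N0' M0'.
Let F' := col_disc b rho M0 N0.

Let b_lin a u v : b (a *: u + v) = a *: b u + b v.
Proof. exact: big_act_lin. Qed.
Let rho_lin1 r a u v : rho (a *: u + v) r = a *: rho u r + rho v r.
Proof. exact: rest_act_lin1. Qed.
Let rho_lin2 c a r r' : rho c (a *: r + r') = a *: rho c r + rho c r'.
Proof. exact: rest_act_lin2. Qed.

Let row_mx_eq0 m1 m2 (u : 'rV[K]_m1) (v : 'rV[K]_m2) : row_mx u v = 0 -> u = 0 /\ v = 0.
Proof. by rewrite -row_mx0 => /eq_row_mx. Qed.

Let F_brick z : F z != 0 <-> brick s t d (sink_rep inv eW eT z).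
Proof.
rewrite -(sink_kernel i0k d_i0 o_k st_k eWP eTP eCP dk d_off st_off z sink).
rewrite (surjective_pairing z) (row_disc_neq0 b_lin rho_lin1 ib0) /=; split=> h.
  move=> X c hX hr; have := h (row_mx (mxvec X) c).
  rewrite /tangent_row row_mxKl row_mxKr mxvecK hX /rho hr linear0 trmx0 row_mx0.
  by move=> /(_ erefl)/row_mx_eq0[/(congr1 vec_mx)]; rewrite mxvecK linear0.
move=> v /row_mx_eq0[/(congr1 vec_mx)]; rewrite mxvecK linear0 => hX /(congr1 trmx).
rewrite trmxK trmx0 => hr; have [/(congr1 mxvec)] := h _ _ hX hr.
by rewrite vec_mxK linear0 => e1 e2; rewrite -[v]hsubmxK e1 e2 row_mx0.
Qed.

Let F'_brick z : F' z != 0 <-> brick s' t' d' (source_rep inv eW eT z).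
Proof.
rewrite -(source_kernel i0k d_i0 o_k st_k eWP eTP eCP dk' d_off' st_off' z source).
rewrite (surjective_pairing z) (col_disc_neq0 b_lin rho_lin1 ib0) /=; split=> h.
  move=> X c hX hr; have := h (row_mx (mxvec X) c).
  rewrite /tangent_col row_mxKl row_mxKr mxvecK hX /rho hr linear0 trmx0 row_mx0.
  by move=> /(_ erefl)/row_mx_eq0[/(congr1 vec_mx)]; rewrite mxvecK linear0.
move=> v /row_mx_eq0[/(congr1 vec_mx)]; rewrite mxvecK linear0 => hX /(congr1 trmx).
rewrite trmxK trmx0 => hr; have [/(congr1 mxvec)] := h _ _ hX hr.
by rewrite vec_mxK linear0 => e1 e2; rewrite -[v]hsubmxK e1 e2 row_mx0.
Qed.

Let sinkK := sink_coordsK K o_k st_k eWP eTP dk d_off st_off eRP sink.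
Let sourceK := source_coordsK K o_k st_k eWP eTP dk' d_off' st_off' eRP' source.

Let brick_sink y : brick s t d (nat_rep (K := K) eR y) <->
  brick s t d (sink_rep inv eW eT (sink_coords eW eT p eR y)).
Proof.
have e a u v : (u < d (t a))%N -> (v < d (s a))%N ->
    nat_rep eR y a u v = sink_rep inv eW eT (sink_coords eW eT p eR y) a u v.
  by move=> hu hv; rewrite -{1}(proj1 sinkK y) /= (@vec_repK K V A s t d n eR eRP _ a u v hu hv).
by split; apply: brick_ext => a u v hu hv; rewrite e.
Qed.

Let brick_source y : brick s' t' d' (nat_rep (K := K) eR' y) <->
  brick s' t' d' (source_rep inv eW eT (source_coords eW eT q eR' y)).
Proof.
have e a u v : (u < d' (t' a))%N -> (v < d' (s' a))%N ->
    nat_rep eR' y a u v = source_rep inv eW eT (source_coords eW eT q eR' y) a u v.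
  by move=> hu hv; rewrite -{1}(proj1 sourceK y) /= (@vec_repK K V A s' t' d' n' eR' eRP' _ a u v hu hv).
by split; apply: brick_ext => a u v hu hv; rewrite e.
Qed.

Let polymap_prod (X Y Z : lmodType K) (h : X -> Z) :
  (forall a u v, h (a *: u + v) = a *: h u + h v) ->
  polymap (fun z : (X * Y)%type => (h z.1, z.2) : (Z * Y)%type).
Proof. by move=> hh; apply: polymap_lin => a u v; congr pair; rewrite /= hh. Qed.

Let det_pf m (Y : lmodType K) : pf (fun z : ('M[K]_m * Y)%type => \det z.1).
Proof. by apply: pf_det => i j; exact: (@pf_fst K _ Y (fun T : 'M[K]_m => T i j) (pf_entry K i j)). Qed.

Lemma sink_to_source_disc : (0 < p)%N ->
  disc_fun n (fun y => brick s t d (nat_rep (K := K) eR y)) ->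
  (exists y, brick s t d (nat_rep (K := K) eR y)) ->
  disc_fun n' (fun y => brick s' t' d' (nat_rep (K := K) eR' y)) /\
  (exists y, brick s' t' d' (nat_rep (K := K) eR' y)).
Proof.
move=> p0 D [y0 by0].
have pF := pf_row_disc b rho_lin2 N0' M0'.
have pF' := pf_col_disc b rho_lin2 M0 N0.
have Z1 : forall y t, sink_coords eW eT p eR (t *: y) = t *: sink_coords (K := K) eW eT p eR y.
  move=> y c; congr pair; apply/matrixP => i j; rewrite !mxE -[c *: y]addr0 nat_rep_lin;
    by rewrite [X in _ + X](_ : _ = 0) ?addr0 // /nat_rep /extend big1 // => l _; rewrite mxE mul0r.
have radF : pfradical F.
  have radG : pfradical (fun y => F (sink_coords eW eT p eR y)).
    apply: (disc_fun_unique uncK D).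
    - exact: pf_comp (@polymap_sink_coords K A _ _ eW eT p _ eR) pF.
    - by move=> c x; rewrite Z1 /F row_disc_homog //; congr (_ ^+ _ * _); rewrite nE.
    - by move=> x; rewrite F_brick brick_sink.
    - by exists y0.
  have := pfradical_iso (@polymap_sink_vec K A inv _ _ eW eT p _ eR) (@polymap_sink_coords K A _ _ eW eT p _ eR)
    (proj1 sinkK) (proj2 sinkK) radG.
  by apply: pfradical_ext => z; rewrite (proj2 sinkK).
(* A generic invertible matrix whose top block is a brick exists because both factors are nonzero
   polynomials; its inverse contains a brick of the reflected side. *)
have [T nz] : exists T : ('M[K]_(p + q) * 'cV[K]_n0)%type, \det T.1 * F (usubmx T.1, T.2) != 0.
  apply: (@pf_mul_neq0 K _ (fun T : ('M[K]_(p + q) * 'cV[K]_n0)%type => \det T.1)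
    (fun T => F (usubmx T.1, T.2))).
  - exact: det_pf.
  - apply: (@pf_comp _ _ _ (fun T : ('M[K]_(p + q) * 'cV[K]_n0)%type => (usubmx T.1, T.2))) pF.
    by apply: polymap_prod => a u v; rewrite linearP.
  - by exists (1%:M, 0); rewrite det1 oner_neq0.
  pose z0 := sink_coords eW eT p eR y0.
  exists (col_mx z0.1 0, z0.2); rewrite /= col_mxKu.
  by apply/F_brick/brick_sink.
move: nz; rewrite mulf_eq0 negb_or => /andP[dT].
have uT : T.1 \in unitmx by rewrite unitmxE unitfE.
rewrite /F (row_disc_col_disc b_lin rho_lin1 ib0 T.2 (inverse_blocks_left uT)).
rewrite mulf_eq0 negb_or => /andP[_ nz].
have nzF' : exists z, F' z != 0 by exists (rsubmx (invmx T.1), T.2).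
have radF' := row_to_col_radical b_lin rho_lin1 rho_lin2 ib0 erefl p0 nzF' radF.
split; last first.
  have [z /F'_brick bz] := nzF'; exists (vec_rep eR' (source_rep inv eW eT z)).
  by apply/brick_source; rewrite (proj2 sourceK).
apply: (disc_fun_iso (@polymap_source_coords K A _ _ eW eT q _ eR') (@polymap_source_vec K A inv _ _ eW eT q _ eR') _
   (proj2 sourceK) (proj1 sourceK) brick_source).
  move=> c y; congr pair; apply/matrixP => i j; rewrite !mxE -[c *: y]addr0 nat_rep_lin;
    by rewrite [X in _ + X](_ : _ = 0) ?addr0 // /nat_rep /extend big1 // => l _; rewrite mxE mul0r.
exists F'; split=> // [c z|z]; last exact: F'_brick.
by rewrite /F' col_disc_homog //; congr (_ ^+ _ * _); rewrite nE'.
Qed.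

Lemma source_to_sink_disc : (0 < q)%N ->
  disc_fun n' (fun y => brick s' t' d' (nat_rep (K := K) eR' y)) ->
  (exists y, brick s' t' d' (nat_rep (K := K) eR' y)) ->
  disc_fun n (fun y => brick s t d (nat_rep (K := K) eR y)) /\
  (exists y, brick s t d (nat_rep (K := K) eR y)).
Proof.
move=> q0 D [y0 by0].
have pF := pf_row_disc b rho_lin2 N0' M0'.
have pF' := pf_col_disc b rho_lin2 M0 N0.
have Z1 : forall y t, source_coords eW eT q eR' (t *: y) = t *: source_coords (K := K) eW eT q eR' y.
  move=> y c; congr pair; apply/matrixP => i j; rewrite !mxE -[c *: y]addr0 nat_rep_lin;
    by rewrite [X in _ + X](_ : _ = 0) ?addr0 // /nat_rep /extend big1 // => l _; rewrite mxE mul0r.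
have radF' : pfradical F'.
  have radG : pfradical (fun y => F' (source_coords eW eT q eR' y)).
    apply: (disc_fun_unique uncK D).
    - exact: pf_comp (@polymap_source_coords K A _ _ eW eT q _ eR') pF'.
    - by move=> c x; rewrite Z1 /F' col_disc_homog //; congr (_ ^+ _ * _); rewrite nE'.
    - by move=> x; rewrite F'_brick brick_source.
    - by exists y0.
  have := pfradical_iso (@polymap_source_vec K A inv _ _ eW eT q _ eR') (@polymap_source_coords K A _ _ eW eT q _ eR')
    (proj1 sourceK) (proj2 sourceK) radG.
  by apply: pfradical_ext => z; rewrite (proj2 sourceK).
have [T nz] : exists T : ('M[K]_(p + q) * 'cV[K]_n0)%type, \det T.1 * F' (rsubmx T.1, T.2) != 0.
  apply: (@pf_mul_neq0 K _ (fun T : ('M[K]_(p + q) * 'cV[K]_n0)%type => \det T.1)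
    (fun T => F' (rsubmx T.1, T.2))).
  - exact: det_pf.
  - apply: (@pf_comp _ _ _ (fun T : ('M[K]_(p + q) * 'cV[K]_n0)%type => (rsubmx T.1, T.2))) pF'.
    by apply: polymap_prod => a u v; rewrite linearP.
  - by exists (1%:M, 0); rewrite det1 oner_neq0.
  pose z0 := source_coords eW eT q eR' y0.
  exists (row_mx 0 z0.1, z0.2); rewrite /= row_mxKr.
  by apply/F'_brick/brick_source.
move: nz; rewrite mulf_eq0 negb_or => /andP[dT].
have uT : T.1 \in unitmx by rewrite unitmxE unitfE.
rewrite /F' (col_disc_row_disc b_lin rho_lin1 ib0 T.2 (inverse_blocks_right uT)).
rewrite mulf_eq0 negb_or => /andP[_ nz].
have nzF : exists z, F z != 0 by exists (usubmx (invmx T.1), T.2).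
have radF := col_to_row_radical b_lin rho_lin1 rho_lin2 ib0 erefl q0 nzF radF'.
split; last first.
  have [z /F_brick bz] := nzF; exists (vec_rep eR (sink_rep inv eW eT z)).
  by apply/brick_sink; rewrite (proj2 sinkK).
apply: (disc_fun_iso (@polymap_sink_coords K A _ _ eW eT p _ eR) (@polymap_sink_vec K A inv _ _ eW eT p _ eR) _
   (proj2 sinkK) (proj1 sinkK) brick_sink).
  move=> c y; congr pair; apply/matrixP => i j; rewrite !mxE -[c *: y]addr0 nat_rep_lin;
    by rewrite [X in _ + X](_ : _ = 0) ?addr0 // /nat_rep /extend big1 // => l _; rewrite mxE mul0r.
exists F; split=> // [c z|z]; last exact: F_brick.
by rewrite /F row_disc_homog //; congr (_ ^+ _ * _); rewrite nE.
Qed.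

End CastlingLink.

Section Good.
Variable K : numClosedFieldType.
Hypothesis uncK : uncountable_type K.

Lemma enumerates_eq (T : eqType) n (e : 'I_n -> T) (P Q : T -> bool) :
  P =1 Q -> enumerates e P -> enumerates e Q.
Proof. by move=> PQ [ie ce]; split=> // x; rewrite -PQ. Qed.

Section GoodDef.
Variables (V A : finType) (s t : A -> V) (d : V -> nat).

Definition valid_coord (z : A * nat * nat) : bool :=
  (z.1.2 < d (t z.1.1))%N && (z.2 < d (s z.1.1))%N.

(* [PGL(Q,d)] has the dimension of [Rep(Q,d)], and some reduced homogeneous
   equation of that degree cuts out the representations that are not bricks. *)
Definition good : Prop :=
  \sum_i d i * d i = (\sum_a d (t a) * d (s a)).+1 /\
  exists eR : 'I_(\sum_a d (t a) * d (s a)) -> A * nat * nat,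
  [/\ enumerates eR valid_coord, exists y, brick s t d (nat_rep (K := K) eR y) &
    disc_fun (\sum_a d (t a) * d (s a)) (fun y => brick s t d (nat_rep (K := K) eR y))].

Lemma reindex_brick n m (eR : 'I_n -> A * nat * nat) (eR' : 'I_m -> A * nat * nat) :
  enumerates eR valid_coord -> enumerates eR' valid_coord -> forall y,
  brick s t d (nat_rep (K := K) eR y) <->
  brick s t d (nat_rep (K := K) eR' (vec_rep eR' (nat_rep eR y))).
Proof.
by move=> h h' y; split; apply: brick_ext => a u v hu hv; rewrite (@vec_repK K V A s t d _ _ h').
Qed.

Lemma good_enum n (eR : 'I_n -> A * nat * nat) : enumerates eR valid_coord -> good ->
  [/\ \sum_i d i * d i = n.+1, exists y, brick s t d (nat_rep (K := K) eR y) &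
    disc_fun n (fun y => brick s t d (nat_rep (K := K) eR y))].
Proof.
move=> hR [hN [eR' [hR' [y by'] D]]].
have E := enumerates_size hR' hR; rewrite E in eR' hR' y by' D hN.
split=> //; first by exists (vec_rep eR (nat_rep eR' y)); apply/(reindex_brick hR' hR).
have lin (e e' : 'I_n -> A * nat * nat) : polymap (fun y : 'cV[K]_n => vec_rep e (nat_rep e' y)).
  by apply: polymap_lin => a u v; apply/colP => l; rewrite !mxE nat_rep_lin.
have can (e e' : 'I_n -> A * nat * nat) : enumerates e valid_coord -> enumerates e' valid_coord ->
    cancel (fun y : 'cV[K]_n => vec_rep e (nat_rep e' y)) (fun y => vec_rep e' (nat_rep e y)).
  move=> he he' z; apply/colP => l; rewrite mxE; have [h1 h2] := @eR_valid V A s t d _ _ he' l.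
  by rewrite (@vec_repK K V A s t d _ _ he) // (@nat_repE K V A s t d _ _ he').
apply: (disc_fun_iso (lin eR' eR) (lin eR eR') _ (can _ _ hR hR') (can _ _ hR' hR) _ D).
  move=> c z; apply/colP => l; rewrite !mxE -[c *: z]addr0 nat_rep_lin.
  by rewrite [X in _ + X](_ : _ = 0) ?addr0 // /nat_rep /extend big1 // => i _; rewrite mxE mul0r.
exact: reindex_brick.
Qed.

Lemma good_of_enum n (eR : 'I_n -> A * nat * nat) : enumerates eR valid_coord ->
  \sum_i d i * d i = n.+1 -> (exists y, brick s t d (nat_rep (K := K) eR y)) ->
  disc_fun n (fun y => brick s t d (nat_rep (K := K) eR y)) -> good.
Proof.
move=> hR; have [e he] := enumerates_sigma (fun a => d (t a)) (fun a => d (s a)).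
have E := enumerates_size he hR; move: eR hR; rewrite -E => eR hR hN b D.
by split=> //; exists eR; split.
Qed.

End GoodDef.

(** * Goodness under reflection *)

Section GoodCastling.
Variables (V A : finType) (k : V) (inv : pred A) (o : A -> V).
Variables (s t s' t' : A -> V) (d d' : V -> nat).
Hypothesis o_k : forall a, inv a -> o a != k.
Hypothesis st_k : forall a, ~~ inv a -> s a != k /\ t a != k.
Hypothesis sink : forall a, inv a -> s a = o a /\ t a = k.
Hypothesis source : forall a, inv a -> s' a = k /\ t' a = o a.
Hypothesis st_off : forall a, ~~ inv a -> s' a = s a /\ t' a = t a.
Hypothesis d_off : forall i, i != k -> d' i = d i.
Hypothesis d_pos : forall i, i != k -> (0 < d i)%N.
Hypothesis inv_ex : exists a, inv a.
Let w := (\sum_(a | inv a) d (o a))%N.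

Let link_data : exists w1 n0 c1 (eW : 'I_w1 -> A * nat * nat) (eT : 'I_n0 -> A * nat * nat)
  (eC : 'I_c1 -> V * nat * nat) i0,
  [/\ i0 != k,
   enumerates eW (fun z => [&& inv z.1.1, (z.1.2 < d (o z.1.1))%N & z.2 == 0%N]) /\ w1 = w,
   enumerates eT (fun z => [&& ~~ inv z.1.1, (z.1.2 < d (t z.1.1))%N & (z.2 < d (s z.1.1))%N]) /\
     n0 = (\sum_(a | ~~ inv a) d (t a) * d (s a))%N &
   enumerates eC (fun z => [&& z.1.1 != k, (z.1.2 < d z.1.1)%N, (z.2 < d z.1.1)%N &
     z != (i0, 0%N, 0%N)]) /\ c1.+1 = (\sum_(i | i != k) d i * d i)%N].
Proof.
have [eW hW] := enumerates_sigma (fun a => if inv a then d (o a) else 0%N) (fun=> 1%N).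
have [eT hT] := enumerates_sigma (fun a => if inv a then 0%N else d (t a)) (fun a => d (s a)).
have [eC hC] := enumerates_sigma (fun i => if i == k then 0%N else d i) d.
(* An arrow at [k] supplies the base vertex [i0], different from [k], at which scalars are
   normalised. *)
have [a0 ia0] := inv_ex; have i0k := o_k ia0; have d0 := d_pos i0k.
have cE : \sum_i (if i == k then 0%N else d i) * d i = (\sum_(i | i != k) d i * d i)%N.
  by rewrite [RHS]big_mkcond; apply: eq_bigr => i _; case: eqP.
move: eC hC; rewrite cE; case cc : (\sum_(i | _) _)%N => [|c1] eC hC.
  move/eqP: cc; rewrite sum_nat_eq0 => /forallP /(_ (o a0)); rewrite i0k /= muln_eq0.
  by rewrite -leqn0 leqNgt d0.
have [|e he] := enumerates_remove (x0 := (o a0, 0%N, 0%N)) hC.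
  by rewrite /= (negbTE i0k) d0.
exists _, _, c1, eW, eT, e, (o a0); split=> //.
- split.
    apply: enumerates_eq hW => [[[a u] v]] /=; rewrite ltnS leqn0.
    by case: (inv a).
  by rewrite /w [RHS]big_mkcond; apply: eq_bigr => a _; rewrite muln1.
- split.
    by apply: enumerates_eq hT => [[[a u] v]] /=; case: (inv a).
  by rewrite [RHS]big_mkcond; apply: eq_bigr => a _; case: (inv a).
split=> //; apply: enumerates_eq he => [[[i u] v]] /=.
by case: eqP => //=; rewrite andbA.
Qed.

Let sum_inv (f g : A -> V) : (forall a, inv a -> f a = o a /\ g a = k) -> forall e : V -> nat,
  (forall i, i != k -> e i = d i) ->
  (\sum_(a | inv a) e (f a) * e (g a) = e k * w)%N.
Proof.
move=> h e he; rewrite /w big_distrr /=; apply: eq_bigr => a ia.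
by have [-> ->] := h a ia; rewrite he ?o_k // mulnC.
Qed.

Let sum_off (e : V -> nat) : (forall i, i != k -> e i = d i) ->
  (\sum_i e i * e i = e k * e k + \sum_(i | i != k) d i * d i)%N.
Proof.
move=> he; rewrite (bigD1 k) //=; congr (_ + _)%N.
by apply: eq_bigr => i ik; rewrite he.
Qed.

Lemma good_sink_to_source : (0 < d k)%N -> d' k = (w - d k)%N -> good s t d ->
  (d k <= w)%N /\ good s' t' d'.
Proof.
move=> p0 d'k G.
have [w1 [n0 [c1 [eW [eT [eC [i0 [i0k [hW wE] [hT nE] [hC cE]]]]]]]]] := link_data.
have d_i0 := d_pos i0k.
have [eR hR] := enumerates_sigma (fun a => d (t a)) (fun a => d (s a)).
have [eR' hR'] := enumerates_sigma (fun a => d' (t' a)) (fun a => d' (s' a)).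
have [hN [y by_] D] := good_enum hR G.
have rE : (\sum_a d (t a) * d (s a) = d k * w + n0)%N.
  rewrite (bigID inv) /= nE; congr (_ + _)%N.
  under eq_bigr do rewrite mulnC.
  exact: (sum_inv sink).
have rE' : (\sum_a d' (t' a) * d' (s' a) = d' k * w + n0)%N.
  rewrite (bigID inv) /= nE; congr (_ + _)%N.
    by apply: sum_inv d_off => a ia; have [-> ->] := source ia.
  apply: eq_bigr => a ia; have [-> ->] := st_off ia; have [h1 h2] := st_k ia.
  by rewrite !d_off.
(* A matrix killing [M] from the left, with nothing at the other vertices, lies in the kernel of the
   tangent map; at a brick the rows of [M] are therefore independent. *)
have le : (d k <= w)%N.
  have E := proj1 (sink_coordsK K o_k st_k hW hT erefl (fun i _ => erefl) (fun a _ => conj erefl erefl) hR sink) y.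
  have /(sink_kernel i0k d_i0 o_k st_k hW hT hC erefl (fun i _ => erefl) (fun a _ => conj erefl erefl) _ sink) ker :
     brick s t d (sink_rep inv eW eT (sink_coords eW eT (d k) eR y)).
    by move: by_; apply: brick_ext => a u v hu hv; rewrite -{1}E (@vec_repK K V A s t d _ _ hR).
  have [||z _] := ker (kermx (sink_coords eW eT (d k) eR y).1) 0.
  - rewrite mulmx_ker add0r; suff -> : big_act (K := K) o eW eC 0 = 0 by rewrite mulmx0.
    have := big_act_lin (K := K) o eW eC (-1) 0 0.
    by rewrite scaler0 addr0 scaleN1r addNr.
  - have := rest_act_lin1 (K := K) s t d eT eC (sink_coords eW eT (d k) eR y).2 (-1) 0 0.
    by rewrite scaler0 addr0 scaleN1r addNr.
  have /eqP := mxrank_ker (sink_coords eW eT (d k) eR y).1.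
  rewrite z mxrank0 eq_sym subn_eq0 => h; rewrite -wE; apply: leq_trans h (rank_leq_col _).
split=> //.
have sN := sum_off (e := d) (fun i _ => erefl); have sN' := sum_off d_off.
have w1E : w1 = (d k + d' k)%N by rewrite wE d'k subnKC.
(* Here the equality of the dimensions of the group and of the representation space enters: it says
   that the Lie algebra away from [k] has the size for which both tangent maps are square. *)
have c1E : c1 = (d k * d' k + n0)%N.
  move: hN; rewrite rE sN -cE -wE w1E => /eqP; rewrite mulnDr !addnS eqSS => /eqP h.
  by apply/eqP; rewrite -(eqn_add2l (d k * d k)) h addnA.
have w2E : w = (d k + d' k)%N by rewrite -wE.
have nE1 : (\sum_a d (t a) * d (s a) = d k * d k + (d k * d' k + n0))%N.
  by rewrite rE w2E mulnDr addnA.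
have nE2 : (\sum_a d' (t' a) * d' (s' a) = d' k * d' k + (d k * d' k + n0))%N.
  by rewrite rE' w2E mulnDr [(d' k * d k)%N]mulnC addnCA addnA.
have NE : (\sum_i d i * d i = d k * d k + (d k * d' k + n0).+1)%N by rewrite sN -cE c1E.
have NE' : (\sum_i d' i * d' i = d' k * d' k + (d k * d' k + n0).+1)%N by rewrite sN' -cE c1E.
clear wE cE rE rE'; subst w1 c1.
have [D' br'] := sink_to_source_disc uncK i0k d_i0 o_k st_k hW hT hC erefl erefl
  (fun i _ => erefl) d_off (fun a _ => conj erefl erefl) st_off sink source hR hR' nE1 nE2 p0 D
  (ex_intro _ y by_).
by apply: good_of_enum hR' _ br' D'; rewrite NE' nE2 addnS.
Qed.


(** The mirror argument: at a source the columns are independent, and the cokernel matrix replaces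
    the kernel matrix. *)
Lemma good_source_to_sink : (0 < d' k)%N -> d k = (w - d' k)%N -> good s' t' d' ->
  (d' k <= w)%N /\ good s t d.
Proof.
move=> q0 dk G.
have [w1 [n0 [c1 [eW [eT [eC [i0 [i0k [hW wE] [hT nE] [hC cE]]]]]]]]] := link_data.
have d_i0 := d_pos i0k.
have [eR hR] := enumerates_sigma (fun a => d (t a)) (fun a => d (s a)).
have [eR' hR'] := enumerates_sigma (fun a => d' (t' a)) (fun a => d' (s' a)).
have [hN [y by_] D] := good_enum hR' G.
have rE : (\sum_a d (t a) * d (s a) = d k * w + n0)%N.
  rewrite (bigID inv) /= nE; congr (_ + _)%N.
  under eq_bigr do rewrite mulnC.
  exact: (sum_inv sink).
have rE' : (\sum_a d' (t' a) * d' (s' a) = d' k * w + n0)%N.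
  rewrite (bigID inv) /= nE; congr (_ + _)%N.
    by apply: sum_inv d_off => a ia; have [-> ->] := source ia.
  apply: eq_bigr => a ia; have [-> ->] := st_off ia; have [h1 h2] := st_k ia.
  by rewrite !d_off.
have le : (d' k <= w)%N.
  have E := proj1 (source_coordsK K o_k st_k hW hT erefl d_off st_off hR' source) y.
  have /(source_kernel i0k d_i0 o_k st_k hW hT hC erefl d_off st_off _ source) ker :
     brick s' t' d' (source_rep inv eW eT (source_coords eW eT (d' k) eR' y)).
    by move: by_; apply: brick_ext => a u v hu hv; rewrite -{1}E (@vec_repK K V A s' t' d' _ _ hR').
  have [||z _] := ker (cokermx (source_coords eW eT (d' k) eR' y).1) 0.
  - rewrite mulmx_coker add0r; suff -> : big_act (K := K) o eW eC 0 = 0 by rewrite mul0mx.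
    have := big_act_lin (K := K) o eW eC (-1) 0 0.
    by rewrite scaler0 addr0 scaleN1r addNr.
  - have := rest_act_lin1 (K := K) s t d eT eC (source_coords eW eT (d' k) eR' y).2 (-1) 0 0.
    by rewrite scaler0 addr0 scaleN1r addNr.
  have /eqP := mxrank_coker (source_coords eW eT (d' k) eR' y).1.
  rewrite z mxrank0 eq_sym subn_eq0 => h; rewrite -wE; apply: leq_trans h (rank_leq_row _).
split=> //.
have sN := sum_off (e := d) (fun i _ => erefl); have sN' := sum_off d_off.
have w1E : w1 = (d k + d' k)%N by rewrite wE dk subnK.
have c1E : c1 = (d k * d' k + n0)%N.
  move: hN; rewrite rE' sN' -cE -wE w1E => /eqP; rewrite mulnDr !addnS eqSS => /eqP h.
  by apply/eqP; rewrite -(eqn_add2l (d' k * d' k)) h mulnC addnCA addnA.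
have w2E : w = (d k + d' k)%N by rewrite -wE.
have nE1 : (\sum_a d (t a) * d (s a) = d k * d k + (d k * d' k + n0))%N.
  by rewrite rE w2E mulnDr addnA.
have nE2 : (\sum_a d' (t' a) * d' (s' a) = d' k * d' k + (d k * d' k + n0))%N.
  by rewrite rE' w2E mulnDr [(d' k * d k)%N]mulnC addnCA addnA.
have NE : (\sum_i d i * d i = d k * d k + (d k * d' k + n0).+1)%N by rewrite sN -cE c1E.
have NE' : (\sum_i d' i * d' i = d' k * d' k + (d k * d' k + n0).+1)%N by rewrite sN' -cE c1E.
clear wE cE rE rE'; subst w1 c1.
have [D' br'] := source_to_sink_disc uncK i0k d_i0 o_k st_k hW hT hC erefl erefl
  (fun i _ => erefl) d_off (fun a _ => conj erefl erefl) st_off sink source hR hR' nE1 nE2 q0 D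
  (ex_intro _ y by_).
by apply: good_of_enum hR _ br' D'; rewrite NE nE1 addnS.
Qed.


End GoodCastling.

End Good.

(** * The group action on the representation space *)

Section GroupAction.
Variable K : numFieldType.
Variable P : dquiver.
Notation n := (rep_dim P).
Notation GLf := (GLfamily K P).
Notation rep := (Rep K P).

Definition colmx m p (f : 'cV[K]_m -> 'cV[K]_p) : 'M[K]_(p, m) :=
  \matrix_(i, j) f (delta_mx j 0) i 0.

Lemma mul_colmx m p (f : 'cV[K]_m -> 'cV[K]_p) :
  (forall a u v, f (a *: u + v) = a *: f u + f v) -> forall v, colmx f *m v = f v.
Proof.
move=> hf v; apply/colP => i.
have hl : linform (fun u => f u i 0) by move=> a u1 u2; rewrite hf !mxE.
rewrite !mxE [RHS](linform_mx hl); apply: eq_bigr => j _.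
by rewrite big_ord1 mxE mulrC.
Qed.

Definition mx_rep (y : 'cV[K]_n) : rep := fun a =>
  \matrix_(u, v) y (enum_rank (Tagged (fun a : arrow P => ('I_(dvec (tgt a)) * 'I_(dvec (src a)))%type) (u, v))) 0.

Lemma mx_repK y : rep_vec (mx_rep y) = y.
Proof.
apply/colP => i; rewrite mxE /= mxE; congr fun_of_matrix; apply: (canLR enum_valK).
by case: (enum_val i) => a [u v].
Qed.

Lemma rep_vecK (x : rep) a : mx_rep (rep_vec x) a = x a.
Proof. by apply/matrixP => u v; rewrite !mxE enum_rankK. Qed.

Lemma rep_vec_lin c (x y : rep) :
  rep_vec (fun a => c *: x a + y a) = c *: rep_vec x + rep_vec y.
Proof. by apply/colP => i; rewrite !mxE /= !mxE. Qed.

Lemma eq_rep_vec (x y : rep) : (forall a, x a = y a) -> rep_vec x = rep_vec y.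
Proof. by move=> xy; apply/colP => i; rewrite !mxE /= xy. Qed.

Lemma rep_vec_inj (x y : rep) : rep_vec x = rep_vec y -> forall a, x a = y a.
Proof. by move=> e a; rewrite -rep_vecK e rep_vecK. Qed.

Lemma mx_rep_lin c y z a : mx_rep (c *: y + z) a = c *: mx_rep y a + mx_rep z a.
Proof. by apply/matrixP => u v; rewrite !mxE. Qed.

Definition fam_act (B : GLf) (x : rep) : rep :=
  fun a => B (tgt a) *m x a - x a *m B (src a).

Definition lieact (B : GLf) : 'M[K]_n := colmx (fun y => rep_vec (fam_act B (mx_rep y))).
Definition grpact (g : GLf) : 'M[K]_n := colmx (fun y => rep_vec (rep_act g (mx_rep y))).

Lemma lieactE B y : lieact B *m y = rep_vec (fam_act B (mx_rep y)).
Proof.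
rewrite /lieact mul_colmx // => c u v; rewrite -rep_vec_lin; apply: eq_rep_vec => a.
by rewrite /fam_act mx_rep_lin mulmxDr mulmxDl -scalemxAr -scalemxAl scalerBr opprD addrACA.
Qed.

Lemma grpactE g y : grpact g *m y = rep_vec (rep_act g (mx_rep y)).
Proof.
rewrite /grpact mul_colmx // => c u v; rewrite -rep_vec_lin; apply: eq_rep_vec => a.
by rewrite /rep_act mx_rep_lin mulmxDr mulmxDl -scalemxAr -scalemxAl.
Qed.

Lemma grpact_rep g x : grpact g *m rep_vec x = rep_vec (rep_act g x).
Proof. by rewrite grpactE; apply: eq_rep_vec => a; rewrite /rep_act rep_vecK. Qed.

Lemma lieact_rep B x : lieact B *m rep_vec x = rep_vec (fam_act B x).
Proof. by rewrite lieactE; apply: eq_rep_vec => a; rewrite /fam_act rep_vecK. Qed.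

Lemma cV_matrix_ext m p (A B : 'M[K]_(m, p)) :
  (forall v : 'cV_p, A *m v = B *m v) -> A = B.
Proof.
move=> h; apply/matrixP => i j; have /colP/(_ i) := h (delta_mx j 0).
by rewrite -!colE !mxE.
Qed.

Lemma invmx_mul m (A B : 'M[K]_m) : A \in unitmx -> B \in unitmx ->
  invmx (A *m B) = invmx B *m invmx A.
Proof.
move=> uA uB; have uAB : A *m B \in unitmx by rewrite unitmx_mul uA.
by rewrite -[RHS](mulmxK uAB) !mulmxA (mulmxKV uA) mulVmx // mul1mx.
Qed.

Definition fam_mul (g h : GLf) : GLf := fun i => g i *m h i.
Definition fam_inv (g : GLf) : GLf := fun i => invmx (g i).
Definition fam_scal (c : K) : GLf := fun i => c%:M.

Lemma in_GL_mul g h : in_GL g -> in_GL h -> in_GL (fam_mul g h).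
Proof. by move=> hg hh i; rewrite unitmx_mul hg hh. Qed.
Lemma in_GL_inv g : in_GL g -> in_GL (fam_inv g).
Proof. by move=> hg i; rewrite unitmx_inv. Qed.
Lemma in_GL_scal c : c != 0 -> in_GL (fam_scal c).
Proof. by move=> c0 i; rewrite unitmxE det_scalar unitfE expf_neq0. Qed.

Lemma grpact_mul g h : in_GL g -> in_GL h -> grpact (fam_mul g h) = grpact g *m grpact h.
Proof.
move=> hg hh; apply: cV_matrix_ext => y; rewrite -mulmxA !grpactE.
apply: eq_rep_vec => a; rewrite /rep_act rep_vecK /fam_mul invmx_mul ?hg ?hh //.
by rewrite -!mulmxA.
Qed.

Lemma grpact_scal c : c != 0 -> grpact (fam_scal c) = 1%:M.
Proof.
move=> c0; apply: cV_matrix_ext => y; rewrite mul1mx grpactE -[RHS]mx_repK.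
apply: eq_rep_vec => a; rewrite /rep_act /fam_scal mul_scalar_mx.
rewrite -scalemxAl invmx_scalar mul_mx_scalar scalerA mulfV // scale1r //.
Qed.

Lemma grpact_inv g : in_GL g -> grpact (fam_inv g) *m grpact g = 1%:M.
Proof.
move=> hg; rewrite -grpact_mul //; last exact: in_GL_inv.
rewrite -(grpact_scal (oner_neq0 K)); congr grpact.
by apply: boolp.functional_extensionality_dep => i; rewrite /fam_mul /fam_inv mulVmx.
Qed.

Lemma grpact_unit g : in_GL g -> grpact g \in unitmx.
Proof. by move=> hg; case: (mulmx1_unit (grpact_inv hg)). Qed.

Lemma PGL_imageP (A : 'M[K]_n) : PGL_image A <-> exists2 g, in_GL g & A = grpact g.
Proof.
split=> [[g hg e]|[g hg ->]]; exists g => //; last by move=> x; rewrite grpact_rep.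
by apply: cV_matrix_ext => y; rewrite -[y]mx_repK -e grpact_rep.
Qed.

Definition fam_det (g : GLf) : K := \prod_i \det (g i).

Lemma in_GLP g : in_GL g <-> fam_det g != 0.
Proof.
split=> [hg|]; first by apply/prodf_neq0 => i _; rewrite -unitfE -unitmxE.
by move=> /prodf_neq0 h i; rewrite unitmxE unitfE h.
Qed.

Section RegularAction.
Variables (X : lmodType K) (g : X -> GLf).
Hypothesis pfg : forall i u v, pf (fun x => g x i u v).

Lemma pf_fam_det : pf (fun x => fam_det (g x)).
Proof. by apply: pf_prod => i; apply: pf_det => u v; exact: pfg. Qed.

Lemma regular_fam_inv i u v : regular (fun x => fam_det (g x)) (fun x => invmx (g x i) u v).
Proof.
apply: (@regular_invmx _ _ _ _ _ (fun x => \prod_(j | j != i) \det (g x j))) => //; last first.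
  by move=> x; rewrite /fam_det (bigD1 i) //= mulrC.
apply: (@pf_ext _ _ (fun x => \prod_j if j != i then \det (g x j) else 1)).
  by move=> x; rewrite [RHS]big_mkcond.
apply: pf_prod => j; case: (j != i); last exact: pf_const.
by apply: pf_det => *; exact: pfg.
Qed.

(** The left factor is kept separate from [g] so that difference quotients of the action are covered
    as well. *)
Lemma regular_rep_act (r : X -> rep) (h : X -> GLf) :
  (forall a u v, regular (fun x => fam_det (g x)) (fun x => r x a u v)) ->
  (forall i u v, pf (fun x => h x i u v)) ->
  forall l, regular (fun x => fam_det (g x))
    (fun x => rep_vec (fun a => h x (tgt a) *m r x a *m invmx (g x (src a))) l 0).
Proof.
move=> hr hh l; case e : (enum_val l : rep_coord P) => [a [u v]].
apply: (@regular_ext _ _ _ (fun x =>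
   \sum_j (\sum_k h x (tgt a) u k * r x a k j) * invmx (g x (src a)) j v)).
  move=> x _; rewrite mxE e /= mxE; apply: eq_bigr => j _.
  by rewrite [X in _ = X * _]mxE.
apply: (regular_sum pf_fam_det) => j; apply: regular_mul; last exact: regular_fam_inv.
apply: (regular_sum pf_fam_det) => k; apply: regular_mul => //.
exact/regular_pf/hh.
Qed.

Lemma regular_grpact l m : regular (fun x => fam_det (g x)) (fun x => grpact (g x) l m).
Proof.
apply: (@regular_ext _ _ _ (fun x => rep_vec (rep_act (g x) (mx_rep (delta_mx m 0))) l 0)).
  by move=> x _; rewrite [RHS]mxE.
apply: (regular_rep_act (r := fun=> mx_rep (delta_mx m 0))) => // a u v.
by apply: regular_pf; exact: pf_const.
Qed.

End RegularAction.

Definition orbit_stable (Z : 'cV[K]_n -> Prop) : Prop :=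
  forall g, in_GL g -> forall y, Z y -> Z (grpact g *m y).

(* Differentiate [f] along the curve [1 + t B] of group elements at [t = 0]. *)
Lemma vanishing_lie_derivative (Z : 'cV[K]_n -> Prop) (f : {mpoly K[n]}) (B : GLf) :
  orbit_stable Z -> (forall y, Z y -> peval f y = 0) ->
  forall y, Z y -> \sum_i (lieact B *m y) i 0 * peval f^`M(i) y = 0.
Proof.
move=> stab f0 y Zy; pose x := mx_rep y.
pose g (t : K^o) : GLf := fun i => 1%:M + t *: B i.
have pfg i u v : pf (fun t : K^o => g t i u v).
  apply: (@pf_ext _ _ (fun t : K^o => (1%:M : 'M[K]_(dvec i)) u v + t * B i u v)).
    by move=> t; rewrite !mxE.
  apply: pf_add; first exact: pf_const.
  apply: pf_mul; last exact: pf_const.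
  exact: pf_linform.
pose dl (t : K^o) := fam_det (g t).
have pdl : pf dl by exact: pf_fam_det.
have g0 i : g 0 i = 1%:M by rewrite /g scale0r addr0.
have dl0 : dl 0 != 0.
  by rewrite /dl /fam_det big1 ?oner_neq0 // => i _; rewrite g0 det1.
(* The quotient of [g(t) y - y] by [t]: moving a representation [x] by [1 + t B] adds
   [t (B x - x B)] times the inverse of [1 + t B]. It is regular at 0 with value the infinitesimal
   action. *)
pose z (t : K^o) : 'cV[K]_n := rep_vec (fun a => 1%:M *m fam_act B x a *m invmx (g t (src a))).
have rz i : regular dl (fun t => z t i 0).
  apply: (@regular_rep_act _ _ pfg (fun=> fam_act B x) (fun=> fam_scal 1)) => *.
    by apply: regular_pf; exact: pf_const.
  exact: pf_const.
pose u (t : K^o) : 'cV[K]_n := grpact (g t) *m y.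
have ru i : regular dl (fun t => u t i 0).
  apply: (@regular_ext _ _ _ (fun t => \sum_j grpact (g t) i j * y j 0)).
    by move=> t _; rewrite [RHS]mxE.
  apply: (regular_sum pdl) => j; apply: regular_mul; first exact: regular_grpact.
  by apply: regular_pf; exact: pf_const.
have [q [pq eq dq]] := peval_telescope f.
pose S (t : K^o) := \sum_i z t i 0 * q i (u t) y.
have rS : regular dl S.
  apply: (regular_sum pdl) => i; apply: regular_mul => //.
  apply: (@regular_comp _ _ _ pdl _ (fun t => (u t, y) : ('cV[K]_n * 'cV[K]_n)%type) (fun w => q i w.1 w.2)) => //.
  apply: (rmap_pair pdl).
    by apply: (rmap_mx pdl) => a b; rewrite ord1.
  by move=> l hl; apply: regular_pf; exact: pf_const.
have uz t : dl t != 0 -> u t - y = t *: z t.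
  move=> /in_GLP hg; apply: (canLR (addrK _)); rewrite /u -{2}[y]mx_repK -/x -rep_vec_lin.
  rewrite grpactE -/x; apply: eq_rep_vec => a.
  rewrite /rep_act mul1mx scalemxAl -[X in _ + X](mulmxK (hg (src a))) -mulmxDl; congr (_ *m _).
  rewrite /fam_act /g mulmxDl mulmxDr !mul1mx mulmx1 -scalemxAl -scalemxAr scalerBr.
  by rewrite [RHS]addrC -!addrA; congr (_ + _); rewrite addrCA subrr addr0.
have S0 : S 0 = 0.
  apply: (@regular_eq0 _ _ dl pdl S (fun t : K^o => t)) => //.
  - exact: pf_linform.
  - by exists 1; exact: oner_neq0.
  move=> t dt t0; have Zu : Z (u t) by apply: stab => //; apply/in_GLP.
  have := eq (u t) y; rewrite (f0 _ Zu) (f0 _ Zy) subrr => /esym h.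
  apply: (mulfI t0); rewrite mulr0 -h /S mulr_sumr; apply: eq_bigr => i _.
  have -> : u t i 0 - y i 0 = (u t - y) i 0 by rewrite !mxE.
  rewrite uz // mulrA; congr (_ * _); exact/esym/mxE.
have z0 : z 0 = lieact B *m y.
  by rewrite lieactE -/x; apply: eq_rep_vec => a; rewrite mul1mx g0 invmx1 mulmx1.
have u0 : u 0 = y.
  rewrite /u -[RHS]mul1mx -(grpact_scal (oner_neq0 K)); congr (grpact _ *m _).
  by apply: boolp.functional_extensionality_dep => j; rewrite g0.
by rewrite -[RHS]S0 /S z0 u0; apply: eq_bigr => i _; rewrite dq.
Qed.

Definition gl_orbit (y y' : 'cV[K]_n) : Prop := exists2 g, in_GL g & y' = grpact g *m y.

Lemma orbit_refl y : gl_orbit y y.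
Proof.
by exists (fam_scal 1); [exact/in_GL_scal/oner_neq0|rewrite grpact_scal ?oner_neq0 // mul1mx].
Qed.

Lemma orbit_act y y' g : in_GL g -> gl_orbit y y' -> gl_orbit y (grpact g *m y').
Proof.
move=> hg [h hh ->]; exists (fam_mul g h); first exact: in_GL_mul.
by rewrite grpact_mul // mulmxA.
Qed.

Lemma orbit_sym y y' : gl_orbit y y' -> gl_orbit y' y.
Proof.
move=> [g hg ->]; exists (fam_inv g); first exact: in_GL_inv.
by rewrite mulmxA grpact_inv // mul1mx.
Qed.

Lemma orbit_trans y1 y2 y3 : gl_orbit y1 y2 -> gl_orbit y2 y3 -> gl_orbit y1 y3.
Proof. by move=> h [g hg ->]; exact: orbit_act. Qed.

Lemma rep_orbitE (x : rep) v : rep_orbit x v <-> gl_orbit (rep_vec x) v.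
Proof. by split=> -[g hg e]; exists g => //; rewrite e grpact_rep. Qed.

Definition lie_surjective (y : 'cV[K]_n) : Prop :=
  forall e : 'cV[K]_n, exists B, lieact B *m y = e.

Lemma lie_surjective_act y g : in_GL g -> lie_surjective y -> lie_surjective (grpact g *m y).
Proof.
move=> hg sy e; have [B hB] := sy (grpact (fam_inv g) *m e).
exists (fun i => g i *m B i *m invmx (g i)).
have -> : e = grpact g *m (lieact B *m y).
  rewrite hB mulmxA -grpact_mul //; last exact: in_GL_inv.
  rewrite (_ : fam_mul g (fam_inv g) = fam_scal 1) ?grpact_scal ?oner_neq0 ?mul1mx //.
  by apply: boolp.functional_extensionality_dep => i; rewrite /fam_mul /fam_inv mulmxV.
rewrite -[y]mx_repK grpact_rep !lieact_rep grpact_rep; apply: eq_rep_vec => a.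
rewrite /fam_act /rep_act mulmxBr mulmxBl !mulmxA.
by rewrite !(mulmxKV (hg _)).
Qed.

(** Every coordinate direction is tangent to the orbit at each of its points, so the polynomials
    vanishing on the orbit are closed under partial derivatives and contain no nonzero constant. *)
Lemma orbit_dense y (f : {mpoly K[n]}) : lie_surjective y ->
  (forall y', gl_orbit y y' -> peval f y' = 0) -> f = 0.
Proof.
move=> sy f0; apply/eqP/negP => /negP fn0.
pose J (p : {mpoly K[n]}) := forall y', gl_orbit y y' -> peval p y' = 0.
have [|c cn0 Jc] := @deriv_closed_const K n J _ f f0 fn0.
  move=> i p Jp y' oy; have [g hg ey] := oy.
  have [B hB] : exists B, lieact B *m y' = delta_mx i 0.
    by rewrite ey; apply: lie_surjective_act.
  have := @vanishing_lie_derivative (gl_orbit y) p B (fun g hg z hz => orbit_act hg hz) Jp y' oy.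
  rewrite hB (bigD1 i) //= big1 ?addr0 => [|j nj].
    by rewrite mxE !eqxx mul1r.
  by rewrite mxE (negbTE nj) mul0r.
by have := Jc y (orbit_refl y); rewrite /peval mevalC => /eqP; rewrite (negbTE cn0).
Qed.

End GroupAction.

(** * The Lie algebra modulo scalars *)

Section Slice.
Variable K : numFieldType.
Variable P : dquiver.
Notation n := (rep_dim P).
Notation GLf := (GLfamily K P).
Notation rep := (Rep K P).

Definition rep_index (i : 'I_n) : arrow P * nat * nat :=
  let u : rep_coord P := enum_val i in
  (tag u, nat_of_ord (tagged u).1, nat_of_ord (tagged u).2).

Lemma rep_index_enum : enumerates rep_index (valid_coord (@src P) (@tgt P) (@dvec P)).
Proof.
split=> [i j|[[a u] v]].
  rewrite /rep_index => hij; apply: enum_val_inj; move: hij.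
  case: (enum_val i) (enum_val j) => [a [u v]] [a' [u' v']] [e]; subst a' => /= eu ev.
  by congr Tagged; congr pair; apply: val_inj.
split=> [/andP[/= hu hv]|[l]].
  exists (enum_rank (Tagged (fun a : arrow P => ('I_(dvec (tgt a)) * 'I_(dvec (src a)))%type)
     (Ordinal hu, Ordinal hv))).
  by rewrite /rep_index enum_rankK.
rewrite /rep_index; case: (enum_val l) => [b [x y]] /= [e eu ev]; subst.
by rewrite /valid_coord /= !ltn_ord.
Qed.

Lemma nat_rep_mx (y : 'cV[K]_n) a u v : nat_rep rep_index y a (nat_of_ord u) (nat_of_ord v) = mx_rep y a u v.
Proof.
rewrite mxE /nat_rep.
set i := enum_rank _; have <- : rep_index i = (a, nat_of_ord u, nat_of_ord v).
  by rewrite /rep_index /i enum_rankK.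
by rewrite extend_on //; case: rep_index_enum.
Qed.

Definition lie_brick (y : 'cV[K]_n) : Prop :=
  forall B : GLf, lieact B *m y = 0 -> exists c, forall i, B i = c%:M.

Lemma lieact_eq0 (B : GLf) y :
  lieact B *m y = 0 <-> forall a, fam_act B (mx_rep y) a = 0.
Proof.
rewrite lieactE; split=> [h a|h].
  have := @rep_vec_inj K P (fam_act B (mx_rep y)) (fun a => 0) _ a; apply.
  by rewrite h; apply/colP => i; rewrite !mxE /= mxE.
apply/colP => i; rewrite mxE [RHS]mxE /= h mxE //.
Qed.

Lemma intertwines_fam (B : GLf) (b : vertex P -> nat -> nat -> K) y :
  (forall i (u v : 'I_(dvec i)), B i u v = b i u v) ->
  lieact B *m y = 0 <-> intertwines (@src P) (@tgt P) (@dvec P) (nat_rep rep_index y) b.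
Proof.
move=> Bb; rewrite lieact_eq0.
have E a (u : 'I_(dvec (tgt a))) (v : 'I_(dvec (src a))) : fam_act B (mx_rep y) a u v =
   \sum_(j < dvec (tgt a)) b (tgt a) u j * nat_rep rep_index y a j v -
   \sum_(j < dvec (src a)) nat_rep rep_index y a u j * b (src a) j v.
  rewrite /fam_act mxE [(B _ *m _) u v]mxE mxE [(_ *m B _) u v]mxE.
  by congr (_ - _); apply: eq_bigr => j _; rewrite nat_rep_mx Bb.
split=> [h a u v hu hv|h a].
  have := E a (Ordinal hu) (Ordinal hv); rewrite h mxE => /esym/eqP.
  by rewrite subr_eq0 => /eqP.
by apply/matrixP => u v; rewrite E h // subrr mxE.
Qed.

Lemma brickP y : brick (@src P) (@tgt P) (@dvec P) (nat_rep rep_index y) <-> lie_brick y.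
Proof.
split=> [br B hB|br b hb].
  have [|c hc] := br (fun i => mx_entries (B i)).
    by apply/(intertwines_fam (B := B)) => // i u v; rewrite mx_entriesE.
  exists c => i; apply/matrixP => u v; rewrite -mx_entriesE hc // mxE.
  by rewrite mulr_natr.
pose B : GLf := fun i => \matrix_(u, v) b i u v.
have hB : lieact B *m y = 0 by apply/(intertwines_fam (b := b)) => // i u v; rewrite mxE.
have [c hc] := br B hB; exists c => i u v hu hv.
have /matrixP/(_ (Ordinal hu) (Ordinal hv)) := hc i; rewrite !mxE /= => ->.
by rewrite mulr_natr.
Qed.

Lemma lieact_lin a (B C : GLf) :
  lieact (fun i => a *: B i + C i) = a *: lieact B + lieact C.
Proof.
apply: cV_matrix_ext => y; rewrite mulmxDl -scalemxAl !lieactE -rep_vec_lin.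
apply: eq_rep_vec => b; rewrite /fam_act mulmxDl mulmxDr -scalemxAl -scalemxAr.
by rewrite scalerBr opprD addrACA.
Qed.

Lemma lieact_scal c : lieact (@fam_scal K P c) = 0.
Proof.
apply: cV_matrix_ext => y; rewrite mul0mx; apply/lieact_eq0 => a.
by rewrite /fam_act /fam_scal mul_scalar_mx mul_mx_scalar subrr.
Qed.

Variable i0 : vertex P.
Hypothesis d_i0 : (0 < dvec i0)%N.
Variables (N1 : nat) (e1 : 'I_N1 -> vertex P * nat * nat).
Hypothesis e1P : enumerates e1 (fun z => [&& (z.1.2 < dvec z.1.1)%N,
  (z.2 < dvec z.1.1)%N & z != (i0, 0%N, 0%N)]).

(** A linear model of the Lie algebra of [PGL(Q,d)]: families whose corner entry at [i0] is 0. *)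
Definition slice (c : 'cV[K]_N1) : GLf :=
  fun i => \matrix_(u, v) extend e1 (c^~ 0) (i, nat_of_ord u, nat_of_ord v).

Definition base_entry (B : GLf) : K := mx_entries (B i0) 0 0.

Lemma slice_lin a b c i : slice (a *: b + c) i = a *: slice b i + slice c i.
Proof.
by apply/matrixP => u v; rewrite !mxE -extend_lin; apply: eq_extend => l; rewrite !mxE.
Qed.

Lemma base_entryE (B : GLf) : base_entry B = B i0 (Ordinal d_i0) (Ordinal d_i0).
Proof. exact: (mx_entriesE (B i0) (Ordinal d_i0) (Ordinal d_i0)). Qed.

Lemma slice_base c : base_entry (slice c) = 0.
Proof.
rewrite base_entryE mxE; apply: extend_off => l; apply/negP => /eqP e.
have [_ ce] := e1P; have /ce := ex_intro (fun i => e1 i = (i0, 0%N, 0%N)) l e.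
by rewrite eqxx !andbF.
Qed.

Lemma slice_onto (B : GLf) : exists c, forall i, B i = slice c i + (base_entry B)%:M.
Proof.
pose c : 'cV[K]_N1 := \col_l (mx_entries (B (e1 l).1.1) (e1 l).1.2 (e1 l).2
   - base_entry B * ((e1 l).1.2 == (e1 l).2)%:R).
exists c => i; apply/matrixP => u v; rewrite !mxE.
have [ie ce] := e1P; have [e|ne] := eqVneq (i, nat_of_ord u, nat_of_ord v) (i0, 0%N, 0%N).
  have := slice_base c; rewrite base_entryE mxE /= e => ->; rewrite add0r.
  case: e => e; subst i => eu ev; rewrite /base_entry.
  have -> : u == v by apply/eqP/val_inj; rewrite /= eu ev.
  by rewrite mulr1n -(mx_entriesE (B i0)) eu ev.
have /ce[l el] : [&& ((i, nat_of_ord u, nat_of_ord v).1.2 < dvec (i, nat_of_ord u, nat_of_ord v).1.1)%N,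
    ((i, nat_of_ord u, nat_of_ord v).2 < dvec (i, nat_of_ord u, nat_of_ord v).1.1)%N &
    (i, nat_of_ord u, nat_of_ord v) != (i0, 0%N, 0%N)] by rewrite /= !ltn_ord.
rewrite -el extend_on // mxE el /= mx_entriesE mulr_natr.
by rewrite -[X in _ = _ - _ + X]/((base_entry B) *+ (u == v)) subrK.
Qed.

Lemma slice_scalar c x : (forall i, slice c i = x%:M) -> c = 0.
Proof.
move=> h; have x0 : x = 0.
  by have := slice_base c; rewrite base_entryE h mxE eqxx mulr1n.
apply/colP => l; rewrite mxE; have [ie ce] := e1P.
have /ce/and3P[] := ex_intro (fun i => e1 i = e1 l) l erefl.
rewrite -(extend_on (c^~ 0) l ie); case: (e1 l) => [[i u] v] /= hu hv _.
have /matrixP/(_ (Ordinal hu) (Ordinal hv)) := h i; rewrite !mxE /= => ->.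
by rewrite x0 mul0rn.
Qed.

Definition slice_act (y : 'cV[K]_n) : 'M[K]_(n, N1) := colmx (fun c => lieact (slice c) *m y).

Lemma slice_actE y c : slice_act y *m c = lieact (slice c) *m y.
Proof.
rewrite /slice_act mul_colmx // => a u v; rewrite scalemxAl -mulmxDl -lieact_lin.
congr (lieact _ *m _); apply: boolp.functional_extensionality_dep => i; exact: slice_lin.
Qed.

Lemma lieact_slice (B : GLf) : exists c, lieact B = lieact (slice c).
Proof.
have [c hc] := slice_onto B; exists c.
have -> : B = (fun i => 1 *: slice c i + @fam_scal K P (base_entry B) i).
  by apply: boolp.functional_extensionality_dep => i; rewrite hc scale1r.
by rewrite lieact_lin lieact_scal scale1r addr0.
Qed.

Lemma lie_brickP y : lie_brick y <-> forall c : 'cV_N1, slice_act y *m c = 0 -> c = 0.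
Proof.
split=> [br c|h B hB].
  by rewrite slice_actE => /br[x hx]; exact: slice_scalar hx.
have [c hc] := slice_onto B; exists (base_entry B) => i.
have c0 : c = 0.
  apply: h; rewrite slice_actE -hB; congr (_ *m _).
  have -> : B = (fun i => 1 *: slice c i + @fam_scal K P (base_entry B) i).
    by apply: boolp.functional_extensionality_dep => j; rewrite hc scale1r.
  by rewrite lieact_lin lieact_scal scale1r addr0.
rewrite hc c0 (_ : slice 0 i = 0) ?add0r //; apply/matrixP => u v; rewrite !mxE.
by rewrite /extend big1 // => l _; rewrite mxE mul0r.
Qed.

Lemma lie_surjectiveP y : lie_surjective y <-> forall e : 'cV_n, exists c : 'cV_N1, slice_act y *m c = e.
Proof.
split=> h e.
  have [B <-] := h e; have [c ->] := lieact_slice B; exists c; exact: slice_actE.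
by have [c <-] := h e; exists (slice c); rewrite slice_actE.
Qed.

End Slice.

(** * Injectivity and dimension counts *)

Section Counting.
Variable K : numFieldType.

Lemma col_inj_rank m s (Q : 'M[K]_(m, s)) :
  (forall c : 'cV_s, Q *m c = 0 -> c = 0) -> \rank Q = s.
Proof.
move=> h; have ck : cokermx Q = 0.
  apply: cV_matrix_ext => v; rewrite mul0mx; apply: h.
  by rewrite mulmxA mulmx_coker mul0mx.
have := mxrank_coker Q; rewrite ck mxrank0 => e.
by apply/eqP; rewrite eqn_leq rank_leq_col -subn_eq0 -e.
Qed.

Lemma unit_of_col_inj s (Q : 'M[K]_s) :
  (forall c : 'cV_s, Q *m c = 0 -> c = 0) -> Q \in unitmx.
Proof. by move=> /col_inj_rank e; rewrite -row_full_unit /row_full e. Qed.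

Lemma msizeM_leq s (p q : {mpoly K[s]}) : (msize (p * q) <= (msize p + msize q).-1)%N.
Proof.
have [->|p0] := eqVneq p 0; first by rewrite mul0r msize0.
have [->|q0] := eqVneq q 0; first by rewrite mulr0 msize0.
by rewrite msizeM.
Qed.

Lemma msize_prod_le s I (r : seq I) (p : I -> {mpoly K[s]}) (k : I -> nat) :
  (forall i, msize (p i) <= (k i).+1)%N -> (msize (\prod_(i <- r) p i) <= (\sum_(i <- r) k i).+1)%N.
Proof.
move=> h; elim: r => [|i r IH]; first by rewrite !big_nil msize1.
rewrite !big_cons; apply: leq_trans (msizeM_leq _ _) _.
by have := h i; lia.
Qed.

Lemma msize_exp_le s (p : {mpoly K[s]}) k m :
  (msize p <= k.+1)%N -> (msize (p ^+ m) <= (m * k).+1)%N.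
Proof.
move=> h; have := @msize_prod_le s 'I_m (index_enum 'I_m) (fun=> p) (fun=> k) (fun=> h).
by rewrite prodr_const sum_nat_const card_ord.
Qed.

(* The monomials of exponents below [D] in the components number [D ^ n],
   while after clearing denominators they live in a space of dimension
   [O(D ^ s)]; hence they are linearly dependent when [s < n]. *)
Lemma regular_dependent s n (dl : 'cV[K]_s -> K) (h : 'cV[K]_s -> 'cV[K]_n) :
  pf dl -> (forall i, regular dl (fun c => h c i 0)) -> (s < n)%N ->
  exists2 F : {mpoly K[n]}, F != 0 & forall c, dl c != 0 -> peval F (h c) = 0.
Proof.
move=> pdl rh lt.
have /boolp.choice[eg heg] : forall i, exists eg : nat * {mpoly K[s]},
    forall c, dl c != 0 -> peval eg.2 c = dl c ^+ eg.1 * h c i 0.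
  move=> i; have [e [g [pg hg]]] := rh i; have [q hq] := pf_mpoly pg.
  by exists (e, q) => c dc; rewrite -hq hg.
have [dq hdq] := pf_mpoly pdl.
pose E := (\sum_i (eg i).1)%N.
pose p i : {mpoly K[s]} := (eg i).2 * dq ^+ (E - (eg i).1).
pose q : {mpoly K[s]} := dq ^+ E.
have hp i c : dl c != 0 -> peval (p i) c = peval q c * h c i 0.
  move=> dc; rewrite /p /q /peval mevalM !rmorphXn /= -!/(peval _ _) heg // -hdq.
  have -> : E = ((eg i).1 + (E - (eg i).1))%N.
    by rewrite subnKC // /E (bigD1 i) //= leq_addr.
  by rewrite addKn exprD; ring.
pose S := (msize q + \sum_i msize (p i)).+1.
have hS i : (msize (p i) <= S.+1)%N by rewrite /S (bigD1 i) //=; lia.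
have hq : (msize q <= S.+1)%N by rewrite /S; lia.
(* This value gives [D ^ n >= D ^ (s + 1) > ((n S + 1) D) ^ s], and the last number bounds the
   monomials that the [pb] can involve. *)
pose D := ((n * S).+1 ^ s).+1.
(* The powers of [q] equalise denominators: whatever [b] is, the value is [q ^ (n D)] times the
   monomial [b] in the components of [h]. *)
pose pb (b : {ffun 'I_n -> 'I_D}) : {mpoly K[s]} := \prod_i (p i ^+ b i * q ^+ (D - b i)).
have size_pb b : (msize (pb b) <= (n * S * D).+1)%N.
  apply: leq_trans (msize_prod_le (k := fun=> (D * S)%N) _ _) _ => [i|].
    apply: leq_trans (msizeM_leq _ _) _.
    have h1 := msize_exp_le (b i) (hS i); have h2 := msize_exp_le (D - b i) hq.
    have e : ((b i * S) + (D - b i) * S = D * S)%N.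
      by rewrite -mulnDl subnKC // ltnW.
    lia.
  by rewrite sum_nat_const card_ord -mulnA [(S * D)%N]mulnC.
have card_lt : (((n * S * D).+1) ^ s < #|{ffun 'I_n -> 'I_D}|)%N.
  rewrite card_ffun !card_ord.
  have h1 : ((n * S * D).+1 <= (n * S).+1 * D)%N by rewrite mulSn /D; lia.
  apply: (@leq_ltn_trans (((n * S).+1 * D) ^ s)).
    by case: (posnP s) => [->|s0]; rewrite ?expn0 // leq_exp2r.
  apply: (@leq_trans (D ^ s.+1)); last by rewrite leq_pexp2l.
  by rewrite expnMn expnS ltn_mul2r expn_gt0 ltnSn.
have [|c [[b0 cb0] cE]] := mpoly_dependent (p := fun i => pb (enum_val i)) _ card_lt.
  by move=> i; exact: size_pb.
pose mon (b : {ffun 'I_n -> 'I_D}) : 'X_{1..n} := [multinom b i : nat | i < n].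
have mon_inj : injective mon.
  move=> b b' /mnmP e; apply/ffunP => i; apply/val_inj.
  by have := e i; rewrite !mnmE.
exists (\sum_i c i *: 'X_[mon (enum_val i)]).
  apply: contraNneq cb0 => /(congr1 (mcoeff (mon (enum_val b0)))).
  rewrite raddf_sum mcoeff0 (bigD1 b0) //= big1 => [|j nj].
    by rewrite mcoeffZ mcoeffX eqxx mulr1 addr0 => ->.
  by rewrite mcoeffZ mcoeffX (inj_eq mon_inj) (inj_eq enum_val_inj) (negbTE nj) mulr0.
move=> x dx; have q0 : peval q x != 0 by rewrite /q /peval rmorphXn /= -/(peval _ _) -hdq expf_neq0.
apply: (mulfI (expf_neq0 (n * D) q0)); rewrite mulr0.
have <- : peval (\sum_i c i *: pb (enum_val i)) x = 0 by rewrite cE /peval meval0.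
rewrite /peval !raddf_sum mulr_sumr; apply: eq_bigr => i _ /=.
rewrite !mevalZ mulrCA; congr (_ * _); rewrite mevalX rmorph_prod /=.
have -> : q.@[fun j => x j 0] ^+ (n * D) = \prod_(j < n) q.@[fun j => x j 0] ^+ D.
  by rewrite prodr_const card_ord -exprM mulnC.
rewrite -big_split /=; apply: eq_bigr => j _.
have ev (u : {mpoly K[s]}) m : (u ^+ m).@[x^~ 0] = peval u x ^+ m.
  by rewrite /peval rmorphXn.
rewrite mevalM !ev hp // exprMn mnmE -/(peval q x).
have <- : peval q x = peval dq x ^+ E by exact: ev.
have -> : peval q x ^+ D = peval q x ^+ enum_val i j * peval q x ^+ (D - enum_val i j).
  by rewrite -exprD subnKC // ltnW.
exact: mulrAC.
Qed.

End Counting.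

(** * From linear free divisors to bricks *)

Section FreeBasis.
Variable K : numClosedFieldType.
Hypothesis uncK : uncountable_type K.

Lemma mradical_vanish n (f g : {mpoly K[n]}) : mradical f ->
  (forall x, peval f x = 0 -> peval g x = 0) -> pdivides f g.
Proof. by move=> rf /(nullstellensatz uncK)[m /rf]. Qed.

Lemma peval_det n m (M : 'M[{mpoly K[n]}]_m) v :
  peval (\det M) v = \det (\matrix_(i, j) peval (M i j) v).
Proof.
rewrite /peval -det_map_mx; congr (\det _); by apply/matrixP => i j; rewrite !mxE.
Qed.

Lemma peval_linear_vf n (A : 'M[K]_n) i y : peval (linear_vf A i 0) y = (A *m y) i 0.
Proof.
rewrite /peval !mxE raddf_sum; apply: eq_bigr => j _ /=.
by rewrite mevalZ mevalXU.
Qed.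

Lemma peval_scale_vf n p (A : 'M[K]_n) i y :
  peval ((p *: linear_vf A) i 0) y = peval p y * (A *m y) i 0.
Proof. by rewrite -peval_linear_vf mxE /peval mevalM. Qed.

Lemma peval_vf_apply n (A : 'M[K]_n) f y :
  peval (vf_apply (linear_vf A) f) y = \sum_i (A *m y) i 0 * peval f^`M(i) y.
Proof.
rewrite /vf_apply /peval raddf_sum; apply: eq_bigr => i _ /=.
by rewrite mevalM -!/(peval _ _) peval_linear_vf.
Qed.

Lemma stable_logarithmic (P : dquiver) (f : {mpoly K[rep_dim P]}) B : mradical f ->
  orbit_stable (P := P) (fun y => peval f y = 0) -> logarithmic f (linear_vf (lieact (P := P) B)).
Proof.
move=> rf st; apply: mradical_vanish => // y fy; rewrite peval_vf_apply.
exact: (vanishing_lie_derivative B st).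
Qed.

Section Basis.
Variables (n m : nat) (f : {mpoly K[n]}) (A : 'I_m -> 'M[K]_n).
Hypothesis logA : forall l, logarithmic f (linear_vf (A l)).
Hypothesis freeA : forall delta, logarithmic f delta ->
  exists! c : 'rV[{mpoly K[n]}]_m, delta = \sum_l c 0 l *: linear_vf (A l).

Lemma log0 : logarithmic f 0.
Proof. by exists 0; rewrite mul0r /vf_apply big1 // => i _; rewrite mxE mul0r. Qed.

Lemma free_zero (c : 'rV[{mpoly K[n]}]_m) :
  \sum_l c 0 l *: linear_vf (A l) = 0 -> c = 0.
Proof.
move=> h; have [c0 [e0 u]] := freeA log0.
have <- : c0 = c by apply: u.
by apply: u; rewrite big1 // => l _; rewrite mxE scale0r.
Qed.

(** The coefficients are a priori polynomials. Along a ray [t y] both sides are divisible by [t],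
    and the quotient at [t = 0] retains only their values at the origin. *)
Lemma log_linear_span (B : 'M[K]_n) : logarithmic f (linear_vf B) ->
  exists a : 'I_m -> K, B = \sum_l a l *: A l.
Proof.
move=> /freeA[c [ec _]]; exists (fun l => peval (c 0 l) 0).
apply: cV_matrix_ext => y; apply/colP => i.
have ev z : (B *m z) i 0 = \sum_l peval (c 0 l) z * (A l *m z) i 0.
  rewrite -peval_linear_vf ec summxE /peval raddf_sum; apply: eq_bigr => l _ /=.
  exact: peval_scale_vf.
have pfc l : pf (fun t : K^o => peval (c 0 l) (t *: y)).
  apply: (@pf_comp _ _ _ (fun t : K^o => t *: y)); last exact: pf_peval.
  by apply: polymap_lin => u v w; rewrite scalerDl scalerA.
have pR : pf (fun t : K^o => \sum_l peval (c 0 l) (t *: y) * (A l *m y) i 0).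
  by apply: pf_sum => l; apply: pf_mul => //; exact: pf_const.
have id_pf : pf (fun t : K^o => t) by exact: pf_linform.
have := @pf_cancel K _ (fun t : K^o => t) (fun=> (B *m y) i 0) _ id_pf (pf_const _ _) pR.
move=> h; have -> := h _ _ 0.
- rewrite mulmx_suml summxE; apply: eq_bigr => l _.
  by rewrite scale0r -scalemxAl [RHS]mxE.
- by exists 1; exact: oner_neq0.
move=> t t0; have := ev (t *: y); rewrite -scalemxAr mxE => e.
apply: (mulfI t0); rewrite e mulr_sumr; apply: eq_bigr => l _.
by rewrite -scalemxAr [X in _ * X]mxE mulrCA.
Qed.

Lemma log_scale (e : 'cV[K]_n) : logarithmic f (\col_i ((e i 0)%:MP * f)).
Proof.
exists (\sum_i (e i 0)%:MP * f^`M(i)); rewrite /vf_apply mulr_suml.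
by apply: eq_bigr => i _; rewrite mxE; ring.
Qed.

(** The fields [f] times a constant vector are logarithmic, and off the divisor the factor [f] can
    be divided out. *)
Lemma free_span_at v (e : 'cV[K]_n) : peval f v != 0 ->
  exists a : 'I_m -> K, e = \sum_l a l *: (A l *m v).
Proof.
move=> fv; have [c [ec _]] := freeA (log_scale e).
exists (fun l => (peval f v)^-1 * peval (c 0 l) v); apply/colP => i.
have /colP/(_ i)/(congr1 (fun p => peval p v)) := ec.
rewrite mxE summxE /peval mevalM mevalC raddf_sum -/(peval f v) => h.
rewrite -[LHS](mulfK fv) h mulrC mulr_sumr summxE; apply: eq_bigr => l _ /=.
by rewrite -/(peval _ _) peval_scale_vf [RHS]mxE mulrA.
Qed.

(** Some [n] of the fields span the tangent space at a point off the divisor. Cramer's rule would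
    express any further field through them, times their nonzero determinant, against freeness. *)
Lemma free_size_le : f != 0 -> (m <= n)%N.
Proof.
move=> fn0; have [v fv] : exists v, peval f v != 0.
  apply: boolp.contrapT => h; move/negP: fn0; apply; apply/eqP/peval_eq0 => x.
  by apply/eqP/negP => /negP fx; apply: h; exists x.
pose M0 : 'M[K]_(m, n) := \matrix_(l, i) (A l *m v) i 0.
have full : row_full M0.
  rewrite -sub1mx; apply/row_subP => i.
  have [a ea] := free_span_at ((row i 1%:M)^T) fv.
  have -> : row i 1%:M = (\row_l a l) *m M0.
    apply: trmx_inj; rewrite ea; apply/colP => j; rewrite !mxE summxE.
    by apply: eq_bigr => l _; rewrite !mxE.
  exact: submxMl.
pose g := fullrankfun full.
rewrite leqNgt; apply/negP => lt.
have [l0 hl0] : exists l0, forall j, g j != l0.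
  apply: boolp.contrapT => no; move: lt; rewrite ltnNge => /negP; apply.
  have gs : forall l, exists j, g j = l.
    move=> l; apply: boolp.contrapT => h; apply: no; exists l => j.
    by apply/eqP => e; apply: h; exists j.
  have [k hk] := boolp.choice gs.
  have ik : injective k by move=> x y e; rewrite -(hk x) e hk.
  by have := leq_card k ik; rewrite !card_ord.
pose M : 'M[{mpoly K[n]}]_n := \matrix_(i, j) linear_vf (A (g j)) i 0.
pose w := \adj M *m linear_vf (A l0).
pose c : 'rV[{mpoly K[n]}]_m := \row_l if l == l0 then - \det M else \sum_(j | g j == l) w j 0.
have c0 : c = 0.
  apply: free_zero; rewrite (bigD1 l0) //= mxE eqxx.
  have -> : \sum_(l | l != l0) c 0 l *: linear_vf (A l) = \sum_j w j 0 *: linear_vf (A (g j)).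
    rewrite (partition_big g (fun l => l != l0)) //=; apply: eq_bigr => l nl.
    rewrite mxE (negbTE nl) scaler_suml; apply: eq_bigr => j /eqP ->; by [].
  have -> : \sum_j w j 0 *: linear_vf (A (g j)) = M *m w.
    apply/colP => i; rewrite mxE summxE; apply: eq_bigr => j _.
    by rewrite mxE [M i j]mxE mulrC.
  by rewrite /w mulmxA mul_mx_adj mul_scalar_mx scaleNr addNr.
move/rowP/(_ l0): c0; rewrite !mxE eqxx => /eqP; rewrite oppr_eq0 => /eqP /(congr1 (fun p => peval p v)).
rewrite peval_det /peval meval0 => /eqP; apply/negP.
have -> : \matrix_(i, j) peval (M i j) v = (rowsub g M0)^T.
  by apply/matrixP => i j; rewrite mxE [M i j]mxE peval_linear_vf !mxE.
by rewrite det_tr -unitfE -unitmxE fullrowsub_unit.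
Qed.

End Basis.

Definition field_mx n (A : 'I_n -> 'M[K]_n) : 'M[{mpoly K[n]}]_n :=
  \matrix_(i, l) linear_vf (A l) i 0.

(* Saito's criterion: [f] divides [Delta = h * f]; the fields [f d_i] give
   [h | f ^ n] and the Koszul fields [d_i f d_j - d_j f d_i] give
   [h | (d_i f) ^ (n - 1)], so [h] is invertible. *)
Lemma saito_unit n (f : {mpoly K[n]}) (A : 'I_n -> 'M[K]_n) :
  f != 0 -> mradical f ->
  (forall l, logarithmic f (linear_vf (A l))) ->
  (forall delta, logarithmic f delta ->
    exists! c : 'rV[{mpoly K[n]}]_n, delta = \sum_l c 0 l *: linear_vf (A l)) ->
  (forall x, peval f x = 0 -> peval (\det (field_mx A)) x = 0) ->
  exists h k, \det (field_mx A) = h * f /\ k * h = 1.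
Proof.
move=> f0 rf logA freeA van; have [h eh] := mradical_vanish rf van.
have comb (E : 'M[{mpoly K[n]}]_n) : (forall j, logarithmic f (col j E)) ->
    exists C, E = field_mx A *m C.
  move=> hE; have [c hc] := boolp.choice (fun j => freeA _ (hE j)).
  exists (\matrix_(l, j) c j 0 l); apply/matrixP => i j.
  have [/colP/(_ i) e _] := hc j; move: e; rewrite mxE => ->.
  rewrite summxE mxE; apply: eq_bigr => l _.
  by rewrite [field_mx A i l]mxE [X in _ = _ * X]mxE mulrC !mxE.
have [|C eC] := comb f%:M.
  move=> j; have -> : col j f%:M = \col_i (((delta_mx j 0 : 'cV[K]_n) i 0)%:MP * f).
    apply/colP => i; rewrite !mxE eqxx andbT.
    by case: (i == j); rewrite ?mpolyC1 ?mul1r ?mpolyC0 ?mul0r.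
  exact: log_scale.
have hfn : f ^+ n = h * f * \det C by rewrite -det_scalar eC det_mulmx eh.
have hd (i : 'I_n) : exists k, f^`M(i) ^+ n.-1 = k * h.
  (* Column [i] is the field [f d_i] and the others are Koszul fields, so expanding along column [i]
     gives [f * (d_i f) ^ (n - 1)]. *)
  pose E : 'M[{mpoly K[n]}]_n := \matrix_(a, j)
    if j == i then (if a == i then f else 0)
    else (if a == j then f^`M(i) else 0) - (if a == i then f^`M(j) else 0).
  have [|C' eC'] := comb E.
    move=> j; have [->|nj] := eqVneq j i.
      exists f^`M(i); rewrite /vf_apply (bigD1 i) //= big1 ?addr0 => [|a na].
        by rewrite !mxE !eqxx mulrC.
      by rewrite !mxE eqxx (negbTE na) mul0r.
    exists 0; rewrite mul0r /vf_apply.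
    under eq_bigr do rewrite !mxE (negbTE nj) mulrBl.
    rewrite sumrB (bigD1 j) //= eqxx big1 ?addr0 => [|a na]; last by rewrite (negbTE na) mul0r.
    rewrite [X in _ - X](bigD1 i) //= eqxx big1 ?addr0 => [|a na]; last by rewrite (negbTE na) mul0r.
    by rewrite mulrC subrr.
  have dE : \det E = f * f^`M(i) ^+ n.-1.
    rewrite (expand_det_col _ i) (bigD1 i) //= big1 ?addr0 => [|a na]; last first.
      by rewrite mxE eqxx (negbTE na) mul0r.
    rewrite mxE !eqxx; congr (_ * _); rewrite /cofactor.
    have -> : row' i (col' i E) = (f^`M(i))%:M.
      apply/matrixP => a b; rewrite !mxE eq_sym (negbTE (neq_lift i b)).
      rewrite [lift i a == i]eq_sym (negbTE (neq_lift i a)) subr0 (inj_eq (@lift_inj _ i)).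
      by case: (a == b).
    by rewrite det_scalar -signr_odd oddD addbb expr0 mul1r.
  exists (\det C'); apply: (mulfI f0).
  by rewrite -dE eC' det_mulmx eh; ring.
(* As [h] divides powers of all the [d_i f], [f] divides powers of [g * d_i f], hence these products
   themselves, and the Jacobian criterion applies. It remains to strip the factors [f] one by one
   from [f ^ m = k * h]. *)
have cop g : pdivides f (g * h) -> pdivides f g.
  move=> fg; apply: (radical_jacobian f0 rf) => i; apply: (rf _ n.-1.+1).
  have [k ek] := hd i; rewrite exprMn (exprS f^`M(i)) ek exprS.
  have -> : g * g ^+ n.-1 * (f^`M(i) * (k * h)) = (g ^+ n.-1 * f^`M(i) * k) * (g * h) by ring.
  exact: pdividesM.
have unit_of m : (exists k, f ^+ m = k * h) -> exists k, 1 = k * h.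
  elim: m => [|m IH]; first by rewrite expr0.
  move=> [k ek]; apply: IH; have [|k1 ek1] := cop k.
    by rewrite -ek exprS mulrC; exists (f ^+ m).
  by exists k1; apply: (mulfI f0); rewrite -exprS ek ek1; ring.
have [|k ek] := unit_of n; last by exists h, k.
by exists (f * \det C); rewrite hfn; ring.
Qed.

End FreeBasis.

(** * Quiver linear free divisors are good *)

Section LfdAnalysis.
Variable K : numClosedFieldType.
Hypothesis uncK : uncountable_type K.

Section Quiver.
Variable P : dquiver.
Notation n := (rep_dim P).

Lemma slice_enum (i0 : vertex P) : (0 < dvec i0)%N ->
  exists N1 (e1 : 'I_N1 -> vertex P * nat * nat),
    enumerates e1 (fun z => [&& (z.1.2 < dvec z.1.1)%N, (z.2 < dvec z.1.1)%N &
      z != (i0, 0%N, 0%N)]) /\ (\sum_(i : vertex P) dvec i * dvec i = N1.+1)%N.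
Proof.
move=> d0; have [e he] := enumerates_sigma (fun i : vertex P => dvec i) (fun i : vertex P => dvec i).
case E : (\sum_(i : vertex P) dvec i * dvec i)%N => [|N1].
  by move: E; rewrite (bigD1 i0) //=; nia.
rewrite E in e he; have [|e1 h1] := enumerates_remove (x0 := (i0, 0%N, 0%N)) he.
  by rewrite /= d0.
by exists N1, e1; split=> //; apply: enumerates_eq h1 => z; rewrite andbA.
Qed.

Lemma exists_generic (X : lmodType K) (f g : X -> K) : pf f -> pf g ->
  (exists x, f x != 0) -> (exists x, g x != 0) -> exists x, f x != 0 /\ g x != 0.
Proof.
move=> pF pG fx gx; have [x] := pf_mul_neq0 pF pG fx gx.
by rewrite mulf_eq0 negb_or => /andP[]; exists x.
Qed.

Lemma pf_line_fam (B C : GLfamily K P) :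
  pf (fun t : K^o => fam_det (fun i => B i + t *: C i)).
Proof.
apply: (@pf_fam_det K P _ (fun t : K^o => (fun i => B i + t *: C i) : GLfamily K P)) => i u v.
apply: (@pf_ext _ _ (fun t : K^o => B i u v + t * C i u v)).
  by move=> t; rewrite !mxE.
apply: pf_add; first exact: pf_const.
by apply: pf_mul; [exact: pf_linform|exact: pf_const].
Qed.

(** For generic [t] the family [1 + t B] is invertible and acts trivially, so group faithfulness
    applies to it. *)
Lemma faithful_lie (B : GLfamily K P) : PGL_faithful K P -> lieact B = 0 ->
  exists c, forall i, B i = c%:M.
Proof.
move=> faith B0; pose g (t : K^o) : GLfamily K P := fun i => 1%:M + t *: B i.
have [||||t [t0 dt]] := @exists_generic K^o (fun t => t) (fun t => fam_det (g t)).
- exact: pf_linform.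
- exact: pf_line_fam.
- by exists 1; exact: oner_neq0.
- exists 0; rewrite /fam_det big1 ?oner_neq0 // => i _.
  by rewrite /g scale0r addr0 det1.
have hg : in_GL (g t) by apply/in_GLP.
have [|c hc] := faith (g t) hg.
  move=> x; apply: eq_rep_vec => a; rewrite /rep_act.
  have /lieact_eq0/(_ a) : lieact B *m rep_vec x = 0 by rewrite B0 mul0mx.
  rewrite /fam_act rep_vecK => /eqP; rewrite subr_eq0 => /eqP e.
  rewrite -[RHS](mulmxK (hg (src a))); congr (_ *m _).
  by rewrite /g mulmxDl mulmxDr mul1mx mulmx1 -scalemxAl -scalemxAr e.
exists ((c - 1) / t) => i; have := hc i; rewrite /g => e.
apply: (scalerI t0); rewrite scale_scalar_mx mulrC divfK // raddfB /= -e.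
by rewrite addrC addKr.
Qed.

Section Base.
Variables (i0 : vertex P) (d_i0 : (0 < dvec i0)%N).
Variables (N1 : nat) (e1 : 'I_N1 -> vertex P * nat * nat).
Hypothesis e1P : enumerates e1 (fun z => [&& (z.1.2 < dvec z.1.1)%N,
  (z.2 < dvec z.1.1)%N & z != (i0, 0%N, 0%N)]).

Lemma grpact_scale c (g : GLfamily K P) : c != 0 -> in_GL g ->
  grpact (fun i => c *: g i) = grpact g.
Proof.
move=> c0 hg; have -> : (fun i => c *: g i) = fam_mul (@fam_scal K P c) g.
  by apply: boolp.functional_extensionality_dep => i; rewrite /fam_mul /fam_scal mul_scalar_mx.
rewrite grpact_mul //; last exact: in_GL_scal.
by rewrite grpact_scal // mul1mx.
Qed.

(** If the group modulo scalars had fewer parameters than the space has coordinates, a nonzero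
    polynomial would vanish on the whole orbit, which contains a nonempty open set. *)
Lemma dominant_count (v0 : 'cV[K]_n) (f : {mpoly K[n]}) : f != 0 ->
  (forall y, peval f y != 0 -> gl_orbit v0 y) -> (n <= N1)%N.
Proof.
move=> f0 orb; rewrite leqNgt; apply/negP => lt.
(* The affine chart of [PGL] where the corner entry at [i0] is normalised to 1. *)
pose g (c : 'cV[K]_N1) : GLfamily K P := fun i => slice e1 c i +
  \matrix_(u, v) ((i, nat_of_ord u, nat_of_ord v) == (i0, 0%N, 0%N))%:R.
have pfg i u v : pf (fun c => g c i u v).
  apply: (@pf_ext _ _ (fun c : 'cV[K]_N1 => slice e1 c i u v +
     ((i, nat_of_ord u, nat_of_ord v) == (i0, 0%N, 0%N))%:R)).
    by move=> c; rewrite [RHS]mxE [X in _ = _ + X]mxE.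
  apply: pf_add; last exact: pf_const.
  by apply: pf_linform => a b c; rewrite slice_lin !mxE.
have pdl := pf_fam_det pfg.
have rh i : regular (fun c => fam_det (g c)) (fun c => (grpact (g c) *m v0) i 0).
  apply: (@regular_ext _ _ _ (fun c => \sum_j grpact (g c) i j * v0 j 0)).
    by move=> c _; rewrite [RHS]mxE.
  apply: (regular_sum pdl) => j; apply: regular_mul; first exact: regular_grpact.
  by apply: regular_pf; exact: pf_const.
have [F F0 hF] := regular_dependent pdl rh lt.
have step1 (h : GLfamily K P) : in_GL h -> base_entry i0 h != 0 ->
    peval F (grpact h *m v0) = 0.
  move=> hh b0; pose h' : GLfamily K P := fun i => (base_entry i0 h)^-1 *: h i.
  pose c : 'cV[K]_N1 := \col_l mx_entries (h' (e1 l).1.1) (e1 l).1.2 (e1 l).2.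
  have gE : h' = g c.
    apply: boolp.functional_extensionality_dep => i; apply/matrixP => u v.
    rewrite [RHS]mxE [X in _ = _ + X]mxE [slice e1 c i u v]mxE; have [ie ce] := e1P.
    have [e|ne] := eqVneq (i, nat_of_ord u, nat_of_ord v) (i0, 0%N, 0%N).
      have z : extend e1 (c^~ 0) (i, nat_of_ord u, nat_of_ord v) = 0.
        apply: extend_off => l; apply/negP => /eqP el.
        have /ce := ex_intro (fun i => e1 i = _) l el.
        by rewrite e eqxx !andbF.
      rewrite z add0r; case: e z => e eu ev _; subst i.
      rewrite -(mx_entriesE (h' i0)) eu ev /h' /base_entry.
      rewrite (mx_entriesE _ (Ordinal d_i0) (Ordinal d_i0)) mxE -base_entryE mulVf //.
    rewrite addr0; have /ce[l el] : [&& ((i, nat_of_ord u, nat_of_ord v).1.2 < dvec (i, nat_of_ord u, nat_of_ord v).1.1)%N,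
      ((i, nat_of_ord u, nat_of_ord v).2 < dvec (i, nat_of_ord u, nat_of_ord v).1.1)%N &
      (i, nat_of_ord u, nat_of_ord v) != (i0, 0%N, 0%N)] by rewrite /= !ltn_ord.
    by rewrite -el extend_on // [c l 0]mxE el /= mx_entriesE.
  have b0' : (base_entry i0 h)^-1 != 0 by rewrite invr_eq0.
  rewrite -(grpact_scale b0' hh) -/h' gE; apply: hF; rewrite -gE; apply/in_GLP => i.
  by rewrite unitmxZ ?unitfE.
(* Group elements with corner entry 0 lie outside the chart; they are reached along the line
   [h + t 1], whose generic members lie in it after rescaling. *)
have step2 y : gl_orbit v0 y -> peval F y = 0.
  move=> [h hh ->]; pose ht (t : K^o) : GLfamily K P := fun i => h i + t *: 1%:M.
  have pfh i u v : pf (fun t => ht t i u v).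
    apply: (@pf_ext _ _ (fun t : K^o => h i u v + t * (1%:M : 'M[K]_(dvec i)) u v)).
      by move=> t; rewrite !mxE.
    apply: pf_add; first exact: pf_const.
    by apply: pf_mul; [exact: pf_linform|exact: pf_const].
  have pdh := pf_fam_det pfh.
  have rF : regular (fun t => fam_det (ht t)) (fun t => peval F (grpact (ht t) *m v0)).
    apply: (regular_comp pdh (h := fun t => grpact (ht t) *m v0)); last exact: pf_peval.
    apply: (rmap_mx pdh) => i j; rewrite ord1.
    apply: (@regular_ext _ _ _ (fun t => \sum_k grpact (ht t) i k * v0 k 0)).
      by move=> t _; rewrite [RHS]mxE.
    apply: (regular_sum pdh) => k; apply: regular_mul; first exact: regular_grpact.
    by apply: regular_pf; exact: pf_const.
  have h0 : ht 0 = h.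
    by apply: boolp.functional_extensionality_dep => i; rewrite /ht scale0r addr0.
  have := @regular_eq0 K _ _ pdh _ (fun t => base_entry i0 (ht t)) rF.
  move=> E; have := E _ _ _ 0; rewrite h0; apply.
  - apply: (@pf_ext _ _ (fun t => ht t i0 (Ordinal d_i0) (Ordinal d_i0))) => // t.
    by rewrite -base_entryE.
  - exists (1 - base_entry i0 h); rewrite base_entryE !mxE -base_entryE eqxx /=.
    by rewrite mulr1 addrC subrK oner_neq0.
  - by move=> t /in_GLP dt bt; exact: step1.
  - exact/in_GLP.
have z : f * F = 0.
  apply: peval_eq0 => y; rewrite /peval mevalM -!/(peval _ _).
  by have [->|/orb/step2 ->] := eqVneq (peval f y) 0; rewrite ?mul0r ?mulr0.
by move/eqP: z; rewrite mulf_eq0 (negbTE f0) (negbTE F0).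
Qed.

End Base.

(** Faithfulness gives [N1 <= m], freeness [m <= n], and the open orbit [n <= N1]. With equality
    throughout, the given basis comes from the group up to a constant invertible matrix, and Saito's
    criterion compares its determinant with [f]. *)
Lemma lfd_analysis : quiver_lfd K P ->
  good K (@src P) (@tgt P) (@dvec P) /\
  exists D : 'cV[K]_n -> Prop, is_associated_group D (@PGL_image K P) /\
    forall t y, t != 0 -> (D (t *: y) <-> D y).
Proof.
case=> -[/card_gt0P[i0 _] _] sinc [D [[x0 _ DU] [f [f0 rf Df] [m [A [logA freeA]]]] assoc faith]].
have d_i0 := sinc i0.
have [N1 [e1 [e1P NE]]] := slice_enum d_i0.
pose v0 : 'cV[K]_n := rep_vec x0.
have fU y : peval f y != 0 <-> gl_orbit v0 y.
  rewrite -rep_orbitE; split=> [fy|oy].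
    apply: boolp.contrapT => no; move/negP: fy; apply; apply/eqP/Df; exact/DU.
  by apply/negP => /eqP /Df /DU.
have fv0 : peval f v0 != 0 by apply/fU; exact: orbit_refl.
have stab : orbit_stable (P := P) (fun y => peval f y = 0).
  move=> g hg y fy; apply/eqP/negP => /negP /fU oy.
  have : gl_orbit v0 y.
    by apply: orbit_trans oy _; apply: orbit_sym; apply: orbit_act => //; exact: orbit_refl.
  by move/fU; rewrite fy eqxx.
have logB B : logarithmic f (linear_vf (lieact (P := P) B)) by exact: stable_logarithmic.
have [a ha] := boolp.choice (fun l : 'I_N1 =>
  log_linear_span freeA (logB (slice e1 (delta_mx l 0)))).
pose Q : 'M[K]_(m, N1) := \matrix_(k, l) a l k.
have hQ c : lieact (slice e1 c) = \sum_k (Q *m c) k 0 *: A k.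
  apply: cV_matrix_ext => y; rewrite -slice_actE mulmx_suml.
  apply/colP => i; rewrite mxE summxE.
  transitivity (\sum_l (\sum_k a l k *: (A k *m y)) i 0 * c l 0).
    apply: eq_bigr => l _; congr (_ * _); rewrite mxE ha mulmx_suml summxE [RHS]summxE.
    by apply: eq_bigr => k _; rewrite -scalemxAl.
  under eq_bigr do rewrite summxE mulr_suml.
  rewrite exchange_big; apply: eq_bigr => k _ /=; rewrite -scalemxAl mxE [(Q *m c) k 0]mxE mulr_suml.
  by apply: eq_bigr => l _; rewrite mxE [Q k l]mxE; ring.
have Qinj (c : 'cV[K]_N1) : Q *m c = 0 -> c = 0.
  move=> Qc; have : lieact (slice e1 c) = 0.
    by rewrite hQ Qc big1 // => k _; rewrite mxE scale0r.
  by move/(faithful_lie faith) => [x hx]; exact: (slice_scalar d_i0 e1P hx).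
have le1 : (N1 <= m)%N by rewrite -(col_inj_rank Qinj) rank_leq_row.
have le2 := free_size_le freeA f0.
have le3 := dominant_count d_i0 e1P f0 (fun y => proj1 (fU y)).
have Em : m = n by apply/eqP; rewrite eqn_leq le2 (leq_trans le3).
have EN : N1 = n by apply/eqP; rewrite eqn_leq le3 (leq_trans le1).
clear le1 le2 le3; subst m N1.
have uQ := unit_of_col_inj Qinj.
have hA l : A l = lieact (slice e1 (invmx Q *m delta_mx l 0)).
  rewrite hQ mulKVmx // (bigD1 l) //= big1 ?addr0 => [|k nk].
    by rewrite mxE !eqxx scale1r.
  by rewrite mxE (negbTE nk) scale0r.
pose Dl := \det (field_mx A).
have DlE y : peval Dl y = \det (\matrix_(i, l) (A l *m y) i 0).
  rewrite peval_det; congr (\det _); apply/matrixP => i l.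
  by rewrite [LHS]mxE [field_mx A i l]mxE peval_linear_vf [RHS]mxE.
have MA y (c : 'cV[K]_n) : (\matrix_(i, l) (A l *m y) i 0) *m c =
    slice_act e1 y *m (invmx Q *m c).
  have lin (u : 'cV[K]_n) : invmx Q *m u = \sum_l u l 0 *: (invmx Q *m delta_mx l 0).
    rewrite {1}(matrix_sum_delta u) mulmx_sumr; apply: eq_bigr => l _.
    by rewrite big_ord1 -scalemxAr.
  rewrite [in RHS]lin mulmx_sumr; apply/colP => i; rewrite mxE summxE.
  apply: eq_bigr => l _; rewrite mxE hA -scalemxAr [RHS]mxE slice_actE mulrC //.
have surj y : peval Dl y != 0 -> lie_surjective y.
  rewrite DlE -unitfE -unitmxE => uM; apply/(lie_surjectiveP d_i0 e1P) => e.
  exists (invmx Q *m (invmx (\matrix_(i, l) (A l *m y) i 0) *m e)).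
  by rewrite -MA mulKVmx.
(* Such an orbit is dense, hence meets the open orbit, hence equals it. *)
have DlU y : peval Dl y != 0 -> gl_orbit v0 y.
  move=> /surj sy; apply: boolp.contrapT => no; move/negP: f0; apply; apply/eqP.
  apply: (orbit_dense sy) => y' oy'; apply/eqP/negP => /negP /fU oy.
  by apply: no; apply: orbit_trans oy (orbit_sym oy').
have [h [k [eh ek]]] : exists h k, Dl = h * f /\ k * h = 1.
  apply: (saito_unit uncK f0 rf logA freeA) => y fy.
  by apply/eqP/negP => /negP /DlU /fU; rewrite fy eqxx.
have hne y : peval h y != 0.
  have := congr1 (fun p => peval p y) ek; rewrite /peval mevalM meval1 -!/(peval _ _) => e.
  by apply: contra_eq_neq e => ->; rewrite mulr0 eq_sym oner_neq0.
have Dlf y : peval Dl y != 0 <-> peval f y != 0.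
  by rewrite eh /peval mevalM mulf_eq0 negb_or -/(peval _ _) hne.
have Dlh t y : peval Dl (t *: y) = t ^+ n * peval Dl y.
  rewrite !DlE -detZ; congr (\det _); apply/matrixP => i l.
  by rewrite [LHS]mxE -scalemxAr [LHS]mxE [RHS]mxE [X in _ = _ * X]mxE.
have Dlb y : peval Dl y != 0 <-> lie_brick y.
  rewrite (lie_brickP d_i0 e1P); split=> [|inj].
    rewrite DlE -unitfE -unitmxE => uM c hc; have := MA y (Q *m c).
    rewrite mulKmx // hc => /(congr1 (mulmx (invmx (\matrix_(i, l) (A l *m y) i 0)))).
    by rewrite mulKmx // mulmx0 => /Qinj.
  rewrite DlE -unitfE -unitmxE; apply: unit_of_col_inj => c.
  by rewrite MA => /inj e; rewrite -[c](mulKVmx uQ) e mulmx0.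
split.
  apply: (good_of_enum (rep_index_enum P)).
  - exact: NE.
  - by exists v0; apply/brickP/Dlb/Dlf.
  exists (peval Dl); split=> //; first exact: pf_peval; last by move=> y; rewrite Dlb brickP.
  apply/mradicalP => g e [w ew]; have [|w' ew'] := rf g e.
    by exists (w * h); rewrite ew eh mulrA.
  exists (w' * k); rewrite ew' eh; have -> : w' * k * (h * f) = w' * (k * h) * f by ring.
  by rewrite ek mulr1.
exists D; split=> // t y t0; rewrite !Df; split=> fy; apply/eqP/negP => /negP /Dlf.
  have /negP nz : ~~ (peval Dl (t *: y) != 0) by apply/negP => /Dlf; rewrite fy eqxx.
  by move=> h1; apply: nz; rewrite Dlh mulf_neq0 // expf_neq0.
have /negP nz : ~~ (peval Dl y != 0) by apply/negP => /Dlf; rewrite fy eqxx.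
by rewrite Dlh mulf_eq0 negb_or => /andP[_].
Qed.

End Quiver.
End LfdAnalysis.

(** * From bricks to linear free divisors *)

Section RegularZeros.
Variable K : numFieldType.

Lemma spanning_family (T : Type) N (r : T -> 'rV[K]_N) :
  (forall x : 'cV_N, (forall t, r t *m x = 0) -> x = 0) ->
  exists t : 'I_N -> T, \matrix_i r (t i) \in unitmx.
Proof.
move=> h.
suff [k [t ft]] : exists k (t : 'I_k -> T), (k = N) /\ row_free (\matrix_i r (t i)).
  by case: ft => e; subst k => ft; exists t; rewrite -row_free_unit.
have step k : (k <= N)%N -> exists t : 'I_k -> T, row_free (\matrix_i r (t i)).
  elim: k => [|k IH] lt.
    have [|t _] := @boolp.choice _ _ (fun (_ : 'I_0) (_ : T) => True); first by case.
    by exists t; rewrite /row_free flatmx0 mxrank0.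
  have [t ft] := IH (ltnW lt); set M := \matrix_i r (t i) in ft.
  have [j hj] : exists j, col j (cokermx M) != 0.
    apply: boolp.contrapT => no; have c0 : cokermx M = 0.
      apply/matrixP => i j; rewrite [RHS]mxE; apply: boolp.contrapT => nz; apply: no.
      exists j; apply/negP => /eqP /colP /(_ i); rewrite [LHS]mxE [RHS]mxE; exact: nz.
    have := mxrank_coker M; rewrite c0 mxrank0 => /esym/eqP; rewrite subn_eq0.
    by move: ft; rewrite /row_free => /eqP ->; rewrite leqNgt lt.
  have [t0 ht0] : exists t0, r t0 *m col j (cokermx M) != 0.
    apply: boolp.contrapT => no; move/eqP: hj; apply; apply: h => t0.
    by apply/eqP/negP => /negP nz; apply: no; exists t0.
  have nsub : ~~ (r t0 <= M)%MS.
    apply/negP => /submxP[D e]; move/negP: ht0; apply; apply/eqP.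
    by rewrite e -mulmxA colE (mulmxA M) mulmx_coker mul0mx mulmx0.
  exists (fun i => if unlift ord0 i is Some i' then t i' else t0).
  rewrite -kermx_eq0; apply/eqP/row_matrixP => i; rewrite row0.
  set w := row i _.
  have w0 : w *m \matrix_i r (if unlift ord0 i is Some i' then t i' else t0) = 0.
    by rewrite /w -row_mul mulmx_ker row0.
  have e : w 0 ord0 *: r t0 + (\row_l w 0 (lift ord0 l)) *m M = 0.
    rewrite -[RHS]w0; apply/rowP => l; rewrite [RHS]mxE big_ord_recl mxE; congr (_ + _).
      by rewrite !mxE unlift_none.
    by rewrite mxE; apply: eq_bigr => a _; rewrite !mxE liftK.
  have z0 : w 0 ord0 = 0.
    apply/eqP/negP => /negP nz; move/negP: nsub; apply.
    rewrite -[r t0](scalerK nz) scalemx_sub //; move/eqP: e; rewrite addr_eq0 => /eqP ->.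
    by rewrite -mulNmx submxMl.
  move: e; rewrite z0 scale0r add0r => e.
  have z : \row_l w 0 (lift ord0 l) = 0 by apply: (row_free_inj ft); rewrite /= mul0mx.
  apply/rowP => l; rewrite [RHS]mxE; case: (unliftP ord0 l) => [l'|] -> //.
  by move/rowP/(_ l'): z; rewrite !mxE.
by have [t ft] := step N (leqnn N); exists N, t.
Qed.

Lemma regular_zero N (d : 'cV[K]_N -> K) (phi : 'cV[K]_N -> K) : regular d phi ->
  exists p : {mpoly K[N]}, forall x, d x != 0 -> (peval p x = 0 <-> phi x = 0).
Proof.
move=> [e [h [/pf_mpoly[p ep] eh]]]; exists p => x dx; rewrite -ep eh //.
split=> [/eqP|->]; last by rewrite mulr0.
by rewrite mulf_eq0 expf_eq0 (negbTE dx) andbF => /eqP.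
Qed.

Lemma zariski_closed_zeros N (I : Type) (p : I -> {mpoly K[N]}) :
  zariski_closed (fun x : 'cV[K]_N => forall i, peval (p i) x = 0).
Proof.
exists (fun q => exists i, q = p i) => x; split=> [h q [i ->] //|h i].
by apply: h; exists i.
Qed.

(** Any two points are joined inside [S] by a rational curve defined on a nonempty open part of the
    line, and two nonempty open parts of a line always meet. *)
Lemma line_connected N (S : 'cV[K]_N -> Prop) : (exists x, S x) ->
  (forall u1 u2, S u1 -> S u2 -> exists (dl : K^o -> K) (ga : K^o -> 'cV[K]_N),
    [/\ pf dl /\ rmap dl ga, dl 0 != 0 /\ dl 1 != 0, ga 0 = u1, ga 1 = u2 &
      forall t, dl t != 0 -> S (ga t)]) -> zariski_connected S.
Proof.
move=> S0 line; split=> // -[Z1 [Z2 [[[I1 c1] [I2 c2]] cov dis [u1 [S1 Z1u]] [u2 [S2 Z2u]]]]].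
have [dl [ga [[pdl rga] [d0 d1] g0 g1 gS]]] := line _ _ S1 S2.
have nz (I : {mpoly K[N]} -> Prop) (Z : 'cV[K]_N -> Prop) u :
    (forall x, Z x <-> (forall p, I p -> peval p x = 0)) -> ~ Z u -> exists2 p, I p & peval p u != 0.
  move=> c nZ; apply: boolp.contrapT => no; apply: nZ; apply/c => p Ip.
  by apply/eqP/negP => /negP np; apply: no; exists p.
have [p1 I1p p1u] : exists2 p, I1 p & peval p u2 != 0.
  by apply: (nz _ _ _ c1) => Z1u2; exact: (dis _ S2 (conj Z1u2 Z2u)).
have [p2 I2p p2u] : exists2 p, I2 p & peval p u1 != 0.
  by apply: (nz _ _ _ c2) => Z2u1; exact: (dis _ S1 (conj Z1u Z2u1)).
have r1 := regular_comp pdl rga (pf_peval p1); have r2 := regular_comp pdl rga (pf_peval p2).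
have [e1 [h1 [ph1 eh1]]] := r1.
have h1nz : exists t, h1 t != 0.
  by exists 1; rewrite eh1 // g1 mulf_neq0 // expf_neq0.
have z : forall t, dl t != 0 -> peval p2 (ga t) = 0.
  apply: (@regular_eq0 _ _ _ pdl _ h1 r2 ph1 h1nz) => t dt ht.
  case: (cov _ (gS _ dt)) => [/c1/(_ _ I1p) e|/c2/(_ _ I2p) //].
  by move: ht; rewrite eh1 // e mulr0 eqxx.
by move: p2u; rewrite -g0 z ?eqxx.
Qed.

Lemma cramer_entry (R : comNzRingType) N (E : 'M[R]_N) (u : 'cV[R]_N) j :
  (\adj E *m u) j 0 = \det (\matrix_(a, b) if b == j then u a 0 else E a b).
Proof.
rewrite (expand_det_col _ j) mxE; apply: eq_bigr => a _.
rewrite [\adj E j a]mxE [X in _ = X * _]mxE eqxx mulrC; congr (_ * _).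
rewrite /cofactor; congr (_ * \det _); apply/matrixP => b c; rewrite !mxE.
by rewrite [lift j c == j]eq_sym (negbTE (neq_lift j c)).
Qed.

End RegularZeros.

(** * Saito's criterion, from the determinant to a basis *)

Section SaitoCriterion.
Variable K : numClosedFieldType.

Lemma free_of_det n (f : {mpoly K[n]}) (A : 'I_n -> 'M[K]_n) :
  f != 0 -> mradical f -> (forall l, logarithmic f (linear_vf (A l))) ->
  \det (field_mx A) = f -> forall delta, logarithmic f delta ->
  exists! c : 'rV[{mpoly K[n]}]_n, delta = \sum_l c 0 l *: linear_vf (A l).
Proof.
move=> f0 rf logA dE delta ld; set E := field_mx A in dE.
have comb (c : 'rV[{mpoly K[n]}]_n) : \sum_l c 0 l *: linear_vf (A l) = E *m c^T.
  apply/colP => i; rewrite summxE mxE; apply: eq_bigr => l _.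
  by rewrite [LHS]mxE [E i l]mxE [c^T l 0]mxE mulrC.
have detlog (M : 'M[{mpoly K[n]}]_n) : (forall j, logarithmic f (col j M)) -> pdivides f (\det M).
  move=> /boolp.choice[b hb]; apply: (radical_jacobian f0 rf) => i.
  pose g : 'rV[{mpoly K[n]}]_n := \row_i f^`M(i).
  have gM : g *m M = f *: (\row_j b j).
    apply/rowP => j; rewrite !mxE mulrC -hb /vf_apply; apply: eq_bigr => a _.
    by rewrite !mxE mulrC.
  have := congr1 (fun X => (X *m \adj M) 0 i) gM.
  rewrite -mulmxA mul_mx_adj mul_mx_scalar -scalemxAl !mxE => ->.
  by eexists; rewrite mulrC.
(* By Cramer's rule this entry is the determinant of logarithmic fields with one column replaced by
   [delta]; its quotient by [f = \det E] is the coefficient sought. *)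
have dvd j : pdivides f ((\adj E *m delta) j 0).
  rewrite cramer_entry; apply: detlog => l.
  have [->|nl] := eqVneq l j.
    congr (logarithmic f _): ld; apply/colP => a; by rewrite !mxE eqxx.
  congr (logarithmic f _): (logA l); apply/colP => a.
  by rewrite [RHS]mxE [RHS]mxE (negbTE nl) [RHS]mxE.
have [q hq] := boolp.choice dvd.
have inj (u w : 'cV[{mpoly K[n]}]_n) : E *m u = E *m w -> u = w.
  move=> /(congr1 (mulmx (\adj E))); rewrite !mulmxA !mul_adj_mx dE !mul_scalar_mx => /colP e.
  by apply/colP => i; have := e i; rewrite !mxE => /(mulfI f0).
have e0 : delta = E *m (\row_l q l)^T.
  apply/colP => i; apply: (mulfI f0).
  have -> : f * delta i 0 = (f%:M *m delta) i 0 by rewrite mul_scalar_mx mxE.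
  rewrite -dE -mul_mx_adj -mulmxA mxE [in RHS]mxE mulr_sumr; apply: eq_bigr => l _.
  by rewrite hq dE !mxE; ring.
exists (\row_l q l); split; first by rewrite comb.
by move=> c; rewrite comb {1}e0 => ec; apply: trmx_inj; apply: inj.
Qed.

End SaitoCriterion.

(** * Polynomial families that move points of an orbit to a base point *)

Section Transporter.
Variable K : numFieldType.
Variable P : dquiver.
Notation n := (rep_dim P).

Section Full.
Variables (N : nat) (e0 : 'I_N -> vertex P * nat * nat).
Hypothesis e0P : enumerates e0 (fun z => (z.1.2 < dvec z.1.1)%N && (z.2 < dvec z.1.1)%N).

Lemma slice_full (B : GLfamily K P) : exists c, B = slice e0 c.
Proof.
exists (\col_l mx_entries (B (e0 l).1.1) (e0 l).1.2 (e0 l).2).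
apply: boolp.functional_extensionality_dep => i; apply/matrixP => u v; rewrite [RHS]mxE.
have [ie ce] := e0P; have [|l el] := proj1 (ce (i, nat_of_ord u, nat_of_ord v)).
  by rewrite /= !ltn_ord.
by rewrite -el extend_on // mxE el /= mx_entriesE.
Qed.

Lemma slice_eq0 c : (forall i, slice (K := K) e0 c i = 0) -> c = 0.
Proof.
move=> h; apply/colP => l; rewrite mxE; have [ie ce] := e0P.
have /ce/andP[] := ex_intro (fun i => e0 i = e0 l) l erefl.
rewrite -(extend_on (c^~ 0) l ie); case: (e0 l) => [[i u] v] /= hu hv.
by have /matrixP/(_ (Ordinal hu) (Ordinal hv)) := h i; rewrite !mxE /=.
Qed.

End Full.

(* The homomorphisms from [y] to [v] are the zeros of [hom_act v y]. *)
Definition hom_act (v y : 'cV[K]_n) (B : GLfamily K P) : 'cV[K]_n :=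
  rep_vec (fun a => B (tgt a) *m mx_rep y a - mx_rep v a *m B (src a)).

Lemma hom_act_lin v y a B C :
  hom_act v y (fun i => a *: B i + C i) = a *: hom_act v y B + hom_act v y C.
Proof.
rewrite /hom_act -rep_vec_lin; apply: eq_rep_vec => b.
by rewrite mulmxDl mulmxDr -scalemxAl -scalemxAr scalerBr opprD addrACA.
Qed.

Lemma hom_act_end v B : hom_act v v B = lieact B *m v.
Proof. by rewrite lieactE. Qed.

Lemma hom_act_eq0 v y B : hom_act v y B = 0 <->
  forall a, B (tgt a) *m mx_rep y a = mx_rep v a *m B (src a).
Proof.
split=> [h a|h].
  have z : hom_act v y B = rep_vec (fun a => 0).
    by rewrite h; apply/colP => i; rewrite !mxE /= mxE.
  by have /rep_vec_inj/(_ a)/eqP := z; rewrite subr_eq0 => /eqP.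
by apply/colP => i; rewrite mxE [RHS]mxE /= h subrr mxE.
Qed.

Lemma hom_act_transport v y B : hom_act v y B = 0 -> in_GL B -> grpact B *m y = v.
Proof.
move=> /hom_act_eq0 h hB; rewrite grpactE -[RHS]mx_repK; apply: eq_rep_vec => a.
by rewrite /rep_act h mulmxK.
Qed.

Lemma transport_hom_act v y g : grpact g *m y = v -> in_GL g -> hom_act v y g = 0.
Proof.
by move=> <- hg; apply/hom_act_eq0 => a; rewrite grpactE rep_vecK /rep_act mulmxKV.
Qed.

Lemma hom_act_compose v y g B : in_GL g -> grpact g *m y = v ->
  hom_act v y B = 0 -> lieact (fam_mul B (fam_inv g)) *m v = 0.
Proof.
move=> hg gy /hom_act_eq0 h; have /hom_act_eq0 hh := transport_hom_act gy hg.
apply/lieact_eq0 => a; apply/eqP; rewrite subr_eq0 /fam_mul /fam_inv; apply/eqP.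
rewrite mulmxA -h -!mulmxA; congr (_ *m _).
by rewrite -[LHS](mulmxK (hg (src a))) -[_ *m mx_rep v a *m _]mulmxA -hh mulmxA mulVmx // mul1mx.
Qed.

Section Kernel.
Variables (e0 : 'I_n.+1 -> vertex P * nat * nat).
Hypothesis e0P : enumerates e0 (fun z => (z.1.2 < dvec z.1.1)%N && (z.2 < dvec z.1.1)%N).
Variable v : 'cV[K]_n.

(** The [n] equations in [n + 1] unknowns, completed by a free last row; expanding along that row
    exposes the maximal minors. *)
Definition bordered (y : 'cV[K]_n) (r : 'rV[K]_n.+1) : 'M[K]_n.+1 :=
  \matrix_(i, j) if unlift ord_max i is Some i' then
    hom_act v y (slice e0 (delta_mx j 0)) i' 0 else r 0 j.

(* The maximal minors of the matrix of [hom_act v y], a polynomial solution of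
   the homogeneous system [hom_act v y B = 0]. *)
Definition transporter (y : 'cV[K]_n) : GLfamily K P :=
  slice e0 (\col_j cofactor (bordered y 0) ord_max j).

Lemma bordered_row y r (c : 'cV[K]_n.+1) i :
  (bordered y r *m c) (lift ord_max i) 0 = hom_act v y (slice e0 c) i 0.
Proof.
have lin : linform (fun c : 'cV[K]_n.+1 => hom_act v y (slice e0 c) i 0).
  move=> a b w; have -> : slice e0 (a *: b + w) = (fun i => a *: slice e0 b i + slice e0 w i).
    by apply: boolp.functional_extensionality_dep => l; exact: slice_lin.
  by rewrite hom_act_lin !mxE.
rewrite mxE [RHS](linform_mx lin); apply: eq_bigr => j _.
by rewrite big_ord1 mxE liftK mulrC.
Qed.

Lemma bordered_last y r (c : 'cV[K]_n.+1) : (bordered y r *m c) ord_max 0 = (r *m c) 0 0.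
Proof. by rewrite !mxE; apply: eq_bigr => j _; rewrite mxE unlift_none. Qed.

Lemma transporter_hom y : hom_act v y (transporter y) = 0.
Proof.
apply/colP => i; rewrite -(bordered_row y 0) [RHS]mxE.
have := congr1 (fun M : 'M_n.+1 => M (lift ord_max i) ord_max) (mul_mx_adj (bordered y 0)).
rewrite mxE [X in _ = X]mxE eq_sym (negbTE (neq_lift _ _)) mulr0n => e.
by rewrite -[RHS]e mxE; apply: eq_bigr => j _; rewrite [X in _ * X = _]mxE [X in _ = _ * X]mxE.
Qed.

Lemma det_bordered y r : \det (bordered y r) =
  (r *m (\col_j cofactor (bordered y 0) ord_max j)) 0 0.
Proof.
rewrite (expand_det_row _ ord_max) mxE; apply: eq_bigr => j _.
rewrite !mxE unlift_none; congr (_ * _); rewrite /cofactor; congr (_ * \det _).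
by apply/matrixP => a b; rewrite !mxE liftK.
Qed.

(** When the solutions form a line spanned by [B], bordering by a coordinate that is nonzero on [B]
    gives an invertible matrix, whose determinant is one of the minors. *)
Lemma transporter_neq0 y (B : GLfamily K P) : hom_act v y B = 0 ->
  (forall C, hom_act v y C = 0 -> exists x, forall i, C i = x *: B i) ->
  (exists i, B i != 0) -> exists i, transporter y i != 0.
Proof.
move=> hB span [i0 nz]; apply: boolp.contrapT => no.
have t0 : \col_j cofactor (bordered y 0) ord_max j = 0.
  apply: (slice_eq0 e0P) => i; apply/eqP/negP => /negP h; by apply: no; exists i.
have [b eb] := slice_full e0P B.
have [j bj] : exists j, b j 0 != 0.
  apply: boolp.contrapT => nj; move/negP: nz; apply; apply/eqP.
  rewrite eb; apply/matrixP => u w; rewrite !mxE /extend big1 // => l _.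
  have [->|nl] := eqVneq (b l 0) 0; first by rewrite mul0r.
  by case: nj; exists l.
have u : bordered y (delta_mx 0 j) \in unitmx.
  apply: unit_of_col_inj => c e.
  have hc : hom_act v y (slice e0 c) = 0.
    by apply/colP => i; rewrite -(bordered_row y (delta_mx 0 j)) e !mxE.
  have [x hx] := span _ hc.
  have cx : c = x *: b.
    apply/eqP; rewrite -subr_eq0; apply/eqP; apply: (slice_eq0 e0P) => i.
    by rewrite addrC -scaleN1r scalerA slice_lin hx eb mulN1r scaleNr addNr.
  have := bordered_last y (delta_mx 0 j) c; rewrite e mxE -rowE mxE => /esym cj.
  have x0 : x = 0.
    by move/eqP: cj; rewrite cx mxE mulf_eq0 (negbTE bj) orbF => /eqP.
  by rewrite cx x0 scale0r.
by move: u; rewrite unitmxE det_bordered t0 mulmx0 mxE unitfE eqxx.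
Qed.

Lemma pf_transporter i u w : pf (fun y => transporter y i u w).
Proof.
apply: (@pf_ext _ _ (fun y => extend e0 (fun j => cofactor (bordered y 0) ord_max j) (i, nat_of_ord u, nat_of_ord w))).
  by move=> y; rewrite [RHS]mxE; apply: eq_extend => j; rewrite mxE.
apply: pf_sum => j; apply: pf_mul; last exact: pf_const.
apply: pf_mul; first exact: pf_const.
apply: pf_det => a b; apply: (@pf_ext _ _ (fun y => bordered y 0 (lift ord_max a) (lift j b))).
  by move=> y; rewrite !mxE.
apply: (@pf_ext _ _ (fun y => hom_act v y (slice e0 (delta_mx (lift j b) 0)) a 0)).
  by move=> y; rewrite [RHS]mxE liftK.
set C := slice _ _.
case E : (enum_val a : rep_coord P) => [c [l m]].
apply: (@pf_ext _ _ (fun y => \sum_k C (tgt c) l k * mx_rep y c k m - \sum_k mx_rep v c l k * C (src c) k m)).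
  by move=> y; rewrite mxE E /= !mxE.
apply: pf_add; last exact: pf_const.
apply: pf_sum => k; apply: pf_mul; first exact: pf_const.
apply: pf_linform => x y z; by rewrite mx_rep_lin !mxE.
Qed.

Hypothesis d_pos : forall i : vertex P, (0 < dvec i)%N.
Hypothesis brick_v : lie_brick v.

(** If [g] carries [y] to [v], composing with its inverse turns homomorphisms into endomorphisms of
    the brick [v]; so they are multiples of [g], and the transporter is a nonzero one. *)
Lemma transporter_GL y : gl_orbit v y -> in_GL (transporter y).
Proof.
move=> /orbit_sym[g hg /esym gy] i0.
have span C : hom_act v y C = 0 -> exists x, forall i, C i = x *: g i.
  move=> hC; have [x hx] := brick_v (hom_act_compose hg gy hC).
  exists x => i; have := hx i; rewrite /fam_mul /fam_inv => /(congr1 (mulmxr (g i))) /=.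
  by rewrite mulmxKV // mul_scalar_mx.
have gnz i : g i != 0.
  apply/negP => /eqP z; have := mulmxV (hg i); rewrite z mul0mx.
  move=> /matrixP/(_ (Ordinal (d_pos i)) (Ordinal (d_pos i))); rewrite !mxE eqxx => /esym/eqP.
  by rewrite oner_eq0.
have [|i nz] := transporter_neq0 (transport_hom_act gy hg) span; first by exists i0.
have [x hx] := span _ (transporter_hom y).
have x0 : x != 0 by apply: contraNneq nz => x0; rewrite hx x0 scale0r.
by rewrite hx unitmxZ ?unitfE.
Qed.

Lemma transporter_act y : gl_orbit v y -> grpact (transporter y) *m y = v.
Proof. by move=> /transporter_GL; apply: hom_act_transport; exact: transporter_hom. Qed.

End Kernel.
End Transporter.

(** * Good pairs are quiver linear free divisors *)

Section LfdOfGood.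
Variable K : numClosedFieldType.
Hypothesis uncK : uncountable_type K.
Variable P : dquiver.
Notation n := (rep_dim P).

(** The projection onto the connected component of a vertex is an endomorphism, hence a scalar. *)
Lemma connected_of_brick (y : 'cV[K]_n) (i0 : vertex P) : sincere P -> lie_brick y ->
  quiver_connected P.
Proof.
move=> sinc br; split=> [|i j]; first by apply/card_gt0P; exists i0.
pose B : GLfamily K P := fun l => (connect (@adjacent P) i l)%:R%:M.
have [|c hc] := br B.
  apply/lieact_eq0 => a; rewrite /fam_act /B.
  have E : connect (@adjacent P) i (tgt a) = connect (@adjacent P) i (src a).
    apply/idP/idP => h; apply: connect_trans h _; apply: connect1; rewrite /adjacent;
      by apply/existsP; exists a; rewrite !eqxx ?orbT.
  by rewrite E mul_scalar_mx mul_mx_scalar subrr.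
have val l : (connect (@adjacent P) i l)%:R = c.
  have /matrixP/(_ (Ordinal (sinc l)) (Ordinal (sinc l))) := hc l.
  by rewrite !mxE eqxx !mulr1n.
have := val j; rewrite -(val i) connect0; case: (connect _ _ _) => // /eqP.
by rewrite eq_sym oner_eq0.
Qed.

Lemma faithful_of_brick (y : 'cV[K]_n) : lie_brick y -> PGL_faithful K P.
Proof.
move=> br g hg triv; apply: br; apply/lieact_eq0 => a; apply/eqP; rewrite subr_eq0; apply/eqP.
have /rep_vec_inj/(_ a) := triv (mx_rep y); rewrite /rep_act => e.
by rewrite -[in RHS]e mulmxKV.
Qed.

Lemma PGL_subgroup : GL_subgroup (@PGL_image K P).
Proof.
split=> [A /PGL_imageP[g hg ->]||A B /PGL_imageP[g hg ->] /PGL_imageP[h hh ->]|A /PGL_imageP[g hg ->]].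
- exact: grpact_unit.
- apply/PGL_imageP; exists (fam_scal 1); first exact/in_GL_scal/oner_neq0.
  by rewrite grpact_scal ?oner_neq0.
- by apply/PGL_imageP; exists (fam_mul g h); [exact: in_GL_mul|rewrite grpact_mul].
- apply/PGL_imageP; exists (fam_inv g); first exact: in_GL_inv.
  by rewrite -[LHS]mul1mx -(grpact_inv hg) mulmxK // grpact_unit.
Qed.

Lemma PGL_connected : connected_matrices (@PGL_image K P).
Proof.
apply: line_connected => [|u1 u2 /PGL_imageP[g1 hg1 e1] /PGL_imageP[g2 hg2 e2]].
  exists (mxvec 1%:M)^T; rewrite trmxK mxvecK; by have [_] := PGL_subgroup.
pose g (t : K^o) : GLfamily K P := fun i => g1 i + t *: (g2 i - g1 i).
have pfg i u v : pf (fun t => g t i u v).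
  apply: (@pf_ext _ _ (fun t : K^o => g1 i u v + t * (g2 i - g1 i) u v)).
    by move=> t; rewrite !mxE.
  apply: pf_add; first exact: pf_const.
  by apply: pf_mul; [exact: pf_linform|exact: pf_const].
have pd := pf_fam_det pfg.
have g0 : g 0 = g1.
  by apply: boolp.functional_extensionality_dep => i; rewrite /g scale0r addr0.
have g1E : g 1 = g2.
  by apply: boolp.functional_extensionality_dep => i; rewrite /g scale1r addrC subrK.
exists (fun t => fam_det (g t)), (fun t => (mxvec (grpact (g t)))^T); split.
- split=> //; apply: (rmap_mx pd) => i j; case/mxvec_indexP: i => a b.
  apply: (@regular_ext _ _ _ (fun t => grpact (g t) a b)) => [t _|]; last exact: regular_grpact.
  by rewrite [RHS]mxE ord1 mxvecE.
- by rewrite g0 g1E; split; exact/in_GLP.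
- by rewrite g0 -e1 vec_mxK trmxK.
- by rewrite g1E -e2 vec_mxK trmxK.
- by move=> t /in_GLP dt; rewrite trmxK mxvecK; apply/PGL_imageP; exists (g t).
Qed.

Lemma PGL_preserves (v0 : 'cV[K]_n) : preserves (@PGL_image K P) (fun y => ~ gl_orbit v0 y).
Proof.
move=> A /PGL_imageP[g hg ->] y; split=> no o; apply: no.
  exact: orbit_act.
apply: orbit_trans o _; apply: orbit_sym; apply: orbit_act => //; exact: orbit_refl.
Qed.

Section Base.
Variables (i0 : vertex P) (e1 : 'I_n -> vertex P * nat * nat).
Variable e0 : 'I_n.+1 -> vertex P * nat * nat.
Hypothesis sinc : sincere P.
Hypothesis e1P : enumerates e1 (fun z => [&& (z.1.2 < dvec z.1.1)%N,
  (z.2 < dvec z.1.1)%N & z != (i0, 0%N, 0%N)]).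
Hypothesis e0P : enumerates e0 (fun z => (z.1.2 < dvec z.1.1)%N && (z.2 < dvec z.1.1)%N).
Notation Delta y := (\det (slice_act (K := K) e1 y)).

Lemma slice_act_entry y i j : slice_act (K := K) e1 y i j = (lieact (slice e1 (delta_mx j 0)) *m y) i 0.
Proof. by rewrite mxE. Qed.

Lemma pf_Delta : pf (fun y => Delta y).
Proof.
apply: pf_det => i j; apply: pf_linform => a u v.
by rewrite !slice_act_entry mulmxDr -scalemxAr !mxE.
Qed.

Lemma Delta_homog t y : Delta (t *: y) = t ^+ n * Delta y.
Proof.
rewrite -detZ; congr (\det _); apply/matrixP => i j.
by rewrite [RHS]mxE !slice_act_entry -scalemxAr mxE.
Qed.

Lemma Delta_brick y : Delta y != 0 <-> lie_brick y.
Proof.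
rewrite (lie_brickP (sinc i0) e1P) -unitfE -unitmxE; split=> [u c|]; last exact: unit_of_col_inj.
by move=> /(congr1 (mulmx (invmx (slice_act e1 y)))); rewrite mulKmx // mulmx0.
Qed.

Lemma Delta_surjective y : Delta y != 0 <-> lie_surjective y.
Proof.
rewrite (lie_surjectiveP (sinc i0) e1P) -unitfE -unitmxE; split=> [u e|h].
  by exists (invmx (slice_act e1 y) *m e); rewrite mulKVmx.
have [c hc] := boolp.choice (fun j => h (delta_mx j 0)).
have e : slice_act e1 y *m (\matrix_(i, j) c j i 0) = 1%:M.
  apply/matrixP => i j; have /colP/(_ i) := hc j; rewrite !mxE eqxx andbT => <-.
  by apply: eq_bigr => l _; rewrite mxE.
by case: (mulmx1_unit e).
Qed.

Lemma lieact_slice_sum c : lieact (slice (K := K) e1 c) =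
  \sum_l c l 0 *: lieact (slice e1 (delta_mx l 0)).
Proof.
apply/matrixP => i j; rewrite summxE.
have lin : linform (fun c : 'cV[K]_n => lieact (slice e1 c) i j).
  move=> a u w; have -> : slice e1 (a *: u + w) = (fun i => a *: slice e1 u i + slice e1 w i).
    by apply: boolp.functional_extensionality_dep => l; exact: slice_lin.
  by rewrite lieact_lin !mxE.
by rewrite (linform_mx lin); apply: eq_bigr => l _; rewrite big_ord1 [RHS]mxE.
Qed.

Variables (v0 : 'cV[K]_n) (f : {mpoly K[n]}).
Hypothesis brick_v0 : lie_brick v0.
Hypothesis fE : forall y, peval f y = Delta y.
Hypothesis rad_f : mradical f.

Lemma f_neq0 : f != 0.
Proof. by have /Delta_brick := brick_v0; apply: contra => /eqP f0; rewrite -fE f0 /peval meval0. Qed.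

(** A nonzero value makes the orbit of [y] dense. The determinant of the transporter is a nonzero
    polynomial, so it is nonzero at some point of that orbit, which is then moved to [v0]. *)
Lemma orbit_brick y : peval f y != 0 <-> gl_orbit v0 y.
Proof.
rewrite fE; split=> [/Delta_surjective sy|[g hg ->]]; last first.
  by apply/Delta_surjective; apply: lie_surjective_act => //; apply/Delta_surjective/Delta_brick.
have pq := pf_fam_det (pf_transporter e0 v0); have [q hq] := pf_mpoly pq.
apply: boolp.contrapT => no.
have q0 : q = 0.
  apply: (orbit_dense sy) => y' oy; apply: boolp.contrapT => /eqP; rewrite -hq => /in_GLP gy.
  apply: no; apply: orbit_trans (orbit_sym oy); apply: orbit_sym.
  by exists (transporter e0 v0 y') => //; rewrite (hom_act_transport (transporter_hom e0 v0 y') gy).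
have /in_GLP := transporter_GL e0P sinc brick_v0 (orbit_refl v0).
by rewrite hq q0 /peval meval0 eqxx.
Qed.

Let A l := lieact (slice (K := K) e1 (delta_mx l 0)).

Lemma orbit_logarithmic l : logarithmic f (linear_vf (A l)).
Proof.
apply: stable_logarithmic => // g hg y fy; apply/eqP/negP => /negP /orbit_brick o.
have /orbit_brick : gl_orbit v0 y.
  by apply: orbit_trans o _; apply: orbit_sym; apply: orbit_act => //; exact: orbit_refl.
by rewrite fy eqxx.
Qed.

Lemma field_mx_det : \det (field_mx A) = f.
Proof.
apply: peval_inj => y; rewrite fE peval_det; congr (\det _); apply/matrixP => i j.
by rewrite slice_act_entry [LHS]mxE [field_mx A i j]mxE peval_linear_vf.
Qed.

Let freeA := free_of_det f_neq0 rad_f orbit_logarithmic field_mx_det.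

(** Infinitesimal invariance of [f] makes [X] logarithmic, hence an element of the Lie algebra of
    the group; killing a brick, it is zero. *)
Lemma stabilizer_annihilator (X : 'M[K]_n) : X *m v0 = 0 ->
  (forall v, \sum_i (X *m v) i 0 * peval f^`M(i) v = 0) -> X = 0.
Proof.
move=> Xv h; have /(log_linear_span freeA)[a ea] : logarithmic f (linear_vf X).
  exists 0; rewrite mul0r; apply: peval_eq0 => v; by rewrite peval_vf_apply.
have eX : X = lieact (slice e1 (\col_l a l)).
  by rewrite ea lieact_slice_sum; apply: eq_bigr => l _; rewrite mxE.
have /(lie_brickP (sinc i0) e1P) inj := brick_v0.
have a0 : \col_l a l = 0 by apply: inj; rewrite slice_actE -eX.
by rewrite eX lieact_slice_sum big1 // => l _; rewrite a0 mxE scale0r.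
Qed.

(** The composite of [f] with [s] is a multiple of [f] of the same degree, and [v0] shows that the
    constant is 1. *)
Lemma stabilizer_invariant (s : 'M[K]_n) : s *m v0 = v0 ->
  (forall v, peval f v = 0 -> peval f (s *m v) = 0) ->
  forall v, peval f (s *m v) = peval f v.
Proof.
move=> sv h; have pG : pf (fun v => peval f (s *m v)).
  apply: (@pf_comp _ _ _ (mulmx s)); last exact: pf_peval.
  by apply: polymap_lin => a u w; rewrite mulmxDr -scalemxAr.
have [m dv] := pf_nullstellensatz uncK (pf_peval f) pG h.
have /mradicalP rF := rad_f; have [q pq eq] := rF _ _ pG dv.
have hF t x : peval f (t *: x) = t ^+ n * peval f x by rewrite !fE Delta_homog.
have hG t x : peval f (s *m (t *: x)) = t ^+ n * peval f (s *m x) by rewrite -scalemxAr hF.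
have fv0 : peval f v0 != 0 by apply/orbit_brick; exact: orbit_refl.
have qc := pf_homog_const (pf_peval f) pq hF hG eq fv0.
have q1 : q 0 = 1.
  by apply: (mulIf fv0); rewrite mul1r -{2}sv eq (qc v0).
by move=> v; rewrite eq qc q1 mul1r.
Qed.

(* The equations [s v0 = v0] and [f (s v) = f v] can be written [J(s)(s - 1) = 0]
   where the linear system [J(1)] is injective, so that [1] is isolated
   among the linear maps satisfying them. *)
Lemma stabilizer_isolated : exists D : 'M[K]_n -> K,
  [/\ pf D, D 1%:M != 0 & forall s, s *m v0 = v0 ->
    (forall v, peval f (s *m v) = peval f v) -> D s != 0 -> s = 1%:M].
Proof.
have [q [pq eq dq]] := peval_telescope f.
(* Linear in [X]. At [X = s - 1] the conditions express [s v0 = v0] and [f(s v) = f(v)]; at [s = 1]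
   they are those of [stabilizer_annihilator]. *)
pose phi (s X : 'M[K]_n) (t : 'I_n + 'cV[K]_n) : K := match t with
  | inl i => (X *m v0) i 0
  | inr v => \sum_i (X *m v) i 0 * q i (s *m v) v end.
pose R s t : 'rV[K]_(n * n) := \row_j phi s (vec_mx (delta_mx 0 j)) t.
have RE s t (x : 'cV_(n * n)) : (R s t *m x) 0 0 = phi s (vec_mx x^T) t.
  have lin : linform (fun x : 'cV[K]_(n * n) => phi s (vec_mx x^T) t).
    move=> a u w; rewrite linearP linearP /=; case: t => [i|v] /=.
      by rewrite mulmxDl -scalemxAl !mxE.
    rewrite mulr_sumr -big_split; apply: eq_bigr => i _ /=.
    by rewrite mulmxDl -scalemxAl mxE [(_ *: (_ *m v)) i 0]mxE mulrDl mulrA.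
  rewrite mxE (linform_mx lin); apply: eq_bigr => j _.
  by rewrite big_ord1 mxE mulrC trmx_delta.
(* Among the infinitely many conditions, [n * n] already determine [X] at [s = 1]; their determinant
   is the function sought. *)
have [|T uT] := @spanning_family K _ _ (R 1%:M).
  move=> x hx; have X0 : vec_mx x^T = 0 :> 'M_n.
    apply: stabilizer_annihilator => [|v].
      by apply/colP => i; have := RE 1%:M (inl i) x; rewrite hx mxE /= => <-; rewrite mxE.
    have := RE 1%:M (inr v) x; rewrite hx mxE /= mul1mx => /esym h; rewrite -[RHS]h.
    by apply: eq_bigr => i _; rewrite dq.
  by rewrite -[x]trmxK -[x^T]vec_mxK X0 linear0 trmx0.
exists (fun s => \det (\matrix_i R s (T i))); split.
- apply: pf_det => i j; apply: (@pf_ext _ _ (fun s => phi s (vec_mx (delta_mx 0 j)) (T i))).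
    by move=> s; rewrite !mxE.
  case: (T i) => [l|v] /=; first exact: pf_const.
  apply: pf_sum => l; apply: pf_mul; first exact: pf_const.
  apply: (@pf_comp _ _ _ (fun s : 'M[K]_n => (s *m v, v) : ('cV[K]_n * 'cV[K]_n)%type)
    (fun w => q l w.1 w.2)) => //.
  apply: polymap_pair; last by move=> m hm; exact: pf_const.
  by apply: polymap_lin => a u w; rewrite mulmxDl -scalemxAl.
- by rewrite -unitfE -unitmxE.
move=> s sv sf; rewrite -unitfE -unitmxE => u.
have z : (\matrix_i R s (T i)) *m (mxvec (s - 1%:M))^T = 0.
  apply/row_matrixP => i; rewrite row0 row_mul rowK; apply/rowP => j; rewrite ord1 [RHS]mxE.
  rewrite RE trmxK mxvecK; case: (T i) => [l|v] /=.
    by rewrite mulmxBl sv mul1mx subrr mxE.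
  have := eq (s *m v) v; rewrite sf subrr => /esym h; rewrite -[RHS]h.
  by apply: eq_bigr => l _; rewrite mulmxBl mul1mx !mxE.
have := congr1 (mulmx (invmx (\matrix_i R s (T i)))) z; rewrite mulKmx // mulmx0.
move=> /(congr1 (fun x => vec_mx x^T)); rewrite trmxK mxvecK trmx0 linear0.
by move/eqP; rewrite subr_eq0 => /eqP.
Qed.

(** Correct each [h] by the group element carrying [h v0] back to [v0]. The result [s] fixes [v0]
    and still preserves the divisor, so either [s = 1] and [h] comes from the group, or [D s = 0].
    These two closed conditions exclude each other, and the identity satisfies the first. *)
Lemma PGL_maximal (H : 'M[K]_n -> Prop) : GL_subgroup H -> connected_matrices H ->
  preserves H (fun y => ~ gl_orbit v0 y) -> forall h, H h -> PGL_image h.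
Proof.
move=> [unH H1 HM HV] [_ conH] presH h Hh; apply: boolp.contrapT => nPh.
have [D [pD D1 iso]] := stabilizer_isolated.
pose T := transporter e0 v0.
have orbH g : H g -> gl_orbit v0 (g *m v0).
  move=> Hg; apply: boolp.contrapT => no; have /(presH _ Hg) := no; apply.
  exact: orbit_refl.
pose m (x : 'cV[K]_(n * n)) : 'M[K]_n := vec_mx x^T.
pose dl x := fam_det (T (m x *m v0)).
pose s x := grpact (T (m x *m v0)) *m m x.
have pm i j : pf (fun x => m x i j).
  by apply: pf_linform => a u w; rewrite /m linearP linearP !mxE.
have pT i u w : pf (fun x => T (m x *m v0) i u w).
  apply: (@pf_comp _ _ _ (fun x => m x *m v0) (fun y => T y i u w)); last exact: pf_transporter.
  by apply: polymap_lin => a b c; rewrite /m linearP linearP mulmxDl -scalemxAl.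
have pdl : pf dl := pf_fam_det pT.
have rs i j : regular dl (fun x => s x i j).
  apply: (@regular_ext _ _ _ (fun x => \sum_l grpact (T (m x *m v0)) i l * m x l j)).
    by move=> x _; rewrite [RHS]mxE.
  apply: (regular_sum pdl) => l; apply: regular_mul; first exact: regular_grpact.
  exact: regular_pf.
have rs1 (ij : 'I_n * 'I_n) : regular dl (fun x => s x ij.1 ij.2 - (1%:M : 'M[K]_n) ij.1 ij.2).
  by apply: (regular_add pdl) => //; apply: regular_pf; exact: pf_const.
(* Closed sets require polynomials, so regular functions are replaced by numerators; the denominator
   [dl] does not vanish on [H]. *)
have [p hp] := boolp.choice (fun ij => regular_zero (rs1 ij)).
have [p2 hp2] := regular_zero (regular_comp pdl (rmap_mx pdl rs) pD).
have dlH x : H (m x) -> dl x != 0.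
  by move=> Hx; apply/in_GLP; apply: transporter_GL => //; exact: orbH.
have s1P x : H (m x) -> ((forall ij, peval (p ij) x = 0) <-> s x = 1%:M).
  move=> Hx; split=> [z|e ij]; last by apply/hp; [exact: dlH|rewrite e subrr].
  apply/matrixP => i j; apply/eqP; rewrite -subr_eq0; apply/eqP.
  by have /hp := z (i, j); apply; exact: dlH.
have PGL1 x : H (m x) -> s x = 1%:M -> PGL_image (m x).
  move=> Hx sx; have hT : in_GL (T (m x *m v0)) by apply/in_GLP; exact: dlH.
  apply/PGL_imageP; exists (fam_inv (T (m x *m v0))); first exact: in_GL_inv.
  by rewrite -[LHS]mul1mx -(grpact_inv hT) -mulmxA -/(s x) sx mulmx1.
apply: conH; exists (fun x => forall ij, peval (p ij) x = 0), (fun x => forall _ : unit, peval p2 x = 0).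
have mK g : m (mxvec g)^T = g by rewrite /m trmxK mxvecK.
have stab x : H (m x) -> D (s x) != 0 -> s x = 1%:M.
  move=> Hx; have hT : in_GL (T (m x *m v0)) by apply/in_GLP; exact: dlH.
  have sv : s x *m v0 = v0 by rewrite -mulmxA; apply: transporter_act => //; exact: orbH.
  apply: iso => //; apply: stabilizer_invariant => // v fv.
  have nv : ~ gl_orbit v0 v by move/orbit_brick; rewrite fv eqxx.
  apply/eqP/negP => /negP /orbit_brick; rewrite -mulmxA.
  have PT : PGL_image (grpact (T (m x *m v0))) by apply/PGL_imageP; exists (T (m x *m v0)).
  by apply/(PGL_preserves v0 PT)/(presH _ Hx).
split.
- split; exact: zariski_closed_zeros.
- move=> x Hx; have [z|nz] := eqVneq (D (s x)) 0.
    by right=> _; apply/hp2 => //; exact: dlH.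
  by left; apply/s1P => //; exact: stab.
- move=> x Hx [/s1P e /(_ tt)/hp2]; rewrite e //; move=> z; move: D1; rewrite z ?eqxx //.
  exact: dlH.
- exists (mxvec 1%:M)^T; split; first by rewrite trmxK mxvecK.
  have Hx : H (m (mxvec 1%:M)^T) by rewrite mK.
  apply/s1P => //; rewrite /s mK mul1mx mulmx1.
  have [c hc] : exists c, forall i, T v0 i = c%:M.
    by apply: brick_v0; rewrite -hom_act_end; exact: transporter_hom.
  have hT : in_GL (T v0) by apply: transporter_GL => //; exact: orbit_refl.
  have c0 : c != 0.
    have := hT i0; rewrite hc unitmxE det_scalar unitfE expf_eq0 negb_and.
    by have := sinc i0; case: (dvec i0).
  have -> : T v0 = @fam_scal K P c by apply: boolp.functional_extensionality_dep => i; exact: hc.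
  exact: grpact_scal.
- exists (mxvec h)^T; split; first by rewrite trmxK mxvecK.
  have Hx : H (m (mxvec h)^T) by rewrite mK.
  move=> _; apply/hp2; first exact: dlH.
  apply/eqP/negP => /negP /(stab _ Hx) /(PGL1 _ Hx); rewrite mK; exact: nPh.
Qed.

Lemma quiver_lfd_of_brick : quiver_lfd K P.
Proof.
split=> //; first exact: (connected_of_brick i0 sinc brick_v0).
have DE y : peval f y = 0 <-> ~ gl_orbit v0 y.
  rewrite -orbit_brick; split=> [->|/negP]; first by rewrite eqxx.
  by rewrite negbK => /eqP.
exists (fun y => ~ gl_orbit v0 y); split.
- exists (mx_rep v0) => [|v]; last by rewrite rep_orbitE mx_repK.
  exists (fun q => q = f) => x; rewrite rep_orbitE mx_repK -DE.
  by split=> [h q ->|h] //; exact: h.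
- exists f; first by split=> [|g m|x]; [exact: f_neq0|exact: rad_f|rewrite DE].
  by exists n, A; split; [exact: orbit_logarithmic|exact: freeA].
- split; [exact: PGL_subgroup|exact: PGL_connected|exact: PGL_preserves|exact: PGL_maximal].
- exact: (faithful_of_brick brick_v0).
Qed.

End Base.

(** The abstract equation in [good] has the degree and the zeros of the determinant of [slice_act],
    which is therefore reduced as well. *)
Lemma lfd_of_good : sincere P -> good K (@src P) (@tgt P) (@dvec P) -> quiver_lfd K P.
Proof.
move=> sinc /(good_enum (rep_index_enum P))[hN [v0 /brickP bv0] D].
have [i0 _] : exists i0 : vertex P, true.
  apply: boolp.contrapT => no; move: hN; rewrite big1 // => i _; by case: no; exists i.
have [N1 [e1 [e1P E1]]] := slice_enum (sinc i0).
have [e0 he0] := enumerates_sigma (fun i : vertex P => dvec i) (fun i : vertex P => dvec i).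
have EN : N1 = n by move: hN; rewrite E1 => -[].
clear E1; subst N1; rewrite hN in e0 he0.
have [f hf] := pf_mpoly (pf_Delta e1).
apply: (@quiver_lfd_of_brick i0 e1 e0 sinc e1P he0 v0 f bv0) => [y|]; first by rewrite hf.
apply/mradicalP; apply: (disc_fun_unique uncK D (pf_peval f)) => [t x|x|].
- by rewrite -!hf Delta_homog.
- by rewrite -hf (Delta_brick sinc e1P) brickP.
- by exists v0; apply/brickP.
Qed.

End LfdOfGood.

(** * Reflections and heights *)

Section Reflections.
Variable K : numClosedFieldType.
Hypothesis uncK : uncountable_type K.

Lemma sum_delete (P : dquiver) (k : vertex P) (F : vertex P -> nat) :
  (\sum_(i : vertex (delete_vertex k)) F (val i) = \sum_(i | i != k) F i)%N.
Proof.
rewrite [RHS](reindex_omap (val : vertex (delete_vertex k) -> vertex P) insub) /=; last first.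
  by move=> i ik; rewrite insubT.
by apply: eq_bigl => i; rewrite (valP i) valK eqxx.
Qed.

(** Arrows at a vertex of dimension 0 carry no coordinates, so both quivers have the same
    representations and endomorphisms. *)
Lemma good_delete (P : dquiver) (k : vertex P) : dvec k = 0%N ->
  good K (@src P) (@tgt P) (@dvec P) ->
  good K (@src (delete_vertex k)) (@tgt (delete_vertex k)) (@dvec (delete_vertex k)).
Proof.
move=> dk; set Q := delete_vertex k.
have [eQ hQ] := ex_intro (fun e => enumerates e _) _ (rep_index_enum Q).
pose eP l : arrow P * nat * nat := (val (eQ l).1.1, (eQ l).1.2, (eQ l).2).
have [iQ cQ] := hQ.
have offk i u : (u < dvec i)%N -> i != k by apply: contraTneq => ->; rewrite dk.
have hP : enumerates eP (valid_coord (@src P) (@tgt P) (@dvec P)).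
  split=> [l m|[[a u] v]].
    rewrite /eP => -[/val_inj e1 e2 e3]; apply: iQ; move: e1 e2 e3.
    by case: (eQ l) (eQ m) => [[a u] v] [[b u'] v'] /= -> -> ->.
  split=> [/andP[/= hu hv]|[l <-]].
    have ha : (src a != k) && (tgt a != k) by rewrite (offk _ _ hu) (offk _ _ hv).
    have [|l el] := proj1 (cQ (exist _ a ha : arrow Q, u, v)); first by rewrite /valid_coord /= hu.
    by exists l; rewrite /eP el.
  have /cQ := ex_intro (fun m => eQ m = eQ l) l erefl.
  by rewrite /valid_coord /eP; case: (eQ l) => [[b u'] v'].
have repE y (a : arrow Q) u v : nat_rep (K := K) eP y (val a) u v = nat_rep eQ y a u v.
  rewrite /nat_rep /extend; apply: eq_bigr => l _.
  suff -> : (eP l == (val a, u, v)) = (eQ l == (a, u, v)) by [].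
  by rewrite /eP; case: (eQ l) => [[b u'] v'] /=; rewrite !xpair_eqE -val_eqE.
have brickE y : brick (@src P) (@tgt P) (@dvec P) (nat_rep (K := K) eP y) <->
    brick (@src Q) (@tgt Q) (@dvec Q) (nat_rep (K := K) eQ y).
  split=> br B hB.
    pose B' (i : vertex P) u v := if insub i is Some j then B (j : vertex Q) u v else 0.
    have B'E (j : vertex Q) u v : B' (val j) u v = B j u v by rewrite /B' valK.
    have [|c hc] := br B'.
      move=> a u v hu hv.
      have ha : (src a != k) && (tgt a != k) by rewrite (offk _ _ hu) (offk _ _ hv).
      pose b : arrow Q := exist _ a ha; have := hB b u v hu hv.
      congr (_ = _); apply: eq_bigr => j _; rewrite -[a]/(val b) repE.
        by rewrite -(B'E (tgt b)).
      by rewrite -(B'E (src b)).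
    by exists c => i u v hu hv; rewrite -B'E hc.
  have [|c hc] := br (fun j : vertex Q => B (val j)).
    move=> b u v hu hv; have := hB (val b) u v hu hv.
    by congr (_ = _); apply: eq_bigr => j _; rewrite repE.
  exists c => i u v hu hv; exact: (hc (exist _ i (offk _ _ hu))).
move=> /(good_enum hP)[hN [y hy] [F [pF rF hF FP]]].
apply: (good_of_enum hQ).
- by rewrite -hN [RHS](bigD1 k) //= dk mul0r add0r -sum_delete.
- by exists y; apply/brickE.
- exists F; split; [exact: pF|exact: rF|exact: hF|by move=> x; rewrite FP; exact: brickE].
Qed.

Lemma good_reverse (P : dquiver) (k : vertex P) : sincere P -> is_source k \/ is_sink k ->
  (exists a : arrow P, involves k a) -> good K (@src P) (@tgt P) (@dvec P) ->
  (dvec k <= neighbour_dim k)%N /\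
  good K (@src (reverse_at k)) (@tgt (reverse_at k)) (@reflected_dim P k).
Proof.
move=> sinc ssk ex G.
have o_k a : involves k a -> other_end k a != k.
  rewrite /involves /other_end; case: ssk => h; have := h a.
    by move=> tk; rewrite (negbTE tk) orbF => ->.
  by move=> sk; rewrite (negbTE sk).
have off a : ~~ involves k a -> src a != k /\ tgt a != k.
  by rewrite /involves negb_or => /andP.
have rev_off a : ~~ involves k a ->
    @src (reverse_at k) a = src a /\ @tgt (reverse_at k) a = tgt a.
  by move=> /negbTE ia; rewrite /= ia.
have d_off i : i != k -> reflected_dim k i = dvec i.
  by rewrite /reflected_dim => /negbTE ->.
have dk : reflected_dim k k = (neighbour_dim k - dvec k)%N by rewrite /reflected_dim eqxx.
case: ssk => h.
  have nE : (\sum_(a : arrow P | involves k a) reflected_dim k (other_end k a) = neighbour_dim k)%N.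
    by apply: eq_bigr => a ia; rewrite d_off ?o_k.
  have ends a : involves k a -> src a = k /\ tgt a = other_end k a.
    by rewrite /involves /other_end (negbTE (h a)) orbF => /eqP ->; rewrite eqxx.
  (* At a source the reversed quiver plays the sink side and [P] the reflected side. *)
  have E := @good_source_to_sink K uncK (vertex P) (arrow P) k (@involves P k) (@other_end P k)
    (@src (reverse_at k)) (@tgt (reverse_at k)) (@src P) (@tgt P) (@reflected_dim P k) (@dvec P) o_k.
  rewrite nE in E; apply: E => //.
  - by move=> a ia; have [e1 e2] := rev_off a ia; rewrite e1 e2; exact: off.
  - by move=> a ia; have [e1 e2] := ends a ia; rewrite /= ia.
  - by move=> a /rev_off[-> ->].
  - by move=> i /d_off ->.
  - by move=> i /d_off ->; exact: sinc.
have ends a : involves k a -> src a = other_end k a /\ tgt a = k.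
  by rewrite /involves /other_end (negbTE (h a)) /= => /eqP ->.
apply: (@good_sink_to_source K uncK (vertex P) (arrow P) k (@involves P k) (@other_end P k)
    (@src P) (@tgt P) (@src (reverse_at k)) (@tgt (reverse_at k)) (@dvec P) (@reflected_dim P k)) => //.
by move=> a ia; have [e1 e2] := ends a ia; rewrite /= ia.
Qed.

Lemma lfd_reflection (P : dquiver) (k : vertex P) : quiver_lfd K P ->
  is_source k \/ is_sink k -> (exists a : arrow P, involves k a) ->
  (dvec k <= neighbour_dim k)%N /\ quiver_lfd K (reflection k).
Proof.
move=> L ssk ex; have [_ sinc _] := L; have [G _] := lfd_analysis uncK L.
have [le G'] := good_reverse sinc ssk ex G; split=> //.
have dk : reflected_dim k k = (neighbour_dim k - dvec k)%N by rewrite /reflected_dim eqxx.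
rewrite /reflection; case: eqP => e.
  apply: (lfd_of_good uncK).
    by case=> i ik /=; rewrite /reflected_dim (negbTE ik); exact: sinc.
  apply: good_delete => //.
  by rewrite -[LHS]/(reflected_dim k k) dk e subnn.
apply: (lfd_of_good uncK) => // i; rewrite -[dvec i]/(reflected_dim k i) /reflected_dim.
case: eqP => [_|_]; last exact: sinc.
by rewrite subn_gt0 ltn_neqAle le andbT eq_sym; apply/eqP.
Qed.

End Reflections.

(** * Heights and reduction to bipartite quivers *)

Section Heights.
Variable K : numClosedFieldType.
Hypothesis uncK : uncountable_type K.

Definition graded (P : dquiver) (h : vertex P -> nat) : Prop :=
  forall a : arrow P, h (tgt a) = (h (src a)).+1.

Lemma homothety_PGL (P : dquiver) (D : 'cV[K]_(rep_dim P) -> Prop) t :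
  is_associated_group D (@PGL_image K P) ->
  (forall t y, t != 0 -> (D (t *: y) <-> D y)) -> t != 0 -> @PGL_image K P t%:M.
Proof.
move=> [_ _ _ max] cone t0.
apply: (max (fun A => exists2 t, t != 0 & A = t%:M)); last by exists t.
- split=> [A [x x0 ->]||A B [x x0 ->] [y y0 ->]|A [x x0 ->]].
  + by rewrite unitmxE det_scalar unitfE expf_neq0.
  + by exists 1; first exact: oner_neq0.
  + by exists (x * y); rewrite ?mulf_neq0 // scalar_mxM.
  + by exists x^-1; rewrite ?invr_eq0 // invmx_scalar.
- apply: line_connected => [|u w [x x0 ex] [y y0 ey]].
    by exists (mxvec 1%:M)^T; rewrite trmxK mxvecK; exists 1; first exact: oner_neq0.
  pose l (z : K^o) : K := x + z * (y - x).
  have pl : pf l.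
    apply: pf_add; first exact: pf_const.
    by apply: pf_mul; [exact: pf_linform|exact: pf_const].
  have l0 : l 0 = x by rewrite /l mul0r addr0.
  have l1 : l 1 = y by rewrite /l mul1r addrC subrK.
  exists l, (fun z => (mxvec (l z)%:M)^T); split.
  + split=> //; apply: (rmap_mx pl) => i j; case/mxvec_indexP: i => a b.
    apply: (@regular_ext _ _ _ (fun z => l z * (a == b)%:R)) => [z _|].
      by rewrite [RHS]mxE ord1 mxvecE mxE mulr_natr.
    by apply: regular_pf; apply: pf_mul => //; exact: pf_const.
  + by rewrite l0 l1.
  + by rewrite l0 -ex vec_mxK trmxK.
  + by rewrite l1 -ey vec_mxK trmxK.
  + by move=> z lz; rewrite trmxK mxvecK; exists (l z).
- by move=> A [x x0 ->] y; rewrite mul_scalar_mx; exact: cone.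
Qed.

(* If [g] acts on [Rep(Q,d)] as multiplication by [2] then each [g i] is a
   scalar, which doubles along every arrow; its logarithm is a height. *)
Lemma lfd_graded (P : dquiver) : quiver_lfd K P -> exists h : vertex P -> nat, graded h.
Proof.
move=> L; have [[_ con] sinc _] := L; have [_ [D [assoc cone]]] := lfd_analysis uncK L.
have two0 : 2 != 0 :> K by rewrite pnatr_eq0.
have [g hg gx] := homothety_PGL assoc cone two0.
have [[a0 _]|na] := boolp.pselect (exists a : arrow P, True); last first.
  by exists (fun=> 0%N) => a; case: na; exists a.
have gE (y : 'cV[K]_(rep_dim P)) a : g (tgt a) *m mx_rep y a = 2 *: (mx_rep y a *m g (src a)).
  have /rep_vec_inj/(_ a) e : rep_vec (rep_act g (mx_rep y)) = rep_vec (fun a => 2 *: mx_rep y a).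
    by rewrite gx mx_repK mul_scalar_mx -[in LHS](mx_repK y); apply/colP => i; rewrite !mxE /= !mxE.
  by rewrite scalemxAl -e /rep_act mulmxKV.
(* Tested on the representation whose only nonzero entry is [(u, v)] on the arrow [a]. *)
have entry a (u u' : 'I_(dvec (tgt a))) (v v' : 'I_(dvec (src a))) :
    g (tgt a) u' u * (v == v')%:R = 2 * ((u' == u)%:R * g (src a) v v').
  pose i : 'I_(rep_dim P) := enum_rank (Tagged (fun a : arrow P => ('I_(dvec (tgt a)) * 'I_(dvec (src a)))%type) (u, v)).
  have xE : mx_rep (delta_mx i 0 : 'cV[K]_(rep_dim P)) a = delta_mx u v.
    apply/matrixP => b c; rewrite !mxE eqxx andbT (inj_eq enum_rank_inj) eq_Tagged /=.
    by rewrite xpair_eqE.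
  have /matrixP/(_ u' v') := gE (delta_mx i 0) a; rewrite xE !mxE.
  rewrite (bigD1 u) //= big1 ?addr0 => [|b nb]; last by rewrite mxE (negbTE nb) mulr0.
  rewrite [X in _ = _ * X](bigD1 v) //= big1 ?addr0 => [|b nb]; last by rewrite mxE (negbTE nb) andbF mul0r.
  by rewrite !mxE !eqxx andbT /= [v == v']eq_sym.
pose c i : K := g i (Ordinal (sinc i)) (Ordinal (sinc i)).
have cE a : c (tgt a) = 2 * c (src a).
  by have := entry a (Ordinal (sinc _)) (Ordinal (sinc _)) (Ordinal (sinc _)) (Ordinal (sinc _));
     rewrite !eqxx mulr1 mul1r.
have c0 : c (src a0) != 0.
  have gs : g (src a0) = (c (src a0))%:M.
    apply/matrixP => v v'; have := entry a0 (Ordinal (sinc _)) (Ordinal (sinc _)) v v'.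
    rewrite eqxx mul1r mxE -[_ (Ordinal _) _]/(c (tgt a0)) cE -mulrA => /(mulfI two0) <-.
    by rewrite mulr_natr.
  have := hg (src a0); rewrite gs unitmxE det_scalar unitfE expf_eq0 negb_and.
  by have := sinc (src a0); case: (dvec (src a0)).
have pow (m : int) : 2 * 2 ^ m = 2 ^ (m + 1) :> K by rewrite expfzDr // expr1z mulrC.
(* As 2 is not a root of unity, the exponents relative to the base scalar are well defined. *)
have pow1 (z : int) : 2 ^ z = 1 :> K -> z = 0.
  have nat1 n : 2 ^+ n = 1 :> K -> n = 0%N.
    by move/eqP; rewrite -natrX pnatr_eq1 -(expn0 2) eqn_exp2l // => /eqP.
  case: z => n; first by move/nat1 => ->.
  by rewrite NegzE -exprnN => /(congr1 GRing.inv); rewrite invrK invr1 => /nat1.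
pose R i := exists m : int, c i = 2 ^ m * c (src a0).
have Radj i j : adjacent i j -> R i -> R j.
  move=> /existsP[a /orP[] /andP[/eqP <- /eqP <-]] [m em].
    by exists (m + 1); rewrite cE em mulrA pow.
  by exists (m - 1); apply: (mulfI two0); rewrite -cE em [RHS]mulrA pow subrK.
have Rall i : R i.
  have /connectP[p pp ->] := con (src a0) i.
  have : R (src a0) by exists 0; rewrite expr0z mul1r.
  elim: p (src a0) pp => //= j p IH x /andP[xj pj] Rx; apply: IH => //; exact: Radj Rx.
have [m hm] := boolp.choice Rall.
have ms a : m (tgt a) = m (src a) + 1.
  have := cE a; rewrite (hm (tgt a)) (hm (src a)) mulrA => /(mulIf c0); rewrite pow => e.
  apply/eqP; rewrite -subr_eq0; apply/eqP/pow1.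
  by rewrite expfzDr // e -expfzDr // subrr expr0z.
pose M : int := \sum_i `|m i|.
have Mge i : 0 <= m i + M.
  rewrite /M (bigD1 i) //= addrA; apply: addr_ge0; last exact: sumr_ge0.
  by rewrite -lerBlDl sub0r ler_normr lexx orbT.
exists (fun i => absz (m i + M)) => a; have := Mge (src a); rewrite ms; lia.
Qed.

Lemma source_edge (P : dquiver) (k j : vertex P) : quiver_connected P -> j != k ->
  exists a : arrow P, involves k a.
Proof.
move=> [_ /(_ k j)/connectP[[|x p] /= pp ->]]; first by rewrite eqxx.
case/andP: pp => /existsP[a /orP[] /andP[/eqP e1 /eqP e2]] _ _; exists a;
  by rewrite /involves ?e1 ?e2 eqxx ?orbT.
Qed.

(** Neighbours of the source [k] have height [h k + 1] and become its predecessors, which forces the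
    new height [h k + 2]. The vertex [j] keeps this below [B]; if [k] is deleted instead, the sum
    loses a positive term. *)
Lemma reflection_graded (P : dquiver) (k j : vertex P) (h : vertex P -> nat) B :
  graded h -> is_source k -> ((h k).+1 < h j)%N -> (forall i, h i <= B)%N ->
  exists h' : vertex (reflection k) -> nat, [/\ graded h', forall i, (h' i <= B)%N &
    (\sum_i (B.+1 - h' i) < \sum_i (B.+1 - h i))%N].
Proof.
move=> gh sk kj hB; pose h1 i := if i == k then (h k).+2 else h i.
have h1B i : (h1 i <= B)%N.
  by rewrite /h1; case: eqP => // _; exact: leq_trans kj (hB j).
have g1 (a : arrow P) : h1 (@tgt (reverse_at k) a) = (h1 (@src (reverse_at k) a)).+1.
  rewrite /= /involves /h1 (negbTE (sk a)) orbF; have [e|nk] := eqVneq (src a) k.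
    by rewrite e eqxx (negbTE (sk a)) gh e.
  by rewrite (negbTE (sk a)) (negbTE nk) gh.
have sumk : (\sum_(i | i != k) (B.+1 - h1 i) = \sum_(i | i != k) (B.+1 - h i))%N.
  by apply: eq_bigr => i /negbTE ik; rewrite /h1 ik.
have hk := hB k; rewrite /reflection; case: eqP => _.
  exists (fun i => h1 (val i)); split=> [a|i|]; [exact: g1|exact: h1B|].
  rewrite (@sum_delete (@DQuiver (reverse_at k) (reflected_dim k)) k (fun i => B.+1 - h1 i)%N) sumk.
  by rewrite [X in (_ < X)%N](bigD1 k) //=; lia.
exists h1; split=> //; rewrite [X in (X < _)%N](bigD1 k) //= sumk [X in (_ < X)%N](bigD1 k) //=.
by rewrite {1}/h1 eqxx; have := h1B k; rewrite /h1 eqxx; lia.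
Qed.

Lemma dquiver_iso_refl (P : dquiver) : dquiver_iso P P.
Proof. by exists id, id; split=> //; exists id. Qed.

Lemma equiv_bipartite (P : dquiver) : quiver_lfd K P ->
  exists P' : dquiver, [/\ quiver_lfd K P', lfd_equiv K P P' & oriented_bipartite P'].
Proof.
move=> L; have [h gh] := lfd_graded L.
have hB i : (h i <= \max_i h i)%N by exact: leq_bigmax.
(* The maximum is frozen as a bound [B] for the whole induction. Measuring from [B + 1] makes every
   term positive, so measure 0 cannot occur on a nonempty quiver. *)
move: {2}(\sum_i _)%N (leqnn (\sum_i ((\max_i h i).+1 - h i))%N) => N.
move: (\max_i h i)%N hB => B.
elim: N P h L gh => [|N IH] P h L gh hB le; have [[/card_gt0P[i0 _] con] sinc _] := L.
  by move: le; rewrite (bigD1 i0) //=; have := hB i0; lia.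
have [k _ kmin] := arg_minnP h (P := xpredT) (i0 := i0) isT.
(* Without such a [j] only the heights [h k] and [h k + 1] occur, and each arrow goes from the lower
   level to the upper one. *)
have [[j kj]|no] := boolp.pselect (exists j, ((h k).+1 < h j)%N); last first.
  have top j : (h j <= (h k).+1)%N by rewrite leqNgt; apply/negP => lt; apply: no; exists j.
  exists P; split=> //; first by apply: lfd_equiv_iso => //; exact: dquiver_iso_refl.
  exists [set i | h i == h k] => a; rewrite !inE; have := gh a.
  by have := top (tgt a); have := kmin (src a) isT; lia.
have sk : is_source k.
  by move=> a; apply/eqP => e; have := gh a; have := kmin (src a) isT; rewrite e; lia.
have ex : exists a : arrow P, involves k a.
  apply: (@source_edge P k j) => //; first by have [] := L.
  by apply/eqP => e; move: kj; rewrite e; lia.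
have [le' L'] := lfd_reflection uncK L (or_introl sk) ex.
have [h' [gh' hB' lt]] := reflection_graded gh sk kj hB.
have [|P' [LP' eq bip]] := IH _ h' L' gh' hB'; first by rewrite -ltnS; exact: leq_trans lt le.
exists P'; split=> //; apply: lfd_equiv_trans eq.
apply: lfd_equiv_reflection => //; exists k; split=> //; first by left.
exact: dquiver_iso_refl.
Qed.

End Heights.

Theorem theorem1p6 (R : realType) :
  (forall (P : dquiver) (k : vertex P),
     quiver_lfd R[i]%C P ->
     is_source k \/ is_sink k ->
     (exists a : arrow P, involves k a) ->
     (dvec k <= neighbour_dim k)%N /\ quiver_lfd R[i]%C (reflection k))
  /\
  (forall P : dquiver,
     quiver_lfd R[i]%C P ->
     exists P' : dquiver,
       [/\ quiver_lfd R[i]%C P',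
           lfd_equiv R[i]%C P P'
         & oriented_bipartite P']).
Proof.
have uncK := @complex_uncountable R.
by split=> [P k|P]; [exact: lfd_reflection|exact: equiv_bipartite].
Qed.
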